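(* Let $n\ge 2$ and let $\Gamma$ be a nonelementary torsion-free discrete subgroup of $\mathrm{SU}(n,1)$ (respectively of $\mathrm{Sp}(n,1)$). Then the following are equivalent: (i) there exists a discrete faithful representation $\rho:\Gamma\to\mathrm{SU}(n,1)$ (respectively $\rho:\Gamma\to\mathrm{Sp}(n,1)$) such that the trace field of $\rho(\Gamma)$ is contained in $\mathbb R$; (ii) there exists a discrete faithful representation $\rho:\Gamma\to\mathrm{SO}(n,1)$ (respectively $\rho:\Gamma\to\mathrm{O}(n,1)$).
   Context: $\mathrm{SU}(n,1)$ is the group of complex $(n+1)\times(n+1)$ matrices of determinant $1$ preserving the Hermitian form $w^*I_{n,1}z$, $I_{n,1}=\mathrm{diag}(1,\dots,1,-1)$. $\mathrm{Sp}(n,1)=\{A\in\mathrm{GL}(n+1,\mathbb H): A^*I_{n,1}A=I_{n,1}\}$ over the quaternions $\mathbb H$. $\mathrm{O}(n,1)$ and $\mathrm{SO}(n,1)$ are the real matrices in these groups (preserving $I_{n,1}$, resp. also with determinant $1$). Nonelementary means the limit set in the boundary of the corresponding hyperbolic space has more than two points. The trace of a (complex or quaternionic) matrix is the sum of its diagonal entries; the trace field of a group is the field (skew field in the quaternionic case) generated over $\mathbb Q$ by the traces of its elements. *)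

(* Defs.v *)
From HB Require Import structures.
From mathcomp Require Import all_boot all_order all_algebra.
From mathcomp Require Import complex reals Rstruct.
From Stdlib Require Rdefinitions.

Set Implicit Arguments.
Unset Strict Implicit.
Unset Printing Implicit Defensive.

Import Order.TTheory GRing.Theory Num.Theory.
Local Open Scope ring_scope.

Definition RR : realType := Rdefinitions.R.
Notation CC := (complex RR).

Section Generic.
Variables (M : Type) (mul : M -> M -> M) (e : M).

Definition is_subgroup (G : M -> Prop) : Prop :=
  [/\ G e,
      (forall g h, G g -> G h -> G (mul g h)) &
      (forall g, G g -> exists h, [/\ G h, mul g h = e & mul h g = e])].

Definition mpow (g : M) (k : nat) : M := iter k (mul g) e.

Definition torsion_free (G : M -> Prop) : Prop :=
  forall g, G g -> forall k, (0 < k)%N -> mpow g k = e -> g = e.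

Variable near : RR -> M -> M -> Prop.

Definition discrete (G : M -> Prop) : Prop :=
  forall g, G g -> exists2 eps : RR, 0 < eps &
    forall h, G h -> near eps g h -> h = g.

Definition image (G : M -> Prop) (rho : M -> M) : M -> Prop :=
  fun x => exists2 g, G g & rho g = x.

Definition discrete_faithful_rep (G : M -> Prop) (rho : M -> M)
    (Target : M -> Prop) : Prop :=
  [/\ (forall g, G g -> Target (rho g)),
      (forall g h, G g -> G h -> rho (mul g h) = mul (rho g) (rho h)),
      (forall g h, G g -> G h -> rho g = rho h -> g = h) &
      discrete (image G rho)].

(* Limit set in the boundary sphere of the ball model: points of the
   boundary which are accumulation points of the orbit of the origin. *)
Variables (P : Type) (orb0 : M -> P) (onSphere : P -> Prop)
  (nearP : RR -> P -> P -> Prop).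

Definition limit_set (G : M -> Prop) : P -> Prop :=
  fun xi => onSphere xi /\
    forall eps : RR, 0 < eps -> exists2 g, G g & nearP eps (orb0 g) xi.

Definition nonelementary (G : M -> Prop) : Prop :=
  exists x1 x2 x3, [/\ limit_set G x1, limit_set G x2, limit_set G x3 &
                       [/\ x1 <> x2, x1 <> x3 & x2 <> x3]].
End Generic.

Definition cnorm2 (z : CC) : RR := complex.Re z ^+ 2 + complex.Im z ^+ 2.

Definition Jc (n : nat) : 'M[CC]_(n.+1) :=
  \matrix_(i, j) (if i == j then (if i == ord_max then -1 else 1) else 0).

Definition cadj (n : nat) (A : 'M[CC]_(n.+1)) : 'M[CC]_(n.+1) :=
  (map_mx conjc A)^T.

Definition in_SU (n : nat) (A : 'M[CC]_(n.+1)) : Prop :=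
  cadj A *m Jc n *m A = Jc n /\ \det A = 1.

Definition real_cmx (n : nat) (A : 'M[CC]_(n.+1)) : Prop :=
  forall i j, complex.Im (A i j) = 0.

Definition in_SO (n : nat) (A : 'M[CC]_(n.+1)) : Prop :=
  in_SU A /\ real_cmx A.

Definition cnear (n : nat) (eps : RR) (A B : 'M[CC]_(n.+1)) : Prop :=
  forall i j, cnorm2 (B i j - A i j) < eps.

(* image of the origin of complex hyperbolic n-space (ball model) *)
Definition corb0 (n : nat) (g : 'M[CC]_(n.+1)) : 'rV[CC]_n :=
  \row_(i < n) (g (widen_ord (leqnSn n) i) ord_max / g ord_max ord_max).

Definition csphere (n : nat) (xi : 'rV[CC]_n) : Prop :=
  \sum_(i < n) cnorm2 (xi 0 i) = 1.

Definition cnearP (n : nat) (eps : RR) (x y : 'rV[CC]_n) : Prop :=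
  forall i, cnorm2 (y 0 i - x 0 i) < eps.

Definition c_nonelementary (n : nat) (G : 'M[CC]_(n.+1) -> Prop) : Prop :=
  nonelementary (@corb0 n) (@csphere n) (@cnearP n) G.

Record quat := Quat { qr : RR; qi : RR; qj : RR; qk : RR }.

Definition qzero : quat := Quat 0 0 0 0.
Definition qone : quat := Quat 1 0 0 0.
Definition qadd (p q : quat) : quat :=
  Quat (qr p + qr q) (qi p + qi q) (qj p + qj q) (qk p + qk q).
Definition qopp (p : quat) : quat := Quat (- qr p) (- qi p) (- qj p) (- qk p).
Definition qmul (p q : quat) : quat :=
  Quat (qr p * qr q - qi p * qi q - qj p * qj q - qk p * qk q)
       (qr p * qi q + qi p * qr q + qj p * qk q - qk p * qj q)
       (qr p * qj q - qi p * qk q + qj p * qr q + qk p * qi q)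
       (qr p * qk q + qi p * qj q - qj p * qi q + qk p * qr q).
Definition qconj (p : quat) : quat := Quat (qr p) (- qi p) (- qj p) (- qk p).
Definition qnorm2 (p : quat) : RR :=
  qr p ^+ 2 + qi p ^+ 2 + qj p ^+ 2 + qk p ^+ 2.
Definition qinv (p : quat) : quat :=
  let s := (qnorm2 p)^-1 in
  Quat (qr p * s) (- qi p * s) (- qj p * s) (- qk p * s).
Definition qreal (p : quat) : Prop := [/\ qi p = 0, qj p = 0 & qk p = 0].

Definition qmx_mul (n : nat) (A B : 'M[quat]_(n.+1)) : 'M[quat]_(n.+1) :=
  \matrix_(i, j) \big[qadd/qzero]_(k < n.+1) qmul (A i k) (B k j).
Definition qmx1 (n : nat) : 'M[quat]_(n.+1) :=
  \matrix_(i, j) (if i == j then qone else qzero).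
Definition qadj (n : nat) (A : 'M[quat]_(n.+1)) : 'M[quat]_(n.+1) :=
  \matrix_(i, j) qconj (A j i).
Definition qtr (n : nat) (A : 'M[quat]_(n.+1)) : quat :=
  \big[qadd/qzero]_(i < n.+1) A i i.
Definition Jq (n : nat) : 'M[quat]_(n.+1) :=
  \matrix_(i, j) (if i == j then (if i == ord_max then qopp qone else qone)
                  else qzero).

Definition in_Sp (n : nat) (A : 'M[quat]_(n.+1)) : Prop :=
  qmx_mul (qmx_mul (qadj A) (Jq n)) A = Jq n.

Definition real_qmx (n : nat) (A : 'M[quat]_(n.+1)) : Prop :=
  forall i j, qreal (A i j).

Definition in_O (n : nat) (A : 'M[quat]_(n.+1)) : Prop :=
  in_Sp A /\ real_qmx A.

Definition qnear (n : nat) (eps : RR) (A B : 'M[quat]_(n.+1)) : Prop :=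
  forall i j, qnorm2 (qadd (B i j) (qopp (A i j))) < eps.

(* image of the origin of quaternionic hyperbolic n-space (ball model);
   vectors are right H-modules, so we normalise on the right *)
Definition qorb0 (n : nat) (g : 'M[quat]_(n.+1)) : 'rV[quat]_n :=
  \row_(i < n) qmul (g (widen_ord (leqnSn n) i) ord_max)
                    (qinv (g ord_max ord_max)).

Definition qsphere (n : nat) (xi : 'rV[quat]_n) : Prop :=
  \sum_(i < n) qnorm2 (xi 0 i) = 1.

Definition qnearP (n : nat) (eps : RR) (x y : 'rV[quat]_n) : Prop :=
  forall i, qnorm2 (qadd (y 0 i) (qopp (x 0 i))) < eps.

Definition q_nonelementary (n : nat) (G : 'M[quat]_(n.+1) -> Prop) : Prop :=
  nonelementary (@qorb0 n) (@qsphere n) (@qnearP n) G.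

(* Main.v *)
(** Let G be the image of a discrete faithful representation with real traces.
    All estimates take place over the quaternions; SU(n,1) is embedded in
    Sp(n,1). Write <x, y> = x^* J y.

    If elements of G are normalised by the modulus of their last entry, which
    bounds all entries, unbounded sequences accumulate at rank one matrices
    u v^* J with u, v null, and the trace stays real on the closure of the real
    multiples of G. Multiplying such limits gives u d u^* J for some
    quaternion d <> 0. Reality of all traces tr(h u d u^* J h') forces the
    possible d to form a real line, and comparing d with d <u, h u> d shows
    that <u, h u> d is real for all h in G, with d real or purely imaginary.
    So the Hermitian form is, up to the factor d, real on the real span U of
    the orbit G u. If d is real, a maximal Lorentz orthonormal family of U
    spans U, and G acts on it through O(m,1) with m <= n. If d is imaginary,
    U is a plane with a symplectic form, and G acts through
    SL(2,R) -> SO(2,1). In both cases the action is proper on G, hence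
    discrete, and faithful because G is torsion-free.

    This needs that G fixes no null line. A nonelementary group contains a
    free semigroup of rank 2 by a ping-pong argument on rank one limits,
    and this passes to G. A discrete torsion-free group fixing a null line
    contains none: either it is commutative, or its words of length k have
    entries of size O(k^2), so that there are only polynomially many. *)

Require Import Defs.
From HB Require Import structures.
From mathcomp Require Import all_boot all_order all_algebra.
From mathcomp Require Import complex boolp reals Rstruct ring lra zify.
From mathcomp Require classical_sets filter topology normedtype.

Set Implicit Arguments.
Unset Strict Implicit.
Unset Printing Implicit Defensive.

Import Order.TTheory GRing.Theory Num.Theory.
Local Open Scope ring_scope.

(** * Quaternions *)

(** The first obstacle is that nonelementarity is assumed of the given group, while the geometry
    takes place in the image of a representation known only to be discrete and faithful, with an
    unknown limit set. It is therefore turned into a property that every injective homomorphism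
    preserves. A free semigroup suffices to exclude a fixed null line, and it needs ping-pong with
    contractions only, never with their inverses. The second obstacle is noncommutativity: a
    quaternionic trace is not cyclic. Its real part is, and this together with the geometry of null
    vectors replaces trace identities. Imaginary [d] does occur, for instance for SL(2,R) conjugated
    into SU(1,1), where all traces are real. Then every vector of [U] is null, so [U] contains no
    Lorentz frame and the representation itself has to change; [2 <= n] makes room for SO(2,1). *)

Definition quat_tuple (p : quat) : RR * RR * RR * RR :=
  (qr p, qi p, qj p, qk p).
Definition tuple_quat (t : RR * RR * RR * RR) : quat :=
  let: (a, b, c, d) := t in Quat a b c d.

Lemma quat_tupleK : cancel quat_tuple tuple_quat.
Proof. by case. Qed.

HB.instance Definition _ := Choice.copy quat (can_type quat_tupleK).

Lemma quat_eq (p q : quat) :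
  qr p = qr q -> qi p = qi q -> qj p = qj q -> qk p = qk q -> p = q.
Proof. by case: p; case: q => /= ? ? ? ? ? ? ? ? -> -> -> ->. Qed.

Lemma qaddA : associative qadd.
Proof. by move=> p q r; apply: quat_eq => /=; rewrite addrA. Qed.

Lemma qaddC : commutative qadd.
Proof. by move=> p q; apply: quat_eq => /=; rewrite addrC. Qed.

Lemma qadd0 : left_id qzero qadd.
Proof. by move=> p; apply: quat_eq => /=; rewrite add0r. Qed.

Lemma qaddN : left_inverse qzero qopp qadd.
Proof. by move=> p; apply: quat_eq => /=; rewrite addNr. Qed.

HB.instance Definition _ := GRing.isZmodule.Build quat qaddA qaddC qadd0 qaddN.

Lemma qmulA : associative qmul.
Proof. by move=> p q r; apply: quat_eq => /=; ring. Qed.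

Lemma qmul1l : left_id qone qmul.
Proof. by move=> p; apply: quat_eq => /=; ring. Qed.

Lemma qmul1r : right_id qone qmul.
Proof. by move=> p; apply: quat_eq => /=; ring. Qed.

Lemma qmulDl : left_distributive qmul qadd.
Proof. by move=> p q r; apply: quat_eq => /=; ring. Qed.

Lemma qmulDr : right_distributive qmul qadd.
Proof. by move=> p q r; apply: quat_eq => /=; ring. Qed.

Lemma qone_neq0 : qone != 0 :> quat.
Proof. by apply/eqP => -[] /eqP; rewrite oner_eq0. Qed.

HB.instance Definition _ := GRing.Zmodule_isNzRing.Build quat
  qmulA qmul1l qmul1r qmulDl qmulDr qone_neq0.

Lemma qnorm2_ge0 (p : quat) : 0 <= qnorm2 p.
Proof. by rewrite /qnorm2 !addr_ge0 ?sqr_ge0. Qed.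

Lemma qnorm2_eq0 (p : quat) : (qnorm2 p == 0) = (p == 0).
Proof.
apply/idP/eqP => [|->]; last by rewrite /qnorm2 /= !expr2 !mulr0 !addr0.
rewrite /qnorm2 !paddr_eq0 ?addr_ge0 ?sqr_ge0 // !sqrf_eq0.
by case/andP => /andP[/andP[/eqP ? /eqP ?] /eqP ?] /eqP ?; apply: quat_eq.
Qed.

Definition quat_unit : pred quat := [pred p | p != 0].
Definition quat_inv (p : quat) : quat := if p == 0 then p else qinv p.

Lemma quat_mulVr : {in quat_unit, left_inverse 1 quat_inv *%R}.
Proof.
move=> p; rewrite inE /quat_inv => p0; rewrite (negbTE p0).
have h : qnorm2 p != 0 by rewrite qnorm2_eq0.
by apply: quat_eq => /=; rewrite /qnorm2 in h *; field.
Qed.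

Lemma quat_mulrV : {in quat_unit, right_inverse 1 quat_inv *%R}.
Proof.
move=> p; rewrite inE /quat_inv => p0; rewrite (negbTE p0).
have h : qnorm2 p != 0 by rewrite qnorm2_eq0.
by apply: quat_eq => /=; rewrite /qnorm2 in h *; field.
Qed.

Lemma quat_unitP (p q : quat) : q * p = 1 /\ p * q = 1 -> quat_unit p.
Proof.
case=> qp _; apply/eqP => p0; move: qp; rewrite p0 mulr0 => /eqP.
by rewrite eq_sym oner_eq0.
Qed.

Lemma quat_inv_out : {in [predC quat_unit], quat_inv =1 id}.
Proof. by move=> p; rewrite !inE negbK /quat_inv => ->. Qed.

HB.instance Definition _ := GRing.NzRing_hasMulInverse.Build quat
  quat_mulVr quat_mulrV quat_unitP quat_inv_out.

Lemma quat_unitE (p : quat) : (p \is a GRing.unit) = (p != 0).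
Proof. by []. Qed.

Definition qreg (r : RR) : quat := Quat r 0 0 0.

Lemma qrD (p q : quat) : qr (p + q) = qr p + qr q. Proof. by []. Qed.
Lemma qiD (p q : quat) : qi (p + q) = qi p + qi q. Proof. by []. Qed.
Lemma qjD (p q : quat) : qj (p + q) = qj p + qj q. Proof. by []. Qed.
Lemma qkD (p q : quat) : qk (p + q) = qk p + qk q. Proof. by []. Qed.
Lemma qrN (p : quat) : qr (- p) = - qr p. Proof. by []. Qed.
Lemma qiN (p : quat) : qi (- p) = - qi p. Proof. by []. Qed.
Lemma qjN (p : quat) : qj (- p) = - qj p. Proof. by []. Qed.
Lemma qkN (p : quat) : qk (- p) = - qk p. Proof. by []. Qed.
Lemma qmulE (p q : quat) : p * q = qmul p q. Proof. by []. Qed.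
Lemma quat0E : 0 = Quat 0 0 0 0. Proof. by []. Qed.
Lemma quat1E : 1 = Quat 1 0 0 0. Proof. by []. Qed.
Definition qE := (qrD, qiD, qjD, qkD, qrN, qiN, qjN, qkN, qmulE, quat0E, quat1E).

Ltac qring := apply: quat_eq; rewrite ?qE /=; ring.

Lemma qreg_is_zmod_morphism : zmod_morphism qreg.
Proof. by move=> a b; qring. Qed.
Lemma qreg_is_monoid_morphism : monoid_morphism qreg.
Proof. by split=> // a b; qring. Qed.
HB.instance Definition _ := GRing.isZmodMorphism.Build RR quat qreg qreg_is_zmod_morphism.
HB.instance Definition _ := GRing.isMonoidMorphism.Build RR quat qreg qreg_is_monoid_morphism.

Lemma qconj_is_zmod_morphism : zmod_morphism qconj.
Proof. by move=> a b; qring. Qed.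
HB.instance Definition _ := GRing.isZmodMorphism.Build quat quat qconj qconj_is_zmod_morphism.

Lemma qr_is_zmod_morphism : zmod_morphism qr.
Proof. by []. Qed.
HB.instance Definition _ := GRing.isZmodMorphism.Build quat RR qr qr_is_zmod_morphism.

Lemma qregC (r : RR) (p : quat) : qreg r * p = p * qreg r.
Proof. by qring. Qed.
Lemma qconjM (p q : quat) : qconj (p * q) = qconj q * qconj p.
Proof. by qring. Qed.
Lemma qconjK : involutive qconj.
Proof. by move=> p; qring. Qed.
Lemma qconj_reg (r : RR) : qconj (qreg r) = qreg r.
Proof. by qring. Qed.
Lemma qconj1 : qconj 1 = 1.
Proof. by qring. Qed.
Lemma qmul_conjr (p : quat) : p * qconj p = qreg (qnorm2 p).
Proof. by rewrite /qnorm2; qring. Qed.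
Lemma qmul_conjl (p : quat) : qconj p * p = qreg (qnorm2 p).
Proof. by rewrite /qnorm2; qring. Qed.
Lemma qnorm2M (p q : quat) : qnorm2 (p * q) = qnorm2 p * qnorm2 q.
Proof. by rewrite /qnorm2 !qE /=; ring. Qed.
Lemma qnorm2_conj (p : quat) : qnorm2 (qconj p) = qnorm2 p.
Proof. by rewrite /qnorm2 /=; ring. Qed.
Lemma qnorm2_reg (r : RR) : qnorm2 (qreg r) = r ^+ 2.
Proof. by rewrite /qnorm2 /=; ring. Qed.
Lemma qr_mulC (p q : quat) : qr (p * q) = qr (q * p).
Proof. by rewrite !qE /=; ring. Qed.
Lemma qr_reg (r : RR) : qr (qreg r) = r. Proof. by []. Qed.
Lemma qr_regM (r : RR) (p : quat) : qr (qreg r * p) = r * qr p.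
Proof. by rewrite !qE /=; ring. Qed.
Lemma qrealP (p : quat) : qreal p <-> p = qreg (qr p).
Proof.
split=> [[pi pj pk]|->]; last by split.
by apply: quat_eq; rewrite ?pi ?pj ?pk.
Qed.
Lemma qreal_conjP (p : quat) : qreal p <-> qconj p = p.
Proof.
split=> [[pi pj pk]|]; first by apply: quat_eq; rewrite /= ?pi ?pj ?pk ?oppr0.
by case: p => a b c d [] /= *; split=> /=; lra.
Qed.
Lemma qreg_inj : injective qreg.
Proof. by move=> a b []. Qed.
Lemma qreg_eq0 (r : RR) : (qreg r == 0) = (r == 0).
Proof. by apply/eqP/eqP => [[]|->]. Qed.
Lemma quat_mulf_eq0 (p q : quat) : (p * q == 0) = (p == 0) || (q == 0).
Proof. by rewrite -!qnorm2_eq0 qnorm2M mulf_eq0. Qed.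
Lemma quat_invr_eq0 (p : quat) : (p^-1 == 0) = (p == 0).
Proof. by apply: negb_inj; have := unitrV p; rewrite !quat_unitE. Qed.
Lemma qconj_eq0 (p : quat) : (qconj p == 0) = (p == 0).
Proof. by rewrite -!qnorm2_eq0 qnorm2_conj. Qed.
Lemma qrealD p q : qreal p -> qreal q -> qreal (p + q).
Proof. by move=> /qrealP -> /qrealP ->; rewrite -rmorphD. Qed.
Lemma qreal_regM r p : qreal p -> qreal (qreg r * p).
Proof. by move=> /qrealP ->; rewrite -rmorphM. Qed.
Lemma qr_sqr_le (p : quat) : qr p ^+ 2 <= qnorm2 p.
Proof. by rewrite /qnorm2 -!addrA lerDl !addr_ge0 ?sqr_ge0. Qed.

Definition qabs (p : quat) : RR := Num.sqrt (qnorm2 p).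

Lemma qabs_ge0 (p : quat) : 0 <= qabs p.
Proof. exact: sqrtr_ge0. Qed.
Lemma qabs_sqr (p : quat) : qabs p ^+ 2 = qnorm2 p.
Proof. by rewrite sqr_sqrtr ?qnorm2_ge0. Qed.
Lemma qabsM (p q : quat) : qabs (p * q) = qabs p * qabs q.
Proof. by rewrite /qabs qnorm2M sqrtrM ?qnorm2_ge0. Qed.
Lemma qabs_conj (p : quat) : qabs (qconj p) = qabs p.
Proof. by rewrite /qabs qnorm2_conj. Qed.
Lemma qabs_reg (r : RR) : qabs (qreg r) = `|r|.
Proof. by rewrite /qabs qnorm2_reg sqrtr_sqr. Qed.
Lemma qabs0 : qabs 0 = 0.
Proof. by rewrite -[0]/(qreg 0) qabs_reg normr0. Qed.
Lemma qabs1 : qabs 1 = 1.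
Proof. by rewrite -[1]/(qreg 1) qabs_reg normr1. Qed.
Lemma qabs_eq0 (p : quat) : (qabs p == 0) = (p == 0).
Proof. by rewrite -qnorm2_eq0 -qabs_sqr sqrf_eq0. Qed.
Lemma qabs_gt0 (p : quat) : (0 < qabs p) = (p != 0).
Proof. by rewrite lt0r qabs_ge0 andbT qabs_eq0. Qed.
Lemma qabsN (p : quat) : qabs (- p) = qabs p.
Proof. by rewrite -mulN1r qabsM -[-1]/(- qreg 1) -raddfN qabs_reg normrN normr1 mul1r. Qed.
Lemma qr_le_abs (p : quat) : `|qr p| <= qabs p.
Proof. by rewrite -sqrtr_sqr ler_wsqrtr ?qr_sqr_le. Qed.
Lemma qabsD (p q : quat) : qabs (p + q) <= qabs p + qabs q.
Proof.
rewrite -(@ler_pXn2r _ 2) ?nnegrE ?addr_ge0 ?qabs_ge0 //.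
rewrite sqrrD !qabs_sqr -(qabs_conj q) -qabsM.
have := le_trans (ler_norm _) (qr_le_abs (p * qconj q)).
rewrite /qnorm2 !qE /= mulr2n; lra.
Qed.
Lemma qabsB (p q : quat) : qabs (p - q) <= qabs p + qabs q.
Proof. by rewrite -(qabsN q) qabsD. Qed.
Lemma qabs_distC (p q : quat) : qabs (p - q) = qabs (q - p).
Proof. by rewrite -qabsN opprB. Qed.
Lemma qr_sum (I : finType) (P : pred I) (F : I -> quat) :
  qr (\sum_(i | P i) F i) = \sum_(i | P i) qr (F i).
Proof. exact: raddf_sum. Qed.
Lemma qabs_sum (I : finType) (P : pred I) (F : I -> quat) :
  qabs (\sum_(i | P i) F i) <= \sum_(i | P i) qabs (F i).
Proof.
elim/big_ind2: _ => //; first by rewrite qabs0.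
by move=> a b c d ab cd; rewrite (le_trans (qabsD _ _)) ?lerD.
Qed.
Lemma qabsV (p : quat) : p != 0 -> qabs p^-1 = (qabs p)^-1.
Proof.
move=> p0; apply: (@mulIf _ (qabs p)); first by rewrite qabs_eq0.
by rewrite -qabsM mulVr ?quat_unitE // qabs1 mulVf ?qabs_eq0.
Qed.
Lemma qi_le_abs (p : quat) : `|qi p| <= qabs p.
Proof.
rewrite -sqrtr_sqr ler_wsqrtr // /qnorm2.
have := sqr_ge0 (qr p); have := sqr_ge0 (qi p).
have := sqr_ge0 (qj p); have := sqr_ge0 (qk p); lra.
Qed.
Lemma qj_le_abs (p : quat) : `|qj p| <= qabs p.
Proof.
rewrite -sqrtr_sqr ler_wsqrtr // /qnorm2.
have := sqr_ge0 (qr p); have := sqr_ge0 (qi p).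
have := sqr_ge0 (qj p); have := sqr_ge0 (qk p); lra.
Qed.
Lemma qk_le_abs (p : quat) : `|qk p| <= qabs p.
Proof.
rewrite -sqrtr_sqr ler_wsqrtr // /qnorm2.
have := sqr_ge0 (qr p); have := sqr_ge0 (qi p).
have := sqr_ge0 (qj p); have := sqr_ge0 (qk p); lra.
Qed.
Lemma qabs_le_coord (p : quat) :
  qabs p <= `|qr p| + `|qi p| + `|qj p| + `|qk p|.
Proof.
rewrite -(@ler_pXn2r _ 2) ?nnegrE ?addr_ge0 ?qabs_ge0 //.
rewrite qabs_sqr /qnorm2 -(real_normK (num_real (qr p))) -(real_normK (num_real (qi p))).
rewrite -(real_normK (num_real (qj p))) -(real_normK (num_real (qk p))).
have := normr_ge0 (qr p); have := normr_ge0 (qi p); have := normr_ge0 (qj p); have := normr_ge0 (qk p).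
move: `|_| `|_| `|_| `|_| => a b c d *; nra.
Qed.

(** * Quaternionic matrices and the Lorentzian form *)

Definition adj (m k : nat) (A : 'M[quat]_(m, k)) : 'M[quat]_(k, m) :=
  \matrix_(i, j) qconj (A j i).
(** Columns form a right module on which matrices act from the left. The left scaling [*:] commutes
    with that action only for real scalars. *)
Definition rs (m k : nat) (A : 'M[quat]_(m, k)) (q : quat) : 'M[quat]_(m, k) :=
  \matrix_(i, j) (A i j * q).
Definition mnorm (m k : nat) (A : 'M[quat]_(m, k)) : RR :=
  \sum_i \sum_j qabs (A i j).

Section Rectangular.
Variables (m k l : nat).
Implicit Types (A : 'M[quat]_(m, k)) (B : 'M[quat]_(k, l)).

Lemma adj_mul A B : adj (A *m B) = adj B *m adj A.
Proof.
apply/matrixP => i j; rewrite !mxE raddf_sum; apply: eq_bigr => s _ /=.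
by rewrite !mxE qconjM.
Qed.
Lemma mxBE (A A' : 'M[quat]_(m, k)) i j : (A - A') i j = A i j - A' i j.
Proof. by rewrite !mxE. Qed.
Lemma adjK A : adj (adj A) = A.
Proof. by apply/matrixP => i j; rewrite !mxE qconjK. Qed.
Lemma adj_is_zmod_morphism : zmod_morphism (@adj m k).
Proof. by move=> A A'; apply/matrixP => i j; rewrite !mxE raddfB. Qed.
HB.instance Definition _ := GRing.isZmodMorphism.Build _ _ (@adj m k) adj_is_zmod_morphism.
Lemma adj_regZ (r : RR) A : adj (qreg r *: A) = qreg r *: adj A.
Proof. by apply/matrixP => i j; rewrite !mxE qconjM qconj_reg qregC. Qed.
Lemma rs_mul A B q : A *m rs B q = rs (A *m B) q.
Proof.
apply/matrixP => i j; rewrite !mxE mulr_suml; apply: eq_bigr => s _.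
by rewrite !mxE mulrA.
Qed.
Lemma rs_rs A p q : rs (rs A p) q = rs A (p * q).
Proof. by apply/matrixP => i j; rewrite !mxE mulrA. Qed.
Lemma rs1 A : rs A 1 = A.
Proof. by apply/matrixP => i j; rewrite !mxE mulr1. Qed.
Lemma rs_reg A r : rs A (qreg r) = qreg r *: A.
Proof. by apply/matrixP => i j; rewrite !mxE qregC. Qed.
Lemma rsDr A p q : rs A (p + q) = rs A p + rs A q.
Proof. by apply/matrixP => i j; rewrite !mxE mulrDr. Qed.
Lemma rs0 A : rs A 0 = 0.
Proof. by apply/matrixP => i j; rewrite !mxE mulr0. Qed.

Lemma mnorm_ge0 A : 0 <= mnorm A.
Proof. by apply: sumr_ge0 => i _; apply: sumr_ge0 => j _; apply: qabs_ge0. Qed.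
Lemma mnorm_entry A i j : qabs (A i j) <= mnorm A.
Proof.
rewrite /mnorm (bigD1 i) //= (bigD1 j) //= -addrA lerDl addr_ge0 //.
  by apply: sumr_ge0 => ? _; apply: qabs_ge0.
by apply: sumr_ge0 => ? _; apply: sumr_ge0 => ? _; apply: qabs_ge0.
Qed.
Lemma mnorm_eq0 A : (mnorm A == 0) = (A == 0).
Proof.
apply/eqP/eqP => [h|->].
  apply/matrixP => i j; apply/eqP; rewrite mxE -qabs_eq0 eq_le qabs_ge0 andbT.
  by rewrite -h mnorm_entry.
by rewrite /mnorm big1 // => i _; rewrite big1 // => j _; rewrite mxE qabs0.
Qed.
Lemma mnorm0 : mnorm (0 : 'M[quat]_(m, k)) = 0.
Proof. by apply/eqP; rewrite mnorm_eq0. Qed.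
Lemma mnormD A A' : mnorm (A + A') <= mnorm A + mnorm A'.
Proof.
rewrite /mnorm -big_split; apply: ler_sum => i _; rewrite -big_split.
by apply: ler_sum => j _; rewrite mxE qabsD.
Qed.
Lemma mnormN A : mnorm (- A) = mnorm A.
Proof. by apply: eq_bigr => i _; apply: eq_bigr => j _; rewrite mxE qabsN. Qed.
Lemma mnormB A A' : mnorm (A - A') <= mnorm A + mnorm A'.
Proof. by rewrite -(mnormN A') mnormD. Qed.
Lemma mnorm_distC A A' : mnorm (A - A') = mnorm (A' - A).
Proof. by rewrite -mnormN opprB. Qed.
Lemma mnormZ A q : mnorm (q *: A) = qabs q * mnorm A.
Proof.
rewrite /mnorm mulr_sumr; apply: eq_bigr => i _; rewrite mulr_sumr.
by apply: eq_bigr => j _; rewrite mxE qabsM.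
Qed.
Lemma mnorm_rs A q : mnorm (rs A q) = mnorm A * qabs q.
Proof.
rewrite /mnorm mulr_suml; apply: eq_bigr => i _; rewrite mulr_suml.
by apply: eq_bigr => j _; rewrite mxE qabsM.
Qed.
Lemma mnorm_adj A : mnorm (adj A) = mnorm A.
Proof.
rewrite /mnorm exchange_big; apply: eq_bigr => i _; apply: eq_bigr => j _.
by rewrite mxE qabs_conj.
Qed.
Lemma mnorm_le A (r : RR) : (forall i j, qabs (A i j) <= r) ->
  mnorm A <= r * (m * k)%:R.
Proof.
move=> h; rewrite mulnC natrM mulrA mulr_natr -[m in _ *+ m]card_ord -sumr_const.
apply: ler_sum => i _; rewrite mulr_natr -[k in _ *+ k]card_ord -sumr_const.
by apply: ler_sum => j _.
Qed.
Lemma mnorm_triangle A A' A'' : mnorm (A - A'') <= mnorm (A - A') + mnorm (A' - A'').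
Proof. by have := mnormD (A - A') (A' - A''); rewrite addrA subrK. Qed.
Lemma mnorm_mul A B : mnorm (A *m B) <= mnorm A * mnorm B.
Proof.
apply: (@le_trans _ _ (\sum_i \sum_j \sum_s qabs (A i s) * qabs (B s j))).
  apply: ler_sum => i _; apply: ler_sum => j _; rewrite mxE.
  by apply: (le_trans (qabs_sum _ _)); apply: ler_sum => s _; rewrite qabsM.
rewrite /mnorm mulr_suml; apply: ler_sum => i _.
rewrite exchange_big mulr_suml; apply: ler_sum => s _.
rewrite -mulr_sumr ler_wpM2l ?qabs_ge0 //.
rewrite (bigD1 s) //= lerDl; apply: sumr_ge0 => ? _.
by apply: sumr_ge0 => ? _; apply: qabs_ge0.
Qed.
End Rectangular.

Lemma mxDE (m k : nat) (A B : 'M[quat]_(m, k)) i j : (A + B) i j = A i j + B i j.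
Proof. by rewrite mxE. Qed.
Lemma col_mul (m k l : nat) (A : 'M[quat]_(m, k)) (B : 'M[quat]_(k, l)) j :
  col j (A *m B) = A *m col j B.
Proof. by rewrite !colE mulmxA. Qed.
Lemma mul_regZ (m k l : nat) (A : 'M[quat]_(m, k)) (B : 'M[quat]_(k, l)) r :
  A *m (qreg r *: B) = qreg r *: (A *m B).
Proof. by rewrite -!rs_reg rs_mul. Qed.

(** Summing [(s |a_i| - t |b_i|)^2 >= 0] gives [2 s t |X| <= s^2 SA + t^2 SB]. Take [s = |X|],
    [t = SA] if [SA] is nonzero, and [s = SB + 1], [t = |X|] otherwise. *)
Lemma quat_cauchy_schwarz (I : finType) (P : pred I) (a b : I -> quat) :
  qabs (\sum_(i | P i) qconj (a i) * b i) ^+ 2 <=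
  (\sum_(i | P i) qnorm2 (a i)) * (\sum_(i | P i) qnorm2 (b i)).
Proof.
set X := \sum_(i | P i) _.
set SA := \sum_(i | P i) _; set SB := \sum_(i | P i) _.
have SA0 : 0 <= SA by apply: sumr_ge0 => i _; apply: qnorm2_ge0.
have SB0 : 0 <= SB by apply: sumr_ge0 => i _; apply: qnorm2_ge0.
have key (s t : RR) : 2 * s * t * qabs X <= s ^+ 2 * SA + t ^+ 2 * SB \/ s < 0 \/ t < 0.
  case: (ltrP s 0) => s0; [by right; left|]; case: (ltrP t 0) => t0; [by right; right|left].
  apply: (@le_trans _ _ (2 * s * t * \sum_(i | P i) qabs (a i) * qabs (b i))).
    rewrite ler_wpM2l ?mulr_ge0 ?ler0n //.
    apply: (le_trans (qabs_sum _ _)); apply: ler_sum => i _.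
    by rewrite qabsM qabs_conj.
  rewrite /SA /SB !mulr_sumr -big_split; apply: ler_sum => i _ /=.
  rewrite -!qabs_sqr -subr_ge0.
  have -> : s ^+ 2 * qabs (a i) ^+ 2 + t ^+ 2 * qabs (b i) ^+ 2 -
    2 * s * t * (qabs (a i) * qabs (b i)) = (s * qabs (a i) - t * qabs (b i)) ^+ 2 by ring.
  exact: sqr_ge0.
have X0 := qabs_ge0 X.
have [SA00|SA00] := eqVneq SA 0; last first.
  have SAp : 0 < SA by rewrite lt0r SA00.
  have := key (qabs X) SA; case=> [|[]]; [|lra|lra].
  by move=> h; rewrite -(ler_pM2l SAp); nra.
rewrite SA00 mul0r; have := key (SB + 1) (qabs X); case=> [|[]]; [|lra|lra].
by rewrite SA00; nra.
Qed.

Section Form.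
Variable n : nat.
Local Notation M := 'M[quat]_n.+1.
Local Notation V := 'cV[quat]_n.+1.
Local Notation J := (Jq n).

Definition sgn (i : 'I_n.+1) : RR := if i == ord_max then -1 else 1.
Definition hform (x y : V) : quat := (adj x *m J *m y) 0 0.
Definition sq (x : V) : RR :=
  \sum_(i | i != ord_max) qnorm2 (x i 0) - qnorm2 (x ord_max 0).
(** The adjoint for the form [hform]. It is the inverse on the group and, unlike an inverse, still
    makes sense on rank one limits. *)
Definition shp (A : M) : M := J *m adj A *m J.

Lemma qmx_mulE (A B : M) : qmx_mul A B = A *m B.
Proof. by apply/matrixP => i j; rewrite !mxE. Qed.
Lemma qmx1E : qmx1 n = 1%:M.
Proof. by apply/matrixP => i j; rewrite !mxE; case: eqP. Qed.

Lemma sgn_sqr i : sgn i * sgn i = 1.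
Proof. by rewrite /sgn; case: ifP => _; ring. Qed.
Lemma qreg_sgn i : qreg (sgn i) = if i == ord_max then qopp qone else qone.
Proof. by rewrite /sgn; case: ifP => // _; qring. Qed.
Lemma Jmul (k : nat) (A : 'M[quat]_(n.+1, k)) i j :
  (J *m A) i j = qreg (sgn i) * A i j.
Proof.
rewrite mxE (bigD1 i) //= big1 ?addr0; last first.
  by move=> s si; rewrite mxE eq_sym (negbTE si) -[qzero]/(0 : quat) mul0r.
by rewrite mxE eqxx -qreg_sgn.
Qed.
Lemma mulJ (k : nat) (A : 'M[quat]_(k, n.+1)) i j :
  (A *m J) i j = A i j * qreg (sgn j).
Proof.
rewrite mxE (bigD1 j) //= big1 ?addr0; last first.
  by move=> s si; rewrite mxE (negbTE si) -[qzero]/(0 : quat) mulr0.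
by rewrite mxE eqxx -qreg_sgn.
Qed.
Lemma JJ : J *m J = 1%:M.
Proof.
apply/matrixP => i j; rewrite Jmul !mxE; case: (eqVneq i j) => [_|_]; last first.
  by rewrite -[qzero]/(0 : quat) mulr0.
rewrite /sgn; case: ifP => _; rewrite ?mulr1n; qring.
Qed.
Lemma adjJ : adj J = J.
Proof.
apply/matrixP => i j; rewrite !mxE eq_sym; case: (eqVneq i j) => [->|_]; last by qring.
by case: ifP => _; qring.
Qed.
Lemma adj1 : adj (1%:M : M) = 1%:M.
Proof.
apply/matrixP => i j; rewrite !mxE eq_sym.
by case: (eqVneq i j) => [_|_]; rewrite ?mulr1n ?mulr0n; qring.
Qed.

Lemma in_SpE (g : M) : in_Sp g <-> adj g *m J *m g = J.
Proof. by rewrite /in_Sp !qmx_mulE. Qed.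
Lemma shpK (A : M) : shp (shp A) = A.
Proof.
by rewrite /shp !adj_mul adjJ adjK !mulmxA JJ mul1mx -!mulmxA JJ mulmx1.
Qed.
Lemma shp_mul (A B : M) : shp (A *m B) = shp B *m shp A.
Proof. by rewrite /shp adj_mul !mulmxA -(mulmxA _ J J) JJ mulmx1. Qed.
Lemma Sp_shp (g : M) : in_Sp g -> shp g *m g = 1%:M.
Proof. by move/in_SpE => h; rewrite /shp -!mulmxA (mulmxA (adj g)) h JJ. Qed.
Lemma Sp_inv (g h : M) : in_Sp g -> g *m h = 1%:M -> h = shp g.
Proof. by move=> /Sp_shp h1 h2; rewrite -[LHS]mul1mx -h1 -mulmxA h2 mulmx1. Qed.

Lemma adj_mx_entry (k l : nat) (A : 'M[quat]_(n.+1, k)) (B : 'M[quat]_(n.+1, l)) i j :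
  (adj A *m J *m B) i j = hform (col i A) (col j B).
Proof.
rewrite /hform [LHS]mxE [RHS]mxE; apply: eq_bigr => s _.
by rewrite !mulJ !mxE.
Qed.
Lemma formE (x y : V) :
  hform x y = \sum_i qreg (sgn i) * (qconj (x i 0) * y i 0).
Proof.
rewrite /hform mxE; apply: eq_bigr => i _; rewrite mulJ mxE -qregC mulrA //.
Qed.
Lemma form_split (x y : V) :
  hform x y = \sum_(i | i != ord_max) qconj (x i 0) * y i 0
             - qconj (x ord_max 0) * y ord_max 0.
Proof.
rewrite formE (bigD1 ord_max) //= addrC; congr (_ + _).
  apply: eq_bigr => i /negbTE h; rewrite /sgn h -[qreg 1]/(1 : quat) mul1r //.
by rewrite -mulN1r qreg_sgn eqxx.
Qed.
Lemma form_conj (x y : V) : qconj (hform x y) = hform y x.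
Proof.
rewrite !formE raddf_sum; apply: eq_bigr => i _ /=.
by rewrite !qconjM qconjK qconj_reg qregC.
Qed.
Lemma form_sq (x : V) : hform x x = qreg (sq x).
Proof.
rewrite form_split /sq raddfB /= raddf_sum qmul_conjl; congr (_ - _).
by apply: eq_bigr => i _; rewrite qmul_conjl.
Qed.
Lemma formDl x y z : hform (x + y) z = hform x z + hform y z.
Proof. by rewrite /hform raddfD !mulmxDl mxE. Qed.
Lemma formDr x y z : hform x (y + z) = hform x y + hform x z.
Proof. by rewrite /hform mulmxDr mxE. Qed.
Lemma formNl x z : hform (- x) z = - hform x z.
Proof. by rewrite /hform raddfN !mulNmx mxE. Qed.
Lemma formNr x z : hform x (- z) = - hform x z.
Proof. by rewrite /hform mulmxN mxE. Qed.
Lemma formBl x y z : hform (x - y) z = hform x z - hform y z.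
Proof. by rewrite formDl formNl. Qed.
Lemma formBr x y z : hform x (y - z) = hform x y - hform x z.
Proof. by rewrite formDr formNr. Qed.
Lemma form0l z : hform 0 z = 0.
Proof. by rewrite -[0](subrr z) formBl subrr. Qed.
Lemma form0r z : hform z 0 = 0.
Proof. by rewrite -[0 in LHS](subrr z) formBr subrr. Qed.
Lemma form_rsr x y q : hform x (rs y q) = hform x y * q.
Proof. by rewrite /hform rs_mul mxE. Qed.
Lemma form_rsl x y q : hform (rs x q) y = qconj q * hform x y.
Proof. by rewrite -form_conj form_rsr qconjM form_conj. Qed.
Lemma form_regZr x y r : hform x (qreg r *: y) = qreg r * hform x y.
Proof. by rewrite -rs_reg form_rsr qregC. Qed.
Lemma form_regZl x y r : hform (qreg r *: x) y = qreg r * hform x y.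
Proof. by rewrite -rs_reg form_rsl qconj_reg. Qed.
Lemma form_shp (A : M) x y : hform x (A *m y) = hform (shp A *m x) y.
Proof.
by rewrite /hform /shp !adj_mul adjJ adjK !mulmxA -[_ *m J *m J]mulmxA JJ mulmx1.
Qed.
Lemma form_Sp (g : M) x y : in_Sp g -> hform (g *m x) (g *m y) = hform x y.
Proof. by move=> h; rewrite form_shp mulmxA Sp_shp ?mul1mx. Qed.
Lemma qabs_form x y : qabs (hform x y) <= mnorm x * mnorm y.
Proof.
apply: le_trans (mnorm_entry _ _ _) _; apply: le_trans (mnorm_mul _ _) _.
rewrite ler_wpM2r ?mnorm_ge0 // -(mnorm_adj x) /mnorm; apply: ler_sum => i _.
apply: ler_sum => j _; rewrite mulJ qabsM qabs_reg /sgn.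
by case: ifP; rewrite ?normrN normr1 mulr1.
Qed.

Lemma null_max_neq0 (x : V) : sq x = 0 -> x != 0 -> x ord_max 0 != 0.
Proof.
rewrite /sq => h; apply: contra => /eqP xn; apply/eqP/matrixP => i j.
rewrite ord1 mxE; case: (eqVneq i ord_max) => [->//|im].
apply/eqP; rewrite -qnorm2_eq0; move: h; rewrite xn.
rewrite [qnorm2 0](_ : _ = 0) ?subr0; last by apply/eqP; rewrite qnorm2_eq0.
move/eqP; rewrite psumr_eq0 => [/allP/(_ i)|? _]; last exact: qnorm2_ge0.
by rewrite mem_index_enum im => /(_ isT).
Qed.
(** Subtracting from [y] the right multiple of [x] with the same last entry leaves a null vector
    with last entry 0, and on such vectors the form is positive definite. *)
Lemma null_orth (x y : V) : sq x = 0 -> sq y = 0 -> hform x y = 0 -> x != 0 ->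
  y = rs x ((x ord_max 0)^-1 * y ord_max 0).
Proof.
move=> sx sy fxy x0; have xn := null_max_neq0 sx x0.
set q := _^-1 * _; apply/eqP; rewrite -subr_eq0; set z := _ - _.
have zn : z ord_max 0 = 0.
  by rewrite !mxE /q mulrA mulrV ?quat_unitE // mul1r subrr.
have sz : sq z = 0.
  apply: qreg_inj; rewrite -form_sq /z formBl !formBr !form_rsr !form_rsl.
  by rewrite -(form_conj x y) !form_sq sx sy fxy !(mulr0, mul0r, raddf0, subr0).
by case: (eqVneq z 0) => // /(null_max_neq0 sz); rewrite zn eqxx.
Qed.
(** Orthogonality makes [|t_n y_n|] the modulus of the sum over the other coordinates, so
    Cauchy-Schwarz gives [|t_n|^2 |y_n|^2 <= T Y] with [T < |t_n|^2]. If also [Y <= |y_n|^2], then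
    [y_n = 0], and [y] is null, hence 0. *)
Lemma timelike_orth (t y : V) : sq t < 0 -> hform t y = 0 -> y != 0 -> 0 < sq y.
Proof.
move=> st fty y0; set Y := \sum_(i | i != ord_max) qnorm2 (y i 0).
set T := \sum_(i | i != ord_max) qnorm2 (t i 0).
have Y0 : 0 <= Y by apply: sumr_ge0 => i _; apply: qnorm2_ge0.
have T0 : 0 <= T by apply: sumr_ge0 => i _; apply: qnorm2_ge0.
have := @quat_cauchy_schwarz _ (fun i => i != ord_max) (fun i : 'I_n.+1 => t i 0) (fun i => y i 0).
move: fty; rewrite form_split => /eqP; rewrite subr_eq0 => /eqP ->.
rewrite qabs_sqr qnorm2M qnorm2_conj -/Y -/T => h.
have yn0 := qnorm2_ge0 (y ord_max 0); have tn0 := qnorm2_ge0 (t ord_max 0).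
move: st; rewrite /sq -/Y -/T => st.
rewrite ltNge; apply/negP => sy.
have yn : qnorm2 (y ord_max 0) = 0 by nra.
have Y00 : sq y = 0 by rewrite /sq -/Y; nra.
by move/(null_max_neq0 Y00)/negP: y0; rewrite -qnorm2_eq0 yn eqxx.
Qed.

(** Columns and rows of [g] are orthonormal for the form. An entry off the last row and column is
    compared with the one below it, which costs [+1], and that one with the corner, which gains
    [-1]. *)
Lemma Sp_max_entry (g : M) i j : in_Sp g -> g *m shp g = 1%:M ->
  qabs (g i j) <= qabs (g ord_max ord_max).
Proof.
move=> hg hi.
have hc (c : 'I_n.+1) : \sum_(i | i != ord_max) qnorm2 (g i c) =
    sgn c + qnorm2 (g ord_max c).
  have : hform (col c g) (col c g) = qreg (sgn c).
    rewrite -adj_mx_entry; move/in_SpE: hg => ->; by rewrite mxE eqxx -qreg_sgn.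
  rewrite form_sq => /qreg_inj; rewrite /sq !mxE => <-; rewrite subrK.
  by apply: eq_bigr => s _; rewrite mxE.
have hr (r : 'I_n.+1) : \sum_(i | i != ord_max) qnorm2 (g r i) =
    sgn r + qnorm2 (g r ord_max).
  have : adj (adj g) *m J *m adj g = J.
    move: hi; rewrite /shp !mulmxA => hi'.
    by rewrite adjK -[LHS]mulmx1 -JJ mulmxA hi' mul1mx.
  move/matrixP/(_ r r); rewrite adj_mx_entry form_sq [J r r]mxE eqxx.
  rewrite -qreg_sgn; move/qreg_inj; rewrite /sq !mxE qnorm2_conj => <-; rewrite subrK.
  by apply: eq_bigr => s _; rewrite !mxE qnorm2_conj.
rewrite -(@ler_pXn2r _ 2) ?nnegrE ?qabs_ge0 // !qabs_sqr.
have sum1 (F : 'I_n.+1 -> quat) s : s != ord_max ->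
    qnorm2 (F s) <= \sum_(i | i != ord_max) qnorm2 (F i).
  move=> sm; rewrite (bigD1 s) //= lerDl; apply: sumr_ge0 => ? _; exact: qnorm2_ge0.
have hn : sgn ord_max = -1 by rewrite /sgn eqxx.
have row_n s : s != ord_max -> qnorm2 (g ord_max s) <= qnorm2 (g ord_max ord_max) - 1.
  by move=> sm; have := hr ord_max; rewrite hn; have := sum1 (g ord_max) s sm; lra.
case: (eqVneq i ord_max) => [->|im]; case: (eqVneq j ord_max) => [->|jm] //.
- by have := row_n _ jm; lra.
- by have := hc ord_max; rewrite hn; have := sum1 (g^~ ord_max) i im; lra.
have := hc j; rewrite [sgn j](_ : _ = 1) ?/sgn ?(negbTE jm) //.
by have := sum1 (g^~ j) i im; have := row_n _ jm; lra.
Qed.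
End Form.

(** * Bolzano-Weierstrass *)

Definition qcoord (c : 'I_4) (p : quat) : RR :=
  if c == 0 then qr p else if c == 1 then qi p else if c == 2 then qj p else qk p.

Lemma qcoord_le (c : 'I_4) (p : quat) : `|qcoord c p| <= qabs p.
Proof.
rewrite /qcoord; do ![case: ifP => _]; [exact: qr_le_abs|exact: qi_le_abs|
  exact: qj_le_abs|exact: qk_le_abs].
Qed.

Lemma qcoordB (c : 'I_4) (p q : quat) : qcoord c (p - q) = qcoord c p - qcoord c q.
Proof. by rewrite /qcoord; do ![case: ifP => _]. Qed.

Lemma qabs_lt_coord (p : quat) (e : RR) :
  (forall c, `|qcoord c p| < e) -> qabs p < 4 * e.
Proof.
move=> h; apply: le_lt_trans (qabs_le_coord _) _.
have := h 0; have := h 1; have := h 2; have := h (inord 3).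
rewrite /qcoord /= -!(inj_eq val_inj) /= inordK //= => *; lra.
Qed.

Module BolzanoWeierstrass.
Import classical_sets filter topology normedtype numFieldNormedType.Exports.
Local Open Scope classical_set_scope.

Lemma bounded_cluster_fun (R : realType) (I : finType) (f : nat -> I -> R) (b : R) :
  (forall s i, `|f s i| <= b) ->
  exists p : I -> R, forall e : R, 0 < e -> forall N,
    exists2 s, (N <= s)%N & forall i, `|f s i - p i| < e.
Proof.
move=> fb; pose v (s : nat) : 'rV[R]_#|I| := \row_e f s (enum_val e).
pose K := [set w : 'rV[R]_#|I| | forall e, `[- b, b] (w ord0 e)].
have cK : compact K.
  apply: (@rV_compact R _ (fun _ => `[- b, b]%classic)) => e.
  exact: segment_compact.
have [|p [_ clp]] := cK (v s @[s --> \oo]) _.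
  by exists 0%N => // s _ /= e; rewrite mxE /= in_itv /= -ler_norml.
exists (fun i => p 0 (enum_rank i)) => e e0 N.
have [w [[s Ns <-] [_ bw]]] : ((v @` [set s | (N <= s)%N]) `&` ball p e) !=set0.
  apply: clp; last by apply: nbhsx_ballx.
  by exists N => // s Ns; exists s.
exists s => // i; have := bw 0 (enum_rank i).
by rewrite /ball /= distrC mxE enum_rankK.
Qed.
End BolzanoWeierstrass.

Lemma bounded_cluster (m k : nat) (X : nat -> 'M[quat]_(m, k)) (b : RR) :
  (forall s i j, qabs (X s i j) <= b) ->
  exists L : 'M[quat]_(m, k), forall e : RR, 0 < e -> forall N,
    exists2 s, (N <= s)%N & mnorm (X s - L) < e.
Proof.
move=> Xb.
have [|P clP] := @BolzanoWeierstrass.bounded_cluster_fun RR ('I_m * 'I_k * 'I_4)%type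
  (fun s t => qcoord t.2 (X s t.1.1 t.1.2)) b.
  by move=> s t; apply: le_trans (qcoord_le _ _) (Xb _ _ _).
exists (\matrix_(i, j) Quat (P (i, j, 0)) (P (i, j, 1)) (P (i, j, 2)) (P (i, j, inord 3))).
move=> e e0 N.
(* The 4 counts real coordinates, [m * k] entries; the added 1 covers empty matrices and makes the
   final bound strict. *)
pose d : RR := e / (4 * (m * k)%:R + 1).
have mk0 : 0 <= (m * k)%:R :> RR by rewrite ler0n.
have d0 : 0 < d by rewrite divr_gt0 //; lra.
have [s Ns bs] := clP d d0 N.
exists s => //; apply: (@le_lt_trans _ _ (4 * d * (m * k)%:R)).
  apply: mnorm_le => i j; apply/ltW/qabs_lt_coord => c.
  rewrite mxBE qcoordB.
  have := bs (i, j, c); congr (`|_ - _| < _); rewrite !mxE /qcoord /=.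
  case: ifP => [/eqP->//|c0]; case: ifP => [/eqP->//|c1]; case: ifP => [/eqP->//|c2].
  congr (P (_, _, _)); apply/val_inj; rewrite /= inordK //.
  by move: c c0 c1 c2 => [[|[|[|[|]]]]].
rewrite /d -subr_gt0.
have -> : e - 4 * (e / (4 * (m * k)%:R + 1)) * (m * k)%:R =
  e / (4 * (m * k)%:R + 1) by field; lra.
exact: d0.
Qed.

(** * Rank one limits *)

Lemma eq_ler (a b : RR) : a = b -> a <= b.
Proof. by move=> ->. Qed.
(** This is how limits are taken: a closure argument only has to bound [x] linearly in [e], with a
    constant valid for [e < 1]. *)
Lemma eq0_small (x C : RR) :
  0 <= x -> (forall e, 0 < e -> e < 1 -> x <= C * e) -> x = 0.
Proof.
move=> x0 h; apply/eqP; rewrite eq_le x0 andbT leNgt; apply/negP => xp.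
pose b := Num.max C 1.
have b1 : 1 <= b by rewrite /b le_max lexx orbT.
have Cb : C <= b by rewrite /b le_max lexx.
pose e := Num.min (x / (2 * b)) (2^-1).
have e0 : 0 < e by rewrite /e lt_min divr_gt0 ?invr_gt0 //; lra.
have e2 : e < 1 by rewrite /e gt_min; apply/orP; right; lra.
have := h e e0 e2.
have : e <= x / (2 * b) by rewrite /e ge_min lexx.
have -> : x / (2 * b) = (x / 2) / b by field; lra.
rewrite ler_pdivlMr; last lra.
nra.
Qed.

Lemma mnorm_shp n (A : 'M[quat]_n.+1) : mnorm (shp A) = mnorm A.
Proof.
rewrite -[RHS]mnorm_adj; apply: eq_bigr => i _; apply: eq_bigr => j _.
rewrite mulJ Jmul !qabsM !qabs_reg /sgn.
by do 2![case: ifP => _]; rewrite ?normrN normr1 mul1r mulr1.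
Qed.

Lemma outer_mul n (u v y : 'cV[quat]_n.+1) :
  u *m (adj v *m Jq n) *m y = rs u (hform v y).
Proof.
rewrite -mulmxA; apply/matrixP => i j; rewrite !mxE big_ord1 /hform.
by rewrite [j]ord1.
Qed.

Section Group.
Variable n : nat.
Local Notation M := 'M[quat]_n.+1.
Local Notation V := 'cV[quat]_n.+1.
Local Notation J := (Jq n).
Local Notation gmax g := (qabs (g ord_max ord_max)).
Variable G : M -> Prop.
Hypothesis GSp : forall g, G g -> in_Sp g.
Hypothesis Ggr : is_subgroup mulmx 1%:M G.

Lemma G_one : G 1%:M. Proof. by case: Ggr. Qed.
Lemma G_mul g h : G g -> G h -> G (g *m h). Proof. by case: Ggr => _ + _; apply. Qed.
Lemma G_shp g : G g -> G (shp g).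
Proof.
by move=> Gg; case: Ggr => _ _ /(_ g Gg) [h [Gh gh _]]; rewrite -(Sp_inv (GSp Gg) gh).
Qed.
Lemma G_mulV g : G g -> g *m shp g = 1%:M.
Proof.
by move=> Gg; case: Ggr => _ _ /(_ g Gg) [h [Gh gh _]]; rewrite -(Sp_inv (GSp Gg) gh).
Qed.
Lemma G_mulVl g : G g -> shp g *m g = 1%:M.
Proof. by move=> Gg; apply/Sp_shp/GSp. Qed.
Lemma G_form g x y : G g -> hform (g *m x) (g *m y) = hform x y.
Proof. by move=> Gg; apply/form_Sp/GSp. Qed.
Lemma G_entry g i j : G g -> qabs (g i j) <= gmax g.
Proof. by move=> Gg; apply: Sp_max_entry; [apply: GSp|apply: G_mulV]. Qed.
Lemma G_neq0 g x : G g -> x != 0 :> V -> g *m x != 0.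
Proof.
move=> Gg; apply: contra => /eqP h.
by rewrite -[x]mul1mx -(G_mulVl Gg) -mulmxA h mulmx0.
Qed.
Lemma G_sq g x : G g -> sq (g *m x) = sq x.
Proof. by move=> Gg; apply: qreg_inj; rewrite -!form_sq G_form. Qed.

Definition Cl (A : M) : Prop := forall e : RR, 0 < e ->
  exists (t : RR) (g : M), G g /\ mnorm (qreg t *: g - A) < e.

Lemma Cl_G g : G g -> Cl g.
Proof.
by move=> Gg e e0; exists 1, g; split=> //; rewrite rmorph1 scale1r subrr mnorm0.
Qed.

Lemma Cl_mul A B : Cl A -> Cl B -> Cl (A *m B).
Proof.
move=> clA clB e e0.
have A0 := mnorm_ge0 A; have B0 := mnorm_ge0 B.
have d0 : 0 < mnorm A + mnorm B + 1 by lra.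
(* The error of the product is at most [d^2 + d |B| + |A| d], which [d <= 1] reduces to
   [d (|A| + |B| + 1)]. *)
pose d := Num.min 1 (e / (mnorm A + mnorm B + 1) / 2).
have dp : 0 < d by rewrite lt_min ltr01 !divr_gt0.
have d1 : d <= 1 by rewrite ge_min lexx.
have d2 : d * (mnorm A + mnorm B + 1) < e.
  rewrite -ltr_pdivlMr //; apply: (@le_lt_trans _ _ (e / (mnorm A + mnorm B + 1) / 2)).
    by rewrite /d ge_min lexx orbT.
  by have := divr_gt0 e0 d0; lra.
have [t [g [Gg hg]]] := clA d dp; have [t' [g' [Gg' hg']]] := clB d dp.
exists (t * t'), (g *m g'); split; first exact: G_mul.
have -> : qreg (t * t') *: (g *m g') = (qreg t *: g) *m (qreg t' *: g').
  by rewrite mul_regZ -scalemxAl scalerA -rmorphM mulrC.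
set X := _ *: g in hg *; set Y := _ *: g' in hg' *.
have -> : X *m Y - A *m B = (X - A) *m (Y - B) + (X - A) *m B + A *m (Y - B).
  by rewrite -mulmxDr subrK mulmxBl mulmxBr addrA subrK.
have h1 := mnorm_mul (X - A) (Y - B); have h2 := mnorm_mul (X - A) B.
have h3 := mnorm_mul A (Y - B).
apply: le_lt_trans (mnormD _ _) _; apply: le_lt_trans (lerD (mnormD _ _) (lexx _)) _.
have := mnorm_ge0 (X - A); have := mnorm_ge0 (Y - B); nra.
Qed.

Lemma Cl_shp A : Cl A -> Cl (shp A).
Proof.
move=> clA e e0; have [t [g [Gg h]]] := clA e e0.
exists t, (shp g); split; first exact: G_shp.
suff -> : qreg t *: shp g - shp A = shp (qreg t *: g - A) by rewrite mnorm_shp.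
by rewrite /shp raddfB /= adj_regZ mulmxBr mulmxBl mul_regZ -scalemxAl.
Qed.

Lemma Cl_tr A : (forall g, G g -> qreal (\tr g)) -> Cl A -> qreal (\tr A).
Proof.
move=> trG clA.
(* [f] stands for an imaginary coordinate: it vanishes on real multiples of traces and is
   1-Lipschitz. *)
have small (f : quat -> RR) : (forall p q, f (p - q) = f p - f q) ->
    (forall p, `|f p| <= qabs p) -> (forall g t, G g -> f (qreg t * \tr g) = 0) ->
    f (\tr A) = 0.
  move=> fB f_le f0; apply/eqP; rewrite -normr_eq0; apply/eqP.
  apply: (@eq0_small _ 1) => // e e0 _; have [t [g [Gg h]]] := clA e e0.
  rewrite mul1r -[f _]opprK normrN -[- f _]add0r -(f0 g t Gg) -fB.
  apply: le_trans (f_le _) _; apply: le_trans (ltW h).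
  have -> : qreg t * \tr g - \tr A = \tr (qreg t *: g - A).
    by rewrite raddfB /= linearZ.
  apply: le_trans (qabs_sum _ _) _; rewrite /mnorm; apply: ler_sum => i _.
  by rewrite (bigD1 i) //= lerDl; apply: sumr_ge0 => ? _; apply: qabs_ge0.
have tr0 g : G g -> [/\ qi (\tr g) = 0, qj (\tr g) = 0 & qk (\tr g) = 0] by exact: trG.
split; apply: small => //.
- exact: qi_le_abs.
- by move=> g t /tr0 [h _ _]; rewrite qE /= h; ring.
- exact: qj_le_abs.
- by move=> g t /tr0 [_ h _]; rewrite qE /= h; ring.
- exact: qk_le_abs.
- by move=> g t /tr0 [_ _ h]; rewrite qE /= h; ring.
Qed.

(** A rescaled group element [X = g / r] satisfies [X^* J X = r^-2 J]. As [r] grows, the columns of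
    the limit become null and pairwise orthogonal. *)
Lemma quad_limit (L : M) :
  (forall e : RR, 0 < e -> exists (X : M) (t : RR),
     [/\ mnorm (X - L) <= e, adj X *m J *m X = qreg t *: J & `|t| <= e]) ->
  adj L *m J *m L = 0.
Proof.
move=> h; apply/eqP; rewrite -mnorm_eq0; apply/eqP.
pose b := mnorm L + 1; pose j := mnorm J.
apply: (@eq0_small _ (2 * b * j + j)) => [|e e0 e1]; first exact: mnorm_ge0.
have [X [t [XL XJ te]]] := h e e0.
have Xb : mnorm X <= b.
  have := mnormD (X - L) L; rewrite subrK /b; lra.
have L0 := mnorm_ge0 L.
have Lb : mnorm L <= b by rewrite /b; lra.
have -> : adj L *m J *m L = qreg t *: J - (adj (X - L) *m (J *m L) + adj X *m (J *m (X - L))).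
  rewrite -XJ raddfB /= mulmxBr mulmxBr mulmxBl !mulmxA.
  by rewrite [_ + (_ - _)]addrC subrKA opprB addrC subrK.
apply: le_trans (mnormB _ _) _; rewrite mnormZ qabs_reg.
have j0 : 0 <= j := mnorm_ge0 _.
have h1 : mnorm (adj (X - L) *m (J *m L)) <= e * (j * b).
  apply: le_trans (mnorm_mul _ _) _; rewrite mnorm_adj; apply: ler_pM; rewrite ?mnorm_ge0 //.
  by apply: le_trans (mnorm_mul _ _) _; rewrite ler_wpM2l.
have h2 : mnorm (adj X *m (J *m (X - L))) <= b * (j * e).
  apply: le_trans (mnorm_mul _ _) _; rewrite mnorm_adj; apply: ler_pM; rewrite ?mnorm_ge0 //.
  by apply: le_trans (mnorm_mul _ _) _; rewrite ler_wpM2l.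
have h3 : `|t| * mnorm J <= e * j by rewrite ler_wpM2r.
have := mnormD (adj (X - L) *m (J *m L)) (adj X *m (J *m (X - L))); nra.
Qed.

(** The rescaled corner has modulus 1, so the limit [L] is nonzero. Its columns are null and
    orthogonal by [quad_limit], hence right multiples of the last one, which normalised is [u]. The
    same applied to the adjoint of [L] makes the last row null, and this row is [v^* J]. *)
Lemma rank_one_limit (g : nat -> M) :
  (forall k, G (g k)) -> (forall k, k%:R <= gmax (g k)) ->
  exists u v : V, [/\ sq u = 0, u ord_max 0 = 1, sq v = 0, v != 0 &
    forall e : RR, 0 < e -> forall N, exists2 s, (N <= s)%N &
      mnorm (qreg (gmax (g s))^-1 *: g s - u *m (adj v *m J)) < e].
Proof.
move=> Gg gk.
pose X s := qreg (gmax (g s))^-1 *: g s.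
have gp s : 0 < gmax (g s).
  rewrite lt0r qabs_ge0 andbT; apply/eqP => h.
  have := G_mulV (Gg s); have -> : g s = 0.
    apply/matrixP => i j; apply/eqP; rewrite mxE -qabs_eq0 eq_le qabs_ge0 andbT -h.
    exact: G_entry.
  rewrite mul0mx => /matrixP /(_ 0 0); rewrite !mxE eqxx => /eqP.
  by rewrite eq_sym oner_eq0.
have Xb s i j : qabs (X s i j) <= 1.
  rewrite mxE qabsM qabs_reg ger0_norm ?invr_ge0 ?qabs_ge0 // mulrC.
  by rewrite ler_pdivrMr // mul1r G_entry.
have [L hL] := bounded_cluster Xb.
have Xnn s : qabs (X s ord_max ord_max) = 1.
  by rewrite mxE qabsM qabs_reg ger0_norm ?invr_ge0 ?qabs_ge0 // mulVf // gt_eqF.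
have Lnn : qabs (L ord_max ord_max) = 1.
  apply/eqP; rewrite -subr_eq0 -normr_eq0; apply/eqP.
  apply: (@eq0_small _ 1) => // e e0 _; have [s _ hs] := hL e e0 0%N.
  rewrite mul1r; apply: le_trans (ltW hs).
  apply: le_trans (mnorm_entry _ ord_max ord_max).
  rewrite mxBE -(Xnn s) ler_norml; set x := X s _ _; set y := L _ _.
  have := qabsD y (x - y); have := qabsB x (x - y).
  by rewrite opprB !(addrC _ (_ - _)) !subrK => h1 h2; apply/andP; split; lra.
have small e : 0 < e -> exists s, mnorm (X s - L) <= e /\ `|(gmax (g s))^-1 ^+ 2| <= e.
  (* The successor forces [s >= 1], hence [gmax^-1 <= 1], and the square of [gmax^-1] is at most
     [gmax^-1 <= e]. *)
  move=> e0; have [s Ns hs] := hL e e0 (Num.bound e^-1).+1; exists s; split; first exact: ltW.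
  have es : e^-1 <= s%:R :> RR.
    apply: le_trans (_ : (Num.bound e^-1)%:R <= _); last by rewrite ler_nat ltnW.
    by apply/ltW/archi_boundP; rewrite invr_ge0 ltW.
  have s1 : 1 <= s%:R :> RR by rewrite ler1n (leq_ltn_trans _ Ns).
  have gs := gk s.
  have ge : (gmax (g s))^-1 <= e.
    by rewrite -[e]invrK lef_pV2 ?posrE ?invr_gt0 //; apply: le_trans gs.
  have g1 : (gmax (g s))^-1 <= 1 by rewrite invf_le1 //; apply: le_trans gs.
  rewrite ger0_norm ?sqr_ge0 // expr2; apply: le_trans ge.
  by rewrite -[leRHS]mul1r ler_wpM2r // invr_ge0 qabs_ge0.
have Q1 : adj L *m J *m L = 0.
  apply: quad_limit => e e0; have [s [h1 h2]] := small e e0.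
  exists (X s), ((gmax (g s))^-1 ^+ 2); split=> //.
  rewrite /X adj_regZ mul_regZ -!scalemxAl scalerA -rmorphM -expr2.
  by congr (_ *: _); apply/in_SpE/GSp.
have Q2 : adj (adj L) *m J *m adj L = 0.
  apply: quad_limit => e e0; have [s [h1 h2]] := small e e0.
  exists (adj (X s)), ((gmax (g s))^-1 ^+ 2); split=> //.
    by rewrite -raddfB /= mnorm_adj.
  rewrite adjK /X adj_regZ mul_regZ -!scalemxAl scalerA -rmorphM -expr2.
  congr (_ *: _); have := G_mulV (Gg s); rewrite /shp !mulmxA => h.
  by rewrite -[LHS]mulmx1 -JJ mulmxA h mul1mx.
have Lnn0 : L ord_max ord_max != 0 by rewrite -qabs_eq0 Lnn oner_eq0.
pose c := col ord_max L.
have c0 : c != 0.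
  by apply: contra Lnn0 => /eqP/matrixP/(_ ord_max 0); rewrite !mxE => ->.
have colL i j : hform (col i L) (col j L) = 0 by rewrite -adj_mx_entry Q1 mxE.
have sqL i : sq (col i L) = 0 by apply: qreg_inj; rewrite -form_sq colL.
pose w := row ord_max L.
have Lcw i j : L i j = L i ord_max * ((L ord_max ord_max)^-1 * L ord_max j).
  have /matrixP/(_ i 0) := null_orth (sqL ord_max) (sqL j) (colL _ _) c0.
  by rewrite !mxE.
exists (rs c (L ord_max ord_max)^-1), (J *m adj w); split.
- by apply: qreg_inj; rewrite -form_sq form_rsr form_rsl colL mulr0 mul0r.
- by rewrite !mxE mulrV ?quat_unitE.
- apply: qreg_inj; rewrite -form_sq /hform adj_mul adjK adjJ.
  rewrite -(mulmxA w) JJ mulmx1 mulmxA.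
  move/matrixP: Q2 => /(_ ord_max ord_max); rewrite adjK !mxE => h.
  rewrite -[RHS]h; apply: eq_bigr => i _; rewrite !mxE; congr (_ * _).
  by apply: eq_bigr => j _; rewrite !mxE.
- apply/eqP => /matrixP/(_ ord_max 0); rewrite Jmul !mxE /sgn eqxx => /eqP.
  rewrite quat_mulf_eq0 qreg_eq0 oppr_eq0 oner_eq0 /= -qabs_eq0 qabs_conj qabs_eq0.
  by rewrite (negbTE Lnn0).
- have -> : rs c (L ord_max ord_max)^-1 *m (adj (J *m adj w) *m J) = L; last exact: hL.
  rewrite adj_mul adjK adjJ -mulmxA JJ mulmx1.
  by apply/matrixP => i j; rewrite mxE big_ord1 !mxE -mulrA -Lcw.
Qed.

Definition unbounded (H : M -> Prop) := forall R : RR, exists2 g, H g & R < gmax g.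

Lemma rank_one_Cl (H : M -> Prop) : (forall h, H h -> G h) -> unbounded H ->
  exists u v : V, [/\ sq u = 0, u ord_max 0 = 1, sq v = 0, v != 0 &
    forall e : RR, 0 < e -> exists h,
      [/\ H h, e^-1 < gmax h & mnorm (qreg (gmax h)^-1 *: h - u *m (adj v *m J)) < e]].
Proof.
move=> HG Hunb.
have /choice [g hg] : forall k : nat, exists g, H g /\ k%:R < gmax g.
  by move=> k; have [g] := Hunb k%:R; exists g.
have [||u [v [su un sv v0 hL]]] := @rank_one_limit g.
- by move=> k; apply/HG; case: (hg k).
- by move=> k; case: (hg k) => _ /ltW.
exists u, v; split=> // e e0; have [s Ns hs] := hL e e0 (Num.bound e^-1).
exists (g s); case: (hg s) => Hs ks; split=> //; apply: le_lt_trans ks.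
apply: le_trans (_ : (Num.bound e^-1)%:R <= _); last by rewrite ler_nat.
by apply/ltW/archi_boundP; rewrite invr_ge0 ltW.
Qed.

(** Otherwise rescaling produces a rank one limit with [<t, u> <v, t> = 0], but a nonzero null
    vector is never orthogonal to a negative one. Every properness claim below rests on this. *)
Lemma timelike_proper (t : V) (R : RR) : sq t < 0 ->
  exists R' : RR, forall h, G h -> qabs (hform t (h *m t)) <= R -> gmax h <= R'.
Proof.
move=> st; apply: contrapT => hn.
pose H h := G h /\ qabs (hform t (h *m t)) <= R.
have [| |u [v [su un sv v0 hL]]] := @rank_one_Cl H; first by move=> h [].
  move=> R'; apply: contrapT => hn'; apply: hn; exists R' => h Gh hR.
  by rewrite leNgt; apply/negP => hR'; apply: hn'; exists h.
have u0 : u != 0.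
  by apply/eqP => /matrixP/(_ ord_max 0); rewrite un mxE => /eqP; rewrite oner_eq0.
have : hform t (u *m (adj v *m J) *m t) = 0.
  apply/eqP; rewrite -qabs_eq0; apply/eqP.
  apply: (@eq0_small _ (mnorm t * mnorm t + `|R|)) => [|e e0 _]; first exact: qabs_ge0.
  have [h [[Gh hR] eh hs]] := hL e e0.
  set L := u *m _ in hs *; pose X := qreg (gmax h)^-1 *: h.
  have g0 : 0 < gmax h by apply: lt_trans eh; rewrite invr_gt0.
  have -> : hform t (L *m t) = hform t (X *m t) - hform t ((X - L) *m t).
    by rewrite -formBr -mulmxBl opprB addrC subrK.
  apply: le_trans (qabsB _ _) _; rewrite mulrDl addrC lerD //.
    apply: le_trans (qabs_form _ _) _; rewrite -mulrA ler_wpM2l ?mnorm_ge0 //.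
    apply: le_trans (mnorm_mul _ _) _; rewrite mulrC ler_wpM2l ?mnorm_ge0 //.
    exact: ltW.
  rewrite /X -scalemxAl form_regZr qabsM qabs_reg ger0_norm ?invr_ge0 ?qabs_ge0 //.
  rewrite mulrC; apply: ler_pM; rewrite ?qabs_ge0 ?invr_ge0 ?qabs_ge0 //.
    by apply: le_trans hR _; apply: ler_norm.
  by rewrite -[e]invrK lef_pV2 ?posrE ?invr_gt0 // ltW.
rewrite outer_mul form_rsr => /eqP; rewrite quat_mulf_eq0 => /orP[] /eqP h0.
  by have := timelike_orth st h0 u0; rewrite su ltxx.
have h1 : hform t v = 0 by rewrite -form_conj h0 raddf0.
by have := timelike_orth st h1 v0; rewrite sv ltxx.
Qed.
End Group.

(** * Real traces and invariant forms *)

Definition qcomplex (p : quat) : Prop := qj p = 0 /\ qk p = 0.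

Lemma qcomplexM p q : qcomplex p -> qcomplex q -> qcomplex (p * q).
Proof. by case=> pj pk [qj0 qk0]; split; rewrite qE /= pj pk qj0 qk0; ring. Qed.
Lemma qcomplexD p q : qcomplex p -> qcomplex q -> qcomplex (p + q).
Proof. by case=> pj pk [qj0 qk0]; split; rewrite qE pj qj0 || rewrite qE pk qk0; ring. Qed.
Lemma qcomplexV p : qcomplex p -> qcomplex p^-1.
Proof.
case=> pj pk; rewrite /GRing.inv /= /quat_inv; case: ifP => // _.
by split; rewrite /= ?pj ?pk oppr0 mul0r.
Qed.
Definition mxcomplex m k (A : 'M[quat]_(m, k)) := forall i j, qcomplex (A i j).

Section ConjugateVector.
Variable n : nat.
Local Notation V := 'cV[quat]_n.+1.

Definition cbar (x : V) : V := map_mx qconj x.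

Lemma sq_cbar x : sq (cbar x) = sq x.
Proof.
by rewrite /sq mxE qnorm2_conj; congr (_ - _); apply: eq_bigr => i _; rewrite mxE qnorm2_conj.
Qed.
Lemma sq_scale d (x : V) : sq (d *: x) = qnorm2 d * sq x.
Proof.
rewrite /sq mxE qnorm2M mulrBr mulr_sumr; congr (_ - _).
by apply: eq_bigr => i _; rewrite mxE qnorm2M.
Qed.
(** The trace of [x d y^* J] need not be [<y, x> d] over the quaternions. Conjugating all entries
    turns it into a value of the form, with [d] acting from the left. *)
Lemma tr_outer (x y : V) d :
  \tr (rs x d *m (adj y *m Jq n)) = hform (cbar x) (d *: cbar y).
Proof.
rewrite formE; apply: eq_bigr => i _.
by rewrite mxE big_ord1 mulJ !mxE qconjK qregC !mulrA.
Qed.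
(** Real parts are cyclic, which brings the original form back. *)
Lemma qr_tr_outer (x y : V) d :
  qr (hform (cbar x) (d *: cbar y)) = qr (d * hform y x).
Proof.
rewrite !formE mulr_sumr !qr_sum; apply: eq_bigr => i _.
rewrite !mxE qconjK qr_regM [in RHS]mulrA -[in RHS]qregC -[in RHS]mulrA qr_regM.
congr (_ * _).
by rewrite qr_mulC -mulrA.
Qed.
Lemma mul_mx11 (x : V) (B : 'M[quat]_1) : x *m B = rs x (B 0 0).
Proof. by apply/matrixP => i j; rewrite !mxE big_ord1 [j]ord1. Qed.
End ConjugateVector.

Section Core.
Variable n : nat.
Local Notation M := 'M[quat]_n.+1.
Local Notation V := 'cV[quat]_n.+1.
Local Notation J := (Jq n).
Local Notation gmax g := (qabs (g ord_max ord_max)).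
Variable G : M -> Prop.
Hypothesis GSp : forall g, G g -> in_Sp g.
Hypothesis Ggr : is_subgroup mulmx 1%:M G.
Hypothesis Gunb : unbounded G.
Hypothesis nofix : forall u : V, u != 0 -> sq u = 0 ->
  exists2 h, G h & hform u (h *m u) != 0.
Hypothesis trG : forall g, G g -> qreal (\tr g).

Section RankOne.

(** * Admissible coefficients of rank one limits at a fixed null vector *)

Variable u : V.
Hypotheses (su : sq u = 0) (u0 : u != 0).

Let D (d : quat) := Cl G (rs u d *m (adj u *m J)).

(** In the product of [u d u^* J], [h] and [u d' u^* J], the inner factor [u^* J h u] is the scalar
    [<u, h u>]. *)
Lemma rank_one_coef_mul d d' h : D d -> D d' -> G h -> D (d * hform u (h *m u) * d').
Proof.
move=> Dd Dd' Gh; rewrite /D; set a := adj u *m J in Dd Dd' *.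
have -> : rs u (d * hform u (h *m u) * d') *m a = rs u d *m a *m h *m (rs u d' *m a).
  rewrite mulmxA -2!(mulmxA (rs u d)) mul_mx11 rs_rs rs_mul mxE -(mulmxA a).
  by rewrite mulrA.
by apply: (Cl_mul Ggr) => //; apply: (Cl_mul Ggr) => //; apply: Cl_G.
Qed.

Lemma rank_one_coef_conj d : D d -> D (qconj d).
Proof.
rewrite /D => /(Cl_shp GSp Ggr).
have -> // : shp (rs u d *m (adj u *m J)) = rs u (qconj d) *m (adj u *m J).
rewrite /shp !adj_mul adjJ adjK !mulmxA JJ mul1mx; congr (_ *m _).
apply/matrixP => i j; rewrite !mxE !big_ord1 !mxE qconjM mulrA //.
Qed.

Lemma rank_one_trace_real d h h' : D d -> G h -> G h' ->
  qreal (hform (cbar (h *m u)) (d *: cbar (h' *m u))).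
Proof.
move=> Dd Gh Gh'; rewrite -tr_outer.
apply: (Cl_tr trG).
have -> : rs (h *m u) d *m (adj (h' *m u) *m J) =
    h *m (rs u d *m (adj u *m J)) *m shp h'.
  rewrite -rs_mul /shp adj_mul !mulmxA; congr (_ *m _ *m _).
  by rewrite -[_ *m J *m J]mulmxA JJ mulmx1.
apply: (Cl_mul Ggr); last exact: (Cl_G (G_shp GSp Ggr Gh')).
by apply: (Cl_mul Ggr) => //; apply: Cl_G.
Qed.

(** For [z = cbar (h u)] the value [hform z (d z)] is a real trace, and its real part is that of
    [d <h u, h u> = 0]. So the null vectors [z] and [d z] are orthogonal, hence proportional. *)
Lemma cbar_eigenvector d h : D d -> G h ->
  exists mu, d *: cbar (h *m u) = rs (cbar (h *m u)) mu.
Proof.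
move=> Dd Gh; set z := cbar _.
have sz : sq z = 0 by rewrite sq_cbar (G_sq GSp).
have z0 : z != 0.
  move: (G_neq0 GSp Gh u0); apply: contra => /eqP/matrixP hz; apply/eqP/matrixP => i j.
  by have := hz i j; rewrite !mxE => /(congr1 qconj); rewrite qconjK raddf0.
have fz : hform z (d *: z) = 0.
  have /qrealP -> := rank_one_trace_real Dd Gh Gh; rewrite qr_tr_outer form_sq (G_sq GSp) // su.
  by rewrite raddf0 mulr0 raddf0.
eexists; apply: (null_orth sz _ fz z0).
by rewrite sq_scale sz mulr0.
Qed.

(* If [d] and [d'] were independent over the reals, [z |-> d *: z] would map each
   conjugated orbit vector [z] to a right multiple of itself, and the reality of
   [hform z (d *: z')] would force any two orbit vectors to be orthogonal after
   conjugation; then [d * hform u (h *m u)] and its square have real part 0. *)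
Lemma rank_one_coef_line d d' : D d -> D d' -> d != 0 -> exists r : RR, d' = qreg r * d.
Proof.
move=> Dd Dd' d0; apply: contrapT => hn.
have z0 h : G h -> cbar (h *m u) != 0.
  move=> Gh; move: (G_neq0 GSp Gh u0); apply: contra => /eqP/matrixP hz; apply/eqP/matrixP => i j.
  by have := hz i j; rewrite !mxE => /(congr1 qconj); rewrite qconjK raddf0.
have s0 h h' : G h -> G h' -> hform (cbar (h *m u)) (cbar (h' *m u)) = 0.
  move=> Gh Gh'; apply/eqP; apply: contrapT => /negP s0; apply: hn.
  set s := hform _ _ in s0.
  have [mu hmu] := cbar_eigenvector Dd Gh'; have [mu' hmu'] := cbar_eigenvector Dd' Gh'.
  have := rank_one_trace_real Dd Gh Gh'; rewrite hmu form_rsr -/s => /qrealP.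
  set r := qr _ => hr.
  have := rank_one_trace_real Dd' Gh Gh'; rewrite hmu' form_rsr -/s => /qrealP.
  set r' := qr _ => hr'.
  have r0 : r != 0.
    apply/eqP => r0; move/eqP: hr; rewrite r0 raddf0 quat_mulf_eq0 (negbTE s0) /=.
    move/eqP => mu0; move: hmu; rewrite mu0 rs0 => /matrixP hz.
    case/eqP: (z0 _ Gh'); apply/matrixP => i j; have := hz i j; rewrite !mxE => /eqP.
    by rewrite quat_mulf_eq0 (negbTE d0) => /eqP.
  exists (r' / r).
  have e : qreg r' * mu = qreg r * mu'.
    have sU : s \is a GRing.unit by rewrite quat_unitE.
    apply: (mulrI sU); rewrite !mulrA -!qregC -!mulrA hr hr'.
    by rewrite -!rmorphM mulrC.
  have ez : (qreg r' * d - qreg r * d') *: cbar (h' *m u) = 0.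
    by rewrite scalerBl -!scalerA hmu hmu' -!rs_reg !rs_rs -!qregC e subrr.
  have : qreg r' * d = qreg r * d'.
    apply/eqP; rewrite -subr_eq0; apply: contrapT => /negP w0.
    case/eqP: (z0 _ Gh'); apply/matrixP => i j.
    move/matrixP: ez => /(_ i j); rewrite !mxE => /eqP.
    by rewrite quat_mulf_eq0 (negbTE w0) => /eqP.
  move=> e2; rewrite mulrC rmorphM -mulrA e2 mulrA -rmorphM mulVf //.
  by rewrite rmorph1 mul1r.
have re0 d1 h h' : D d1 -> G h -> G h' -> qr (d1 * hform (h' *m u) (h *m u)) = 0.
  move=> Dd1 Gh Gh'; rewrite -qr_tr_outer.
  by have [mu ->] := cbar_eigenvector Dd1 Gh'; rewrite form_rsr s0 // mul0r.
have [h Gh] := nofix u0 su; set e := hform _ _ => e0.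
have G1 := G_one Ggr.
have h1 := re0 d h 1%:M Dd Gh G1.
have h2 := re0 _ h 1%:M (rank_one_coef_mul Dd Dd Gh) Gh G1.
move: h1 h2; rewrite mul1mx -/e -mulrA; set p := d * e => h1 h2.
(* For a quaternion, [qr (p * p) = 2 (qr p)^2 - |p|^2]. *)
have /eqP : qnorm2 p = 0.
  by move: h1 h2; rewrite /qnorm2 qE /=; move: (qr p) => a -> ; nra.
by rewrite qnorm2_eq0 /p quat_mulf_eq0 (negbTE d0) (negbTE e0).
Qed.

Lemma rank_one_form_real d h : D d -> d != 0 -> G h -> qreal (hform u (h *m u) * d).
Proof.
move=> Dd d0 Gh; have [r] := rank_one_coef_line Dd (rank_one_coef_mul Dd Dd Gh) d0.
rewrite qregC -mulrA => /(mulrI (_ : d \is a GRing.unit)) -> //.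
Qed.

(** Taking [shp] conjugates the coefficient, so [qconj d = r d] for a real [r]; equality of norms
    leaves [r = 1] or [r = -1]. *)
Lemma rank_one_coef_sign d : D d -> d != 0 -> qconj d = d \/ qconj d = - d.
Proof.
move=> Dd d0; have [r hr] := rank_one_coef_line Dd (rank_one_coef_conj Dd) d0.
have : qnorm2 d = r ^+ 2 * qnorm2 d by rewrite -qnorm2_reg -qnorm2M -hr qnorm2_conj.
move/eqP; rewrite -subr_eq0 -{1}[qnorm2 d]mul1r -mulrBl mulf_eq0 qnorm2_eq0 (negbTE d0).
rewrite orbF subr_eq0 eq_sym sqrf_eq1 hr => /orP[] /eqP ->; [left|right].
  by rewrite rmorph1 mul1r.
by rewrite rmorphN rmorph1 mulN1r.
Qed.
End RankOne.

(* With [L = u v^* J] a rank one limit, [L h (J L^* J) = u (v^* J h v) u^* J]. *)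
Lemma invariant_form : exists (u : V) (d : quat),
  [/\ sq u = 0 /\ u != 0, d != 0, qconj d = d \/ qconj d = - d,
      (forall h, G h -> qreal (hform u (h *m u) * d)) &
      ((forall h, G h -> mxcomplex h) -> mxcomplex u)].
Proof.
have [u [v [su un sv v0 hL]]] := rank_one_Cl GSp Ggr (fun _ => id) Gunb.
have u0 : u != 0.
  by apply/eqP => /matrixP/(_ ord_max 0); rewrite un mxE => /eqP; rewrite oner_eq0.
have ClL : Cl G (u *m (adj v *m J)).
  by move=> e e0; have [h [Gh _ hs]] := hL e e0; exists (gmax h)^-1, h.
have [h Gh hv] := nofix v0 sv.
pose d := hform v (h *m v).
have Dd : Cl G (rs u d *m (adj u *m J)).
  have -> : rs u d *m (adj u *m J) = u *m (adj v *m J) *m h *m shp (u *m (adj v *m J)).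
    have -> : shp (u *m (adj v *m J)) = v *m (adj u *m J).
      by rewrite /shp !adj_mul adjJ adjK !mulmxA JJ mul1mx.
    rewrite (mulmxA _ v); set b := adj v *m J; set a := adj u *m J.
    by rewrite -2!(mulmxA u) mul_mx11 -(mulmxA b).
  apply: (Cl_mul Ggr); last exact: (Cl_shp GSp Ggr ClL).
  by apply: (Cl_mul Ggr) => //; apply: Cl_G.
exists u, d; split=> //; first exact: rank_one_coef_sign Dd hv.
  by move=> g; apply: rank_one_form_real.
move=> Gc.
set L := u *m _ in hL.
have Lc : mxcomplex L.
  have small (f : quat -> RR) i j : (forall p q, f (p - q) = f p - f q) ->
      (forall p, `|f p| <= qabs p) -> (forall g t, G g -> f (qreg t * g i j) = 0) ->
      f (L i j) = 0.
    move=> fB f_le f0; apply/eqP; rewrite -normr_eq0; apply/eqP.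
    apply: (@eq0_small _ 1) => // e e0 _; have [g [Gg _ hs]] := hL e e0.
    rewrite mul1r -[f _]opprK normrN -[- f _]add0r -(f0 g (gmax g)^-1 Gg) -fB.
    apply: le_trans (f_le _) _; apply: le_trans (ltW hs).
    by apply: le_trans (mnorm_entry _ i j); rewrite mxBE [X in _ <= qabs (X - _)]mxE.
  move=> i j; split; apply: small => //.
  - exact: qj_le_abs.
  - by move=> g t /Gc /(_ i j) [gj gk]; rewrite qE /= gj gk; ring.
  - exact: qk_le_abs.
  - by move=> g t /Gc /(_ i j) [gj gk]; rewrite qE /= gj gk; ring.
pose w := adj v *m J.
have Luw i j : L i j = u i 0 * w 0 j by rewrite mxE big_ord1.
have wn : w 0 ord_max != 0.
  rewrite mulJ mxE quat_mulf_eq0 -qabs_eq0 qabs_conj qabs_eq0.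
  by rewrite (negbTE (null_max_neq0 sv v0)) qreg_eq0 /sgn eqxx oppr_eq0 oner_eq0.
move=> i j; rewrite [j]ord1.
(* Since the last entry of [u] is 1, [u] is a normalised column of [L], and complex entries pass
   from [G] to [L] and then to [u]. *)
have -> : u i 0 = L i ord_max * (L ord_max ord_max)^-1.
  by rewrite !Luw un mul1r mulrK.
by apply: qcomplexM => //; apply: qcomplexV.
Qed.
End Core.

(** * Discrete groups *)

Definition word_eval (T : Type) (mul : T -> T -> T) (e a b : T) (w : seq bool) : T :=
  foldr (fun c x => mul (if c then a else b) x) e w.

(** Comparing words of equal length only is what peeling off first letters proves, and it still
    gives [2^k] distinct elements for each [k]. *)
Definition free_pair (T : Type) (mul : T -> T -> T) (e : T) (G : T -> Prop) (a b : T) :=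
  [/\ G a, G b & forall w1 w2, size w1 = size w2 ->
    word_eval mul e a b w1 = word_eval mul e a b w2 -> w1 = w2].

(** The left side is the count of [count_bounded] at radius [(B k)^2 + 1]. For [k = 2^j] it is at
    most [2^((E + 4j) D)], and with [j = 2i] the inequality [(E + 4j) D < 2^j] follows from
    [E + 4j <= 9i < 2^i] and [D < 2^i]. *)
Lemma exp_beats_poly (A B D : nat) :
  exists k, ((A * ((B * k) ^ 2 + 1) ^ 2 + 1) ^ D < 2 ^ k)%N.
Proof.
pose E := (A + 1 + 4 * (B + 1))%N; pose i := (E + D + 10)%N; pose j := (i + i)%N.
exists (2 ^ j)%N.
have nlt2 a : (a < 2 ^ a)%N by apply: ltn_expl.
have lt9 : (9 * i < 2 ^ i)%N.
  rewrite /i; elim: (E + D)%N => [|m IH]; first by [].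
  by rewrite addSn expnS; lia.
have hB : ((B * 2 ^ j) ^ 2 + 1 <= ((B + 1) * 2 ^ j) ^ 2)%N.
  by have := nlt2 j; nia.
have hA : (A * ((B * 2 ^ j) ^ 2 + 1) ^ 2 + 1 <= (A + 1) * (((B + 1) * 2 ^ j) ^ 2) ^ 2)%N.
  have h : (((B * 2 ^ j) ^ 2 + 1) ^ 2 <= (((B + 1) * 2 ^ j) ^ 2) ^ 2)%N by rewrite leq_exp2r.
  have h1 : (0 < (((B + 1) * 2 ^ j) ^ 2) ^ 2)%N by rewrite !expn_gt0 muln_gt0 addn1 expn_gt0.
  by rewrite mulnDl mul1n leq_add // leq_mul2l h orbT.
have hE : ((A + 1) * (((B + 1) * 2 ^ j) ^ 2) ^ 2 <= 2 ^ (E + 4 * j))%N.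
  rewrite -expnM -[(2 * 2)%N]/4%N expnMn mulnA expnD leq_mul //; last by rewrite -expnM mulnC.
  rewrite /E expnD leq_mul //; first exact: ltnW.
  by rewrite [(4 * _)%N]mulnC expnM leq_exp2r // ltnW.
apply: leq_ltn_trans (_ : (2 ^ (E + 4 * j)) ^ D < _)%N.
  case: (posnP D) => [->|D0]; first by rewrite !expn0.
  by rewrite leq_exp2r // (leq_trans hA).
rewrite -expnM ltn_exp2l // /j expnD.
have hi : (E + 4 * (i + i) <= 9 * i)%N by rewrite /i; lia.
have hD : (D < 2 ^ i)%N by apply: leq_ltn_trans (nlt2 i); rewrite /i; lia.
by apply: ltn_mul => //; apply: leq_ltn_trans hi lt9.
Qed.

Section Discrete.
Variable n : nat.
Local Notation M := 'M[quat]_n.+1.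
Local Notation V := 'cV[quat]_n.+1.
Local Notation J := (Jq n).
Local Notation gmax g := (qabs (g ord_max ord_max)).
Local Notation pow := (mpow mulmx (1%:M : M)).
Local Notation weval := (word_eval mulmx (1%:M : M)).
Variable G : M -> Prop.
Hypothesis GSp : forall g, G g -> in_Sp g.
Hypothesis Ggr : is_subgroup mulmx 1%:M G.
Hypothesis Gdisc : discrete (@qnear n) G.
Hypothesis Gtf : torsion_free mulmx 1%:M G.

Lemma G_isolated : exists2 e : RR, 0 < e &
  forall h, G h -> (forall i j, qabs ((h - 1%:M) i j) < e) -> h = 1%:M.
Proof.
have [eps eps0 h] := Gdisc (G_one Ggr).
exists (Num.min 1 eps); first by rewrite lt_min ltr01.
move=> g Gg hg; apply: h => // i j.
have -> : qnorm2 (qadd (g i j) (qopp (1%:M i j))) = qabs ((g - 1%:M) i j) ^+ 2.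
  by rewrite qabs_sqr mxBE.
have := hg i j; rewrite lt_min => /andP[h1 h2]; have := qabs_ge0 ((g - 1%:M) i j).
move: (qabs _) h1 h2 => x; nra.
Qed.

(** Pigeonhole on a grid of mesh [eta]: if [g] and [h] share a cell, the entries of [g^-1 h - 1] are
    at most [N R (4 eta) = e / 2], so [g = h]. A coordinate meets about [2 R / eta = 16 N R^2 / e]
    cells, whence the form [A R^2 + 1]. *)
Lemma count_bounded : exists A D : nat, forall (R : nat), (0 < R)%N ->
  forall s : seq M, uniq s -> (forall g, g \in s -> G g /\ gmax g <= R%:R) ->
  (size s <= (A * R ^ 2 + 1) ^ D)%N.
Proof.
have [e e0 iso] := G_isolated.
pose N := (n.+1)%:R : RR.
have NE : (n.+1)%:R = N by [].
have N0 : 0 < N by rewrite ltr0n.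
clearbody N.
pose A := Num.bound (16 * N / e).
have hA : 16 * N / e < A%:R by apply: archi_boundP; rewrite !mulr_ge0 ?invr_ge0 //; lra.
pose I := ('I_n.+1 * 'I_n.+1 * 'I_4)%type.
exists A, #|{: I}| => R R0 s us hs.
have Rp : 0 < R%:R :> RR by rewrite ltr0n.
pose eta := e / (8 * N * R%:R).
have eta0 : 0 < eta by rewrite divr_gt0 // !mulr_gt0.
(* The shift by [R] makes the coordinate nonnegative, as [truncn] requires. *)
pose y (g : M) (t : I) := (qcoord t.2 (g t.1.1 t.1.2) + R%:R) / eta.
pose code (g : M) : {ffun I -> 'I_(A * R ^ 2).+1} := [ffun t => inord (Num.truncn (y g t))].
have cle g t : g \in s -> `|qcoord t.2 (g t.1.1 t.1.2)| <= R%:R.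
  move=> /hs [Gg gR]; apply: le_trans (qcoord_le _ _) _.
  by apply: le_trans gR; apply: (G_entry GSp Ggr).
have y0 g t : g \in s -> 0 <= y g t.
  move=> gs; have := cle g t gs; rewrite ler_norml => /andP[h _].
  by rewrite divr_ge0 ?(ltW eta0) // -lerBlDr sub0r.
have yA g t : g \in s -> (Num.truncn (y g t) < (A * R ^ 2).+1)%N.
  move=> gs; rewrite ltnS -(@ler_nat RR).
  apply: (@le_trans _ _ (y g t)); first by rewrite truncn_le y0.
  apply: (@le_trans _ _ (16 * N / e * R%:R ^+ 2)); last first.
    by rewrite natrM natrX ler_wpM2r ?sqr_ge0 // ltW.
  rewrite ler_pdivrMr // /eta.
  have -> : 16 * N / e * R%:R ^+ 2 * (e / (8 * N * R%:R)) = 2 * R%:R.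
    by field; rewrite !gt_eqF ?Rp ?N0 ?e0.
  by have := cle g t gs; rewrite ler_norml => /andP[_ h]; lra.
have inj : {in s &, injective code}.
  move=> g h gs hs' /ffunP eq.
  have close i j : qabs ((h - g) i j) < 4 * eta.
    apply: qabs_lt_coord => c; rewrite mxBE qcoordB.
    have := eq (i, j, c); rewrite !ffunE => /(congr1 val) /=.
    rewrite !inordK ?yA // => eqt.
    have := truncn_itv (y0 g (i, j, c) gs); have := truncn_itv (y0 h (i, j, c) hs').
    rewrite eqt => /andP[h1 h2] /andP[h3 h4].
    have : `|y h (i, j, c) - y g (i, j, c)| < 1.
      rewrite -natr1 in h2 h4; rewrite ltr_norml; apply/andP; split; lra.
    rewrite /y /= -mulrBl normrM normfV (gtr0_norm eta0) ltr_pdivrMr // mul1r.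
    by rewrite opprD addrACA subrr addr0.
  have [Gg gR] := hs _ gs; have [Gh hR] := hs _ hs'.
  suff e1 : shp g *m h = 1%:M.
    by rewrite -[h]mul1mx -(G_mulV GSp Ggr Gg) -mulmxA e1 mulmx1.
  apply: iso; first by apply: (G_mul Ggr) => //; apply: (G_shp GSp Ggr).
  move=> i j; rewrite -(G_mulVl GSp Gg) -mulmxBr mxE.
  apply: le_lt_trans (qabs_sum _ _) _.
  apply: (@le_lt_trans _ _ (\sum_(k < n.+1) R%:R * (4 * eta))).
    apply: ler_sum => k _; rewrite qabsM; apply: ler_pM; rewrite ?qabs_ge0 //.
      have := G_entry GSp Ggr i k (G_shp GSp Ggr Gg).
      have -> : shp g ord_max ord_max = qconj (g ord_max ord_max).
        by rewrite mulJ Jmul mxE /sgn eqxx; qring.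
      by rewrite qabs_conj => /le_trans; apply.
    exact: ltW.
  rewrite sumr_const card_ord -[_ *+ n.+1]mulr_natr NE /eta.
  have -> : R%:R * (4 * (e / (8 * N * R%:R))) * N = e / 2 by field; rewrite !gt_eqF ?Rp ?N0 ?e0.
  lra.
have us' : uniq [seq code g | g <- s] by rewrite map_inj_in_uniq.
rewrite -(size_map code) -(card_uniqP us') addn1.
by rewrite (leq_trans (max_card _)) // card_ffun card_ord.
Qed.

Lemma count_bounded_real (R : RR) : exists N, forall s : seq M, uniq s ->
  (forall g, g \in s -> G g /\ gmax g <= R) -> (size s <= N)%N.
Proof.
have [A [D hAD]] := count_bounded.
exists ((A * (Num.bound `|R|).+1 ^ 2 + 1) ^ D)%N => s us hs.
apply: hAD => // g /hs [Gg gR]; split=> //; apply: le_trans gR _.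
apply: le_trans (ler_norm _) _; apply/ltW; apply: lt_le_trans (archi_boundP (normr_ge0 _)) _.
by rewrite ler_nat.
Qed.

Lemma bounded_finite (R : RR) :
  exists l : seq M, forall g, G g -> gmax g <= R -> g \in l.
Proof.
have [N hN] := count_bounded_real R.
pose P k := `[< exists s : seq M, [/\ uniq s, size s = k & forall g, g \in s -> G g /\ gmax g <= R] >].
have P0 : exists k, P k by exists 0%N; apply/asboolP; exists [::].
have PN k : P k -> (k <= N)%N by move=> /asboolP [s [us <- hs]]; apply: hN.
case: (ex_maxnP P0 PN) => k /asboolP [s [us sk hs]] kmax.
exists s => g Gg gR; apply: contrapT => /negP gs.
have : P k.+1; last by move/kmax; rewrite ltnn.
apply/asboolP; exists (g :: s); split; rewrite /= ?gs ?sk //.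
by move=> h; rewrite inE => /orP[/eqP->|/hs].
Qed.

Lemma bounded_repeat (f : nat -> M) (R : RR) : (forall k, G (f k)) ->
  (forall k, gmax (f k) <= R) -> exists i j, (i < j)%N /\ f i = f j.
Proof.
move=> Gf fR; apply: contrapT => hn.
have [N hN] := count_bounded_real R.
have : uniq [seq f k | k <- iota 0 N.+1].
  rewrite map_inj_uniq ?iota_uniq // => i j fij.
  by case: (ltngtP i j) => // ij; case: hn; [exists i, j|exists j, i].
move/hN; rewrite size_map size_iota ltnn => h.
by suff : false by []; apply: h => g /mapP [k _ ->].
Qed.

Lemma powD (g : M) i j : pow g (i + j)%N = pow g i *m pow g j.
Proof. by rewrite /mpow; elim: i => [|i IH]; rewrite /= ?mul1mx // IH mulmxA. Qed.
Lemma pow_comm (g h : M) k : g *m h = h *m g -> g *m pow h k = pow h k *m g.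
Proof.
move=> c; rewrite /mpow; elim: k => [|k IH] /=; first by rewrite mul1mx mulmx1.
by rewrite mulmxA c -!mulmxA IH.
Qed.
Lemma G_pow g k : G g -> G (pow g k).
Proof.
by move=> Gg; rewrite /mpow; elim: k => [|k IH] /=; [apply: (G_one Ggr)|apply: (G_mul Ggr)].
Qed.

(** Discreteness makes two powers coincide, so [h] has finite order. *)
Lemma bounded_powers (h : M) (R : RR) : G h -> (forall k, gmax (pow h k) <= R) -> h = 1%:M.
Proof.
move=> Gh hR.
have [i [j [ij e]]] := bounded_repeat (fun k => G_pow k Gh) hR.
apply: (Gtf Gh (k := (j - i)%N)); first by rewrite subn_gt0.
have : pow h i *m pow h (j - i)%N = pow h i by rewrite -powD subnKC // ltnW.
move/(congr1 (mulmx (shp (pow h i)))); rewrite mulmxA.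
by rewrite (G_mulVl GSp (G_pow i Gh)) mul1mx.
Qed.

Lemma G_weval a b w : G a -> G b -> G (weval a b w).
Proof.
move=> Ga Gb; elim: w => [|c w IH] /=; first exact: (G_one Ggr).
by apply: (G_mul Ggr) => //; case: c.
Qed.

Lemma free_pair_words a b k : free_pair mulmx 1%:M G a b -> exists s : seq M,
  [/\ uniq s, size s = (2 ^ k)%N &
      forall g, g \in s -> exists2 w, size w = k & g = weval a b w].
Proof.
case=> Ga Gb free.
exists [seq weval a b (tval w) | w <- enum {: k.-tuple bool}]; split.
- rewrite map_inj_in_uniq ?enum_uniq // => w1 w2 _ _ e; apply/val_inj/free => //.
  by rewrite !size_tuple.
- by rewrite size_map -cardE card_tuple card_bool.
- by move=> g /mapP [w _ ->]; exists (tval w) => //; rewrite size_tuple.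
Qed.

Lemma free_pair_unbounded a b : free_pair mulmx 1%:M G a b -> unbounded G.
Proof.
move=> fp R; apply: contrapT => hn.
have [N hN] := count_bounded_real R.
have [s [us ss hs]] := free_pair_words N fp.
case: (fp) => Ga Gb _.
have := hN s us; rewrite ss => h.
have : (2 ^ N <= N)%N.
  apply: h => g /hs [w _ ->]; have Gw := G_weval w Ga Gb; split=> //.
  by rewrite leNgt; apply/negP => ?; apply: hn; exists (weval a b w).
by rewrite leqNgt ltn_expl.
Qed.
End Discrete.

(** * Fixed null lines *)

(** [p] projects onto the orthogonal complement of the hyperbolic plane of [u] and [q], where last
    entries vanish and Cauchy-Schwarz holds. For null [z], [sq (p z) <= 2 |<q, z>| |<u, z>|], so the
    cross term of [<x, y>] is exactly what completes the square. *)
Lemma null_form_bound n (u q x y : 'cV[quat]_n.+1) :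
  sq u = 0 -> sq q = 0 -> hform u q = 1 ->
  (forall z, hform u z = 0 -> hform q z = 0 -> z ord_max 0 = 0) ->
  sq x = 0 -> sq y = 0 ->
  qabs (hform x y) <=
    (Num.sqrt (qabs (hform q x) * qabs (hform u y)) +
     Num.sqrt (qabs (hform u x) * qabs (hform q y))) ^+ 2.
Proof.
move=> su sq0 uq hz sx sy.
have qu : hform q u = 1 by rewrite -form_conj uq qconj1.
pose p z := z - rs u (hform q z) - rs q (hform u z).
have pu z : hform u (p z) = 0.
  by rewrite !formBr !form_rsr form_sq su uq raddf0 mul0r subr0 mul1r subrr.
have pq z : hform q (p z) = 0.
  by rewrite !formBr !form_rsr form_sq sq0 qu raddf0 mul0r subr0 mul1r subrr.
have pn z : p z ord_max 0 = 0 by apply: hz.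
have pp z w : hform (p z) (p w) =
    hform z w - qconj (hform q z) * hform u w - qconj (hform u z) * hform q w.
  have pu' : hform (p z) u = 0 by rewrite -form_conj pu raddf0.
  have pq' : hform (p z) q = 0 by rewrite -form_conj pq raddf0.
  rewrite {2}/p !formBr !form_rsr pu' pq' !mul0r !subr0.
  by rewrite !formBl !form_rsl.
have sqp z : sq (p z) = \sum_(i | i != ord_max) qnorm2 (p z i 0).
  by rewrite /sq pn [qnorm2 0](_ : _ = 0) ?subr0 //; apply/eqP; rewrite qnorm2_eq0.
have cs : qabs (hform (p x) (p y)) ^+ 2 <= sq (p x) * sq (p y).
  by rewrite form_split !sqp !pn mulr0 subr0; apply: quat_cauchy_schwarz.
have sp z : sq z = 0 -> 0 <= sq (p z) <= 2 * (qabs (hform q z) * qabs (hform u z)).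
  move=> sz; apply/andP; split.
    by rewrite sqp; apply: sumr_ge0 => i _; apply: qnorm2_ge0.
  have : qr (hform (p z) (p z)) = sq (p z) by rewrite form_sq.
  rewrite pp form_sq sz raddf0 sub0r => <-.
  have h1 := qr_le_abs (qconj (hform q z) * hform u z).
  have h2 := qr_le_abs (qconj (hform u z) * hform q z).
  rewrite !qabsM !qabs_conj !ler_norml in h1 h2.
  by case/andP: h1 => h1 _; case/andP: h2 => h2 _; rewrite qrD !qrN; lra.
have /andP[sx0 sxl] := sp x sx; have /andP[sy0 syl] := sp y sy.
set A := qabs (hform q x) in sxl *; set A' := qabs (hform u x) in sxl *.
set B := qabs (hform q y) in syl *; set B' := qabs (hform u y) in syl *.
have [A0 A'0 B0 B'0] : [/\ 0 <= A, 0 <= A', 0 <= B & 0 <= B'] by split; apply: qabs_ge0.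
have xy : qabs (hform x y) <= qabs (hform (p x) (p y)) + A' * B + A * B'.
  have -> : hform x y = hform (p x) (p y) + qconj (hform u x) * hform q y +
      qconj (hform q x) * hform u y by rewrite pp !subrK.
  apply: le_trans (qabsD _ _) _; rewrite qabsM qabs_conj lerD //.
  by apply: le_trans (qabsD _ _) _; rewrite qabsM qabs_conj.
set P := qabs (hform (p x) _) in xy cs.
have P0 : 0 <= P by apply: qabs_ge0.
clearbody A A' B B' P.
apply: le_trans xy _; rewrite sqrrD !sqr_sqrtr ?mulr_ge0 //.
rewrite -sqrtrM ?mulr_ge0 // mulr2n.
set S := Num.sqrt _.
have S0 : 0 <= S by apply: sqrtr_ge0.
have SS : S ^+ 2 = A * B' * (A' * B) by rewrite sqr_sqrtr // !mulr_ge0.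
suff : P <= 2 * S by lra.
rewrite -(@ler_pXn2r _ 2) ?nnegrE //; last lra.
rewrite exprMn SS; apply: le_trans cs _.
apply: le_trans (ler_pM sx0 sy0 sxl syl) _.
by apply: eq_ler; ring.
Qed.

Section FixedLine.
Variable n : nat.
Local Notation M := 'M[quat]_n.+1.
Local Notation V := 'cV[quat]_n.+1.
Local Notation J := (Jq n).
Local Notation gmax g := (qabs (g ord_max ord_max)).
Local Notation pow := (mpow mulmx (1%:M : M)).
Local Notation weval := (word_eval mulmx (1%:M : M)).
Variable G : M -> Prop.
Hypothesis GSp : forall g, G g -> in_Sp g.
Hypothesis Ggr : is_subgroup mulmx 1%:M G.
Hypothesis Gdisc : discrete (@qnear n) G.
Hypothesis Gtf : torsion_free mulmx 1%:M G.

Section Normalized.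
Variable u : V.
Hypotheses (su : sq u = 0) (un : u ord_max 0 = 1).
Hypothesis fixu : forall h, G h -> hform u (h *m u) = 0.

Let en : V := delta_mx ord_max 0.
(** A null vector opposite to [u], with [<u, q> = 1]. Since [en] is a combination of [u] and [q],
    vectors orthogonal to both have last entry 0. *)
Let q : V := rs u (qreg 2^-1) - en.
Let chi (h : M) : quat := (h *m u) ord_max 0.
(** With the square roots, [kap] is a dilation factor and [nu] behaves as a length, so that [nu_mul]
    becomes a twisted triangle inequality. *)
Let kap (h : M) : RR := Num.sqrt (qabs (chi h)).
Let nu (h : M) : RR := Num.sqrt (qabs (hform q (h *m q))).

Lemma form_en (x : V) : hform en x = - x ord_max 0.
Proof.
rewrite formE (bigD1 ord_max) //= big1 => [|i im]; last first.
  by rewrite mxE eqxx (negbTE im) raddf0 mul0r mulr0.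
by rewrite mxE !eqxx /= addr0 qconj1 mul1r /sgn eqxx rmorphN rmorph1 mulN1r.
Qed.
Lemma form_en_entry (h : M) : hform en (h *m en) = - h ord_max ord_max.
Proof. by rewrite form_en -colE mxE. Qed.
Lemma form_u_q1 : hform u q = 1.
Proof.
rewrite formBr form_rsr form_sq su raddf0 mul0r sub0r.
by rewrite -form_conj form_en un raddfN /= qconj1 opprK.
Qed.
Lemma sq_opposite : sq q = 0.
Proof.
apply: qreg_inj; rewrite -form_sq {1}/q formBl form_rsl form_u_q1 mulr1 qconj_reg.
rewrite form_en !mxE un !eqxx /= mul1r raddf0; apply: quat_eq; rewrite ?qE /=; lra.
Qed.
Lemma en_uq : en = rs u (qreg 2^-1) - q.
Proof. by rewrite opprB addrC subrK. Qed.
Lemma orth_uq z : hform u z = 0 -> hform q z = 0 -> z ord_max 0 = 0.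
Proof.
move=> h1 h2; apply/eqP; rewrite -oppr_eq0 -form_en en_uq formBl form_rsl h1 h2.
by rewrite mulr0 subrr.
Qed.
Lemma u_neq0 : u != 0.
Proof. by apply/eqP => /matrixP/(_ ord_max 0); rewrite un mxE => /eqP; rewrite oner_eq0. Qed.
Lemma chiP h : G h -> h *m u = rs u (chi h).
Proof.
move=> Gh; have sh : sq (h *m u) = 0 by rewrite (G_sq GSp _ Gh).
by have := null_orth su sh (fixu Gh) u_neq0; rewrite un invr1 mul1r.
Qed.
Lemma chiM g h : G g -> G h -> chi (g *m h) = chi g * chi h.
Proof.
by move=> Gg Gh; rewrite {1}/chi -mulmxA (chiP Gh) rs_mul (chiP Gg) !mxE un mul1r.
Qed.
Lemma kapM g h : G g -> G h -> kap (g *m h) = kap g * kap h.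
Proof. by move=> Gg Gh; rewrite /kap chiM // qabsM sqrtrM ?qabs_ge0. Qed.
Lemma kap1 : kap 1%:M = 1.
Proof. by rewrite /kap /chi mul1mx un qabs1 sqrtr1. Qed.
Lemma kapV g : G g -> kap (shp g) * kap g = 1.
Proof. by move=> Gg; rewrite -kapM ?(G_mulVl GSp Gg) ?kap1 //; apply: (G_shp GSp Ggr). Qed.
Lemma kap_gt0 g : G g -> 0 < kap g.
Proof.
move=> Gg; rewrite lt0r sqrtr_ge0 andbT; apply/eqP => h.
by have /eqP := kapV Gg; rewrite h mulr0 eq_sym oner_eq0.
Qed.
Lemma kap_shp g : G g -> kap (shp g) = (kap g)^-1.
Proof.
move=> Gg; apply: (mulIf (lt0r_neq0 (kap_gt0 Gg))).
by rewrite kapV // mulVf // gt_eqF ?kap_gt0.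
Qed.
Lemma kap_sqr g : kap g ^+ 2 = qabs (chi g).
Proof. by rewrite sqr_sqrtr ?qabs_ge0. Qed.
Lemma form_q_u g : G g -> qabs (hform q (g *m u)) = kap g ^+ 2.
Proof.
move=> Gg; rewrite (chiP Gg) form_rsr kap_sqr -form_conj form_u_q1 qconj1 mul1r //.
Qed.
Lemma form_u_q g : G g -> qabs (hform u (g *m q)) = (kap g)^-1 ^+ 2.
Proof.
move=> Gg; rewrite form_shp -form_conj qabs_conj form_q_u ?kap_shp //.
exact: (G_shp GSp Ggr).
Qed.
Lemma nu_shp g : nu (shp g) = nu g.
Proof. by rewrite /nu form_shp shpK -form_conj qabs_conj. Qed.
Lemma nu_sqr g : nu g ^+ 2 = qabs (hform q (g *m q)).
Proof. by rewrite sqr_sqrtr ?qabs_ge0. Qed.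
Lemma nu_ge0 g : 0 <= nu g. Proof. exact: sqrtr_ge0. Qed.

(* [nu] is the Cygan norm of the Heisenberg group acting on the horospheres
   centred at [u]. *)
Lemma nu_mul g h : G g -> G h -> nu (g *m h) <= nu g * (kap h)^-1 + kap g * nu h.
Proof.
move=> Gg Gh; have k0 := kap_gt0 Gh; have k1 := kap_gt0 Gg.
have V0 : 0 <= nu g * (kap h)^-1 + kap g * nu h.
  by rewrite addr_ge0 // mulr_ge0 ?nu_ge0 ?invr_ge0 ?ltW.
have Gg' := G_shp GSp Ggr Gg.
have s1 : sq (shp g *m q) = 0 by rewrite (G_sq GSp) // sq_opposite.
have s2 : sq (h *m q) = 0 by rewrite (G_sq GSp) // sq_opposite.
have := null_form_bound su sq_opposite form_u_q1 orth_uq s1 s2.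
rewrite -form_shp mulmxA -nu_sqr -(nu_sqr (shp g)) nu_shp -nu_sqr.
rewrite (form_u_q Gh) (form_u_q Gg') kap_shp // invrK.
rewrite -!exprMn !sqrtr_sqr !ger0_norm ?mulr_ge0 ?nu_ge0 ?invr_ge0 ?(ltW k0) ?(ltW k1) //.
by rewrite ler_pXn2r ?nnegrE ?nu_ge0.
Qed.

(** Expand [<en, g en>] with [en = u/2 - q]: the term in [u, u] vanishes, the two mixed terms have
    modulus 1/2 because [kap g = 1], and the last is [nu g ^+ 2]. *)
Lemma gmax_le g : G g -> kap g = 1 -> gmax g <= nu g ^+ 2 + 1.
Proof.
move=> Gg kg; rewrite -qabsN -form_en_entry; set r := qreg 2^-1.
have gen (e v w : V) : e = rs v r - w -> hform e (g *m e) =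
    qconj r * (hform v (g *m v) * r) - qconj r * hform v (g *m w)
    - (hform w (g *m v) * r - hform w (g *m w)).
  move=> ->; rewrite mulmxBr rs_mul !formBl !formBr !form_rsl !form_rsr //.
rewrite (gen _ _ _ en_uq) (fixu Gg) mul0r mulr0 sub0r.
apply: le_trans (qabsB _ _) _; apply: le_trans (lerD (lexx _) (qabsB _ _)) _.
rewrite qabsN !qabsM (form_q_u Gg) (form_u_q Gg) kg -nu_sqr invr1 expr1n.
by rewrite qabs_conj qabs_reg ger0_norm; lra.
Qed.

Lemma bounded_kernel h (C : RR) : G h -> kap h = 1 ->
  (forall l, nu (pow h l) <= C) -> h = 1%:M.
Proof.
move=> Gh kh hC; apply: (bounded_powers GSp Ggr Gdisc Gtf (R := C ^+ 2 + 1)) => // l.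
have Gl := G_pow Ggr l Gh.
have kl : kap (pow h l) = 1.
  elim: l {Gl} => [|l IH]; first exact: kap1.
  by rewrite /mpow /= kapM ?kh ?mul1r //; apply: (G_pow Ggr).
apply: le_trans (gmax_le Gl kl) _; rewrite lerD2r.
by rewrite ler_pXn2r ?nnegrE ?nu_ge0 // (le_trans (nu_ge0 _) (hC l)).
Qed.

(** * Groups fixing a null line and containing a dilation *)

Section Loxodromic.
Variable g : M.
Hypotheses (Gg : G g) (kg : 1 < kap g).

Lemma kap_pow k : kap (pow g k) = kap g ^+ k.
Proof.
elim: k => [|k IH]; first by rewrite expr0 kap1.
by rewrite /mpow /= kapM ?exprS ?IH //; apply: (G_pow Ggr).
Qed.

(** Chosen so that [C (kap^k - kap^-k)] satisfies the recursion given by [nu_mul] with equality. *)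
Let C := nu g / (kap g - (kap g)^-1).

Lemma nu_pow k : nu (pow g k) <= C * (kap g ^+ k - (kap g)^-1 ^+ k).
Proof.
have k0 : 0 < kap g := lt_trans ltr01 kg.
have ki : (kap g)^-1 < 1 by rewrite invf_lt1.
elim: k => [|k IH].
  by rewrite !expr0 subrr mulr0 /nu mul1mx form_sq sq_opposite raddf0 qabs0 sqrtr0.
have := nu_mul Gg (G_pow Ggr k Gg); rewrite kap_pow /mpow /= => /le_trans; apply.
rewrite -/(mpow _ _ _ _).
apply: le_trans (lerD (lexx _) (ler_wpM2l (ltW k0) IH)) _.
have kk : kap g - (kap g)^-1 != 0 by rewrite subr_eq0 gt_eqF // (lt_trans ki kg).
have e : nu g = C * (kap g - (kap g)^-1) by rewrite /C divfK.
rewrite {1}e exprVn !exprS exprVn; set b := kap g ^+ k; set c := kap g in k0 *.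
have b0 : 0 < b by apply: exprn_gt0.
by apply: eq_ler; field; rewrite !gt_eqF.
Qed.

(* The conjugates [g^-k h g^k] stay bounded, so two of them agree and [h] commutes
   with a power of [g]; applied to the powers of [h], this bounds them. *)
Lemma kernel_trivial h : G h -> kap h = 1 -> h = 1%:M.
Proof.
move=> Gh kh.
have k0 : 0 < kap g := lt_trans ltr01 kg.
have ki : (kap g)^-1 < 1 by rewrite invf_lt1.
have C0 : 0 <= C by rewrite divr_ge0 ?nu_ge0 // subr_ge0 ltW // (lt_trans ki kg).
have nuk k : nu (pow g k) * (kap g)^-1 ^+ k <= C.
  rewrite exprVn ler_pdivrMr ?exprn_gt0 //; apply: le_trans (nu_pow k) _.
  rewrite ler_wpM2l // gerBl exprn_ge0 // invr_ge0 ltW //.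
have conj_bound h' k : G h' -> kap h' = 1 ->
    nu (shp (pow g k) *m (h' *m pow g k)) <= 2 * C + nu h' * ((kap g)^-1 ^+ k) ^+ 2.
  move=> Gh' kh'; have Gk := G_pow Ggr k Gg.
  apply: le_trans (nu_mul (G_shp GSp Ggr Gk) (G_mul Ggr Gh' Gk)) _.
  rewrite nu_shp kap_shp // kapM // kh' mul1r kap_pow.
  have := nu_mul Gh' Gk; rewrite kh' mul1r kap_pow -exprVn.
  have := nuk k; have := nu_ge0 h'; have : 0 <= (kap g)^-1 ^+ k by rewrite exprn_ge0 // invr_ge0 ltW.
  move: ((kap g)^-1 ^+ k) (nu (pow g k)) (nu h') (nu (h' *m _)) => a b c d; nra.
have kc k : kap (shp (pow g k) *m (h *m pow g k)) = 1.
  have Gk := G_pow Ggr k Gg.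
  by rewrite (kapM (G_shp GSp Ggr Gk) (G_mul Ggr Gh Gk)) (kapM Gh Gk) kh mul1r kapV.
pose f k := shp (pow g k) *m (h *m pow g k).
have Gf k : G (f k).
  have Gk := G_pow Ggr k Gg.
  by apply: (G_mul Ggr); [apply: (G_shp GSp Ggr)|apply: (G_mul Ggr)].
have fR k : gmax (f k) <= (2 * C + nu h) ^+ 2 + 1.
  apply: le_trans (gmax_le (Gf k) (kc k)) _; rewrite lerD2r.
  have cc : 0 <= 2 * C + nu h.
    by apply: addr_ge0; [apply: mulr_ge0|apply: nu_ge0].
  suff h1 : nu (f k) <= 2 * C + nu h by rewrite ler_pXn2r // nnegrE nu_ge0.
  apply: le_trans (conj_bound h k Gh kh) _; rewrite lerD2l ler_piMr ?nu_ge0 //.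
  by rewrite !exprn_ile1 ?exprn_ge0 ?invr_ge0 ?(ltW k0) ?(ltW ki).
have [i [j [ij fij]]] := bounded_repeat GSp Ggr Gdisc Gf fR.
pose m := (j - i)%N; have m0 : (0 < m)%N by rewrite subn_gt0.
have Gi := G_pow Ggr i Gg; have Gm := G_pow Ggr m Gg.
have comm : h *m pow g m = pow g m *m h.
  have ej : pow g j = pow g m *m pow g i by rewrite -powD subnK // ltnW.
  have conjK x : pow g i *m (shp (pow g i) *m (x *m pow g i)) *m shp (pow g i) = x.
    by rewrite (mulmxA (pow g i)) (G_mulV GSp Ggr Gi) mul1mx -mulmxA (G_mulV GSp Ggr Gi) mulmx1.
  have fj : f j = shp (pow g i) *m (shp (pow g m) *m (h *m pow g m) *m pow g i).
    by rewrite /f ej shp_mul -!mulmxA.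
  have eh : h = shp (pow g m) *m (h *m pow g m).
    by rewrite -[LHS]conjK -[RHS]conjK -/(f i) fij fj.
  by rewrite {2}eh mulmxA (G_mulV GSp Ggr Gm) mul1mx.
have km : (kap g)^-1 ^+ m < 1.
  by rewrite exprn_ilt1 // ?invr_ge0 ?(ltW k0) // -lt0n.
pose b := ((kap g)^-1 ^+ m) ^+ 2.
have b1 : b < 1 by rewrite exprn_ilt1 // exprn_ge0 // invr_ge0 ltW.
(* As [g^m] commutes with [h^l], [conj_bound] reads [nu (h^l) <= 2 C + b nu (h^l)]. *)
apply: (@bounded_kernel h (2 * C / (1 - b))) => // l.
have Gl := G_pow Ggr l Gh.
have kl : kap (pow h l) = 1.
  elim: l {Gl} => [|l IH]; first exact: kap1.
  by rewrite /mpow /= kapM ?kh ?mul1r //; apply: (G_pow Ggr).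
rewrite ler_pdivlMr ?subr_gt0 //.
have := conj_bound (pow h l) m Gl kl.
rewrite -(pow_comm l (esym comm)) mulmxA (G_mulVl GSp Gm) mul1mx -/b; lra.
Qed.
End Loxodromic.

(** If [kap] is identically 1, [nu] is subadditive and words are counted. Otherwise [kernel_trivial]
    makes the homomorphism [kap] injective, so [G] is commutative, against the distinctness of [ab]
    and [ba]. *)
Lemma fixed_not_free a b : ~ free_pair mulmx 1%:M G a b.
Proof.
move=> fp; case: (fp) => Ga Gb free.
have [all1|] := pselect (forall h, G h -> kap h = 1).
  have [A [D hAD]] := count_bounded GSp Ggr Gdisc.
  pose C := (Num.bound (nu a + nu b)).
  have hC c : nu (if c then a else b) <= C%:R.
    have : nu a + nu b < C%:R by apply: archi_boundP; rewrite addr_ge0 ?nu_ge0.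
    by have := nu_ge0 a; have := nu_ge0 b; case: c; lra.
  have hw w : nu (weval a b w) <= C%:R * (size w)%:R.
    elim: w => [|c w IH].
      by rewrite mulr0 /nu mul1mx form_sq sq_opposite raddf0 qabs0 sqrtr0.
    have Gc : G (if c then a else b) by case: c.
    have Gw := G_weval Ggr w Ga Gb.
    have := nu_mul Gc Gw; rewrite !all1 // invr1 mulr1 mul1r /= => /le_trans; apply.
    by rewrite -natr1 mulrDr mulr1 addrC lerD.
  have [k] := exp_beats_poly A C D; rewrite ltnNge => /negP; apply.
  have [s [us <- hs]] := free_pair_words k fp.
  apply: hAD => //; first by rewrite addn1.
  move=> g /hs [w sw ->]; have Gw := G_weval Ggr w Ga Gb; split=> //.
  apply: le_trans (gmax_le Gw (all1 _ Gw)) _; rewrite natrD lerD2r natrX natrM.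
  by rewrite ler_pXn2r ?nnegrE ?nu_ge0 ?mulr_ge0 // -sw hw.
move=> /existsNP [g /not_implyP [Gg kg]].
have [g' Gg' kg'] : exists2 g', G g' & 1 < kap g'.
  case: (ltgtP (kap g) 1) kg => // k1 _; last by exists g.
  exists (shp g); first exact: (G_shp GSp Ggr).
  by rewrite kap_shp // invf_gt1 // kap_gt0.
have Gab := G_mul Ggr Ga Gb; have Gba := G_mul Ggr Gb Ga.
have e : shp (b *m a) *m (a *m b) = 1%:M.
  apply: (kernel_trivial Gg' kg'); first by apply: (G_mul Ggr) => //; apply: (G_shp GSp Ggr).
  rewrite kapM //; last exact: (G_shp GSp Ggr).
  by rewrite kap_shp // !kapM // [kap b * _]mulrC mulVf // gt_eqF // mulr_gt0 ?kap_gt0.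
have : a *m b = b *m a.
  by rewrite -[LHS]mul1mx -(G_mulV GSp Ggr Gba) -mulmxA e mulmx1.
move=> ab; have := @free [:: true; false] [:: false; true] erefl.
by rewrite /= !mulmx1 => /(_ ab).
Qed.
End Normalized.

Lemma free_no_fixed_null a b : free_pair mulmx 1%:M G a b ->
  forall u : V, u != 0 -> sq u = 0 -> exists2 h, G h & hform u (h *m u) != 0.
Proof.
move=> fp u u0 su; apply: contrapT => hn.
have un := null_max_neq0 su u0.
pose w := rs u (u ord_max 0)^-1.
apply: (@fixed_not_free w _ _ _ a b) => //.
- by apply: qreg_inj; rewrite -form_sq form_rsl form_rsr form_sq su raddf0 mul0r mulr0.
- by rewrite mxE mulrV.
- move=> h Gh; rewrite rs_mul form_rsl form_rsr.
  have -> : hform u (h *m u) = 0.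
    by apply/eqP; apply: contrapT => /negP ?; apply: hn; exists h.
  by rewrite mul0r mulr0.
Qed.

(** A kernel element has all its powers in a bounded set, so it is trivial. Near [rho g] only images
    of a finite list occur, and those different from [rho g] keep a positive distance. *)
Lemma proper_faithful (rho : M -> M) :
  (forall g h, G g -> G h -> rho (g *m h) = rho g *m rho h) ->
  (forall g, G g -> rho g *m shp (rho g) = 1%:M) ->
  (forall R : RR, exists R' : RR, forall h, G h -> gmax (rho h) <= R -> gmax h <= R') ->
  (forall g h, G g -> G h -> rho g = rho h -> g = h) /\
  discrete (@qnear n) (Defs.image G rho).
Proof.
move=> rhoM rho_inv proper.
have rho1 : rho 1%:M = 1%:M.
  have G1 := G_one Ggr; have := rhoM _ _ G1 G1; rewrite mul1mx => e.
  by have := rho_inv _ G1; rewrite {1}e -mulmxA (rho_inv _ G1) mulmx1.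
have rhoX h k : G h -> rho (pow h k) = pow (rho h) k.
  by move=> Gh; elim: k => [|k IH] //=; rewrite /mpow /= rhoM ?IH //; apply: (G_pow Ggr).
split.
  move=> g h Gg Gh e.
  have Gk : G (shp g *m h) by apply: (G_mul Ggr) => //; apply: (G_shp GSp Ggr).
  have kk : rho (shp g *m h) = 1%:M.
    have Gi := G_shp GSp Ggr Gg.
    by rewrite (rhoM _ _ Gi Gh) -e -(rhoM _ _ Gi Gg) (G_mulVl GSp Gg).
  have [R' hR'] := proper 1.
  have : shp g *m h = 1%:M.
    apply: (bounded_powers GSp Ggr Gdisc Gtf (R := R')) => // k.
    apply: hR'; first exact: (G_pow Ggr).
    rewrite rhoX // kk; have -> : pow 1%:M k = 1%:M.
      by rewrite /mpow; elim: k => [|k IH] //=; rewrite mul1mx.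
    by rewrite mxE eqxx qabs1.
  by move=> e1; rewrite -[h]mul1mx -(G_mulV GSp Ggr Gg) -mulmxA e1 mulmx1.
move=> _ [g Gg <-].
have [R' hR'] := proper (gmax (rho g) + 1).
have [l hl] := bounded_finite GSp Ggr Gdisc R'.
pose dist h := mnorm (rho h - rho g) ^+ 2.
have [e e0 he] : exists2 e : RR, 0 < e &
    forall h, h \in l -> rho h != rho g -> e <= dist h.
  elim: l {hl} => [|h l [e e0 IH]]; first by exists 1.
  have [eq|neq] := eqVneq (rho h) (rho g).
    exists e => // h'; rewrite inE => /orP[/eqP->|]; last exact: IH.
    by rewrite eq eqxx.
  exists (Num.min e (dist h)).
    by rewrite lt_min e0 /dist exprn_gt0 // lt0r mnorm_ge0 andbT mnorm_eq0 subr_eq0.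
  move=> h'; rewrite inE => /orP[/eqP->|h'l] hh; first by rewrite ge_min lexx orbT.
  by rewrite ge_min IH.
pose N := (n.+1 * n.+1)%:R : RR.
have N0 : 0 < N by rewrite ltr0n.
(* [d] bounds squared entries: [d <= 1] moves the corner by at most 1, so [h] is in [l], and [N]
   entries below [sqrt d] give [dist h <= d N^2 <= e / 2]. *)
pose d := Num.min 1 (e / (2 * N ^+ 2)).
have d0 : 0 < d by rewrite lt_min ltr01 divr_gt0 // mulr_gt0 // exprn_gt0.
exists d => // _ [h Gh <-] near.
have close i j : qabs ((rho h - rho g) i j) ^+ 2 < d.
  by have := near i j; rewrite qabs_sqr mxBE.
have hl' : h \in l.
  apply: hl => //; apply: hR' => //.
  have := qabsD (rho g ord_max ord_max) ((rho h - rho g) ord_max ord_max).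
  have -> : rho g ord_max ord_max + (rho h - rho g) ord_max ord_max = rho h ord_max ord_max.
    by rewrite mxBE addrC subrK.
  move/le_trans; apply; rewrite lerD2l.
  rewrite -(@ler_pXn2r _ 2) ?nnegrE ?qabs_ge0 // expr1n.
  by apply/ltW; apply: lt_le_trans (close _ _) _; rewrite ge_min lexx.
apply/eqP; apply: contrapT => /negP neq.
have := he h hl' neq; rewrite leNgt => /negP; apply; rewrite /dist.
have sd0 : 0 <= Num.sqrt d by apply: sqrtr_ge0.
have : mnorm (rho h - rho g) <= Num.sqrt d * N.
  apply: mnorm_le => i j; rewrite -(@ler_pXn2r _ 2) ?nnegrE ?qabs_ge0 //.
  by rewrite [leRHS]sqr_sqrtr ?(ltW d0) //; apply/ltW/close.
move=> hm; apply: (@le_lt_trans _ _ (d * N ^+ 2)).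
  rewrite -[d in leRHS]sqr_sqrtr ?(ltW d0) // -exprMn.
  by rewrite ler_pXn2r ?nnegrE ?mnorm_ge0 // mulr_ge0 // ltW.
apply: (@le_lt_trans _ _ (e / (2 * N ^+ 2) * N ^+ 2)).
  by rewrite ler_wpM2r ?sqr_ge0 // /d ge_min lexx orbT.
have -> : e / (2 * N ^+ 2) * N ^+ 2 = e / 2 by rewrite invfM [e * (_ * _)]mulrA mulfVK // expf_neq0 // gt_eqF.
lra.
Qed.
End FixedLine.

(** * Ping-pong *)

Section FreePair.
Variable n : nat.
Local Notation M := 'M[quat]_n.+1.
Local Notation V := 'cV[quat]_n.+1.
Local Notation J := (Jq n).
Local Notation gmax g := (qabs (g ord_max ord_max)).
Local Notation weval := (word_eval mulmx (1%:M : M)).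
Variable G : M -> Prop.
Hypothesis GSp : forall g, G g -> in_Sp g.
Hypothesis Ggr : is_subgroup mulmx 1%:M G.

Section PingPong.
Variables (w : 'rV[quat]_n.+1) (eps : RR).
Hypothesis eps0 : 0 < eps.
Let W (y : V) : quat := (w *m y) 0 0.

(** A homogeneous form of the ball of radius [eps] around [p] in the affine chart [W = 1]. *)
Definition cone (p y : V) : Prop :=
  W y != 0 /\ mnorm (y - rs p (W y)) <= eps * qabs (W y).

Lemma pairing_rs y q : W (rs y q) = W y * q.
Proof. by rewrite /W rs_mul mxE. Qed.
Lemma pairing_add y z : W (y + z) = W y + W z.
Proof. by rewrite /W mulmxDr mxE. Qed.
Lemma pairing_le y : qabs (W y) <= mnorm w * mnorm y.
Proof. exact: le_trans (mnorm_entry _ _ _) (mnorm_mul _ _). Qed.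

Lemma cone_contraction (p : V) (c : quat) (B : RR) : W p = 1 -> c != 0 ->
  Cl G (rs p c *m w) -> exists2 a, G a &
    forall p' y, mnorm p' <= B -> cone p' y -> cone p (a *m y).
Proof.
move=> Wp c0 clA.
have [B0|B0] := ltP B 0.
  exists 1%:M; first exact: (G_one Ggr).
  by move=> p' y pB; have := mnorm_ge0 p'; lra.
have P0 := mnorm_ge0 p; have w0 := mnorm_ge0 w.
have cp : 0 < qabs c by rewrite qabs_gt0.
pose K1 := (B + eps) * (1 + mnorm p * mnorm w).
pose K2 := mnorm w * (B + eps).
have K10 : 0 <= K1 by rewrite mulr_ge0 ?addr_ge0 ?mulr_ge0 // ltW.
have K20 : 0 <= K2 by rewrite mulr_ge0 ?addr_ge0 // ltW.
have S0 : 0 < K1 + eps * K2 + 1 by have : 0 <= eps * K2 by [rewrite mulr_ge0 // ltW]; lra.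
(* Below, [|z - p W z| <= d K1 |W y|] and [|W z| >= (|c| - d K2) |W y|], so what is needed is
   [d K1 <= eps (|c| - d K2)]; the added 1 makes this strict. *)
pose d := eps * qabs c / (K1 + eps * K2 + 1).
have d0 : 0 < d by rewrite !mulr_gt0 // invr_gt0.
have dE : d * (K1 + eps * K2 + 1) = eps * qabs c by rewrite /d mulfVK // gt_eqF.
have [t [a [Ga ha]]] := clA d d0; exists a => // p' y p'B [Wy0 hy].
set D := qreg t *: a - _ in ha.
have Wyp : 0 < qabs (W y) by rewrite qabs_gt0.
have ny : mnorm y <= (B + eps) * qabs (W y).
  have := mnormD (y - rs p' (W y)) (rs p' (W y)); rewrite subrK mnorm_rs mulrDl.
  have : mnorm p' * qabs (W y) <= B * qabs (W y) by rewrite ler_pM2r.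
  lra.
pose z := qreg t *: (a *m y).
have zE : z = rs p (c * W y) + D *m y.
  have <- : rs p c *m w *m y = rs p (c * W y) by rewrite -mulmxA mul_mx11 rs_rs.
  by rewrite /z scalemxAl -mulmxDl /D addrC subrK.
have nD : mnorm (D *m y) <= d * ((B + eps) * qabs (W y)).
  apply: le_trans (mnorm_mul _ _) _; apply: ler_pM; rewrite ?mnorm_ge0 //.
  exact: ltW.
have WzE : W z = c * W y + W (D *m y) by rewrite zE pairing_add pairing_rs Wp mul1r.
have WD : qabs (W (D *m y)) <= d * K2 * qabs (W y).
  apply: le_trans (pairing_le _) _; rewrite /K2; have := ler_wpM2l w0 nD; lra.
have Wz : (qabs c - d * K2) * qabs (W y) <= qabs (W z).
  have := qabsB (W z) (W (D *m y)); rewrite {1}WzE addrK qabsM; lra.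
have dK2 : d * K2 < qabs c by rewrite -(ltr_pM2l eps0); nra.
have Wz0 : W z != 0.
  by rewrite -qabs_gt0; apply: lt_le_trans Wz; rewrite mulr_gt0 ?subr_gt0.
have nz : mnorm (z - rs p (W z)) <= eps * qabs (W z).
  have -> : z - rs p (W z) = D *m y - rs p (W (D *m y)).
    by rewrite WzE rsDr {1}zE opprD addrACA subrr add0r.
  apply: le_trans (mnormB _ _) _; rewrite mnorm_rs.
  have h1 : mnorm p * qabs (W (D *m y)) <= mnorm p * (mnorm w * (d * ((B + eps) * qabs (W y)))).
    by rewrite ler_wpM2l //; apply: le_trans (pairing_le _) _; rewrite ler_wpM2l.
  have h2 : eps * ((qabs c - d * K2) * qabs (W y)) <= eps * qabs (W z) by rewrite ler_pM2l.
  apply: le_trans h2; apply: le_trans (lerD nD h1) _.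
  have -> : d * ((B + eps) * qabs (W y)) +
    mnorm p * (mnorm w * (d * ((B + eps) * qabs (W y)))) = (d * K1) * qabs (W y).
    by rewrite /K1; ring.
  by rewrite mulrA ler_pM2r //; nra.
have Wza : W z = qreg t * W (a *m y) by rewrite /z /W mul_regZ mxE.
have t0 : t != 0.
  by apply: contraNneq Wz0 => t0; rewrite Wza t0 raddf0 mul0r.
have tp : 0 < `|t| by rewrite normr_gt0.
split.
  by apply: contraNneq Wz0 => h; rewrite Wza h mulr0.
rewrite -(ler_pM2l tp) -qabs_reg -mnormZ.
have -> : qreg t *: (a *m y - rs p (W (a *m y))) = z - rs p (W z).
  rewrite scalerBr -/z Wza qregC -rs_rs rs_reg //.
by rewrite mulrCA -qabsM -Wza.
Qed.
End PingPong.

(** Both limits have the same kernel, that of [w], so [a] and [b] each map both cones into their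
    own. As the cones are disjoint, the image of [p1] reveals the first letter of a word. *)
Lemma ping_pong (w : 'rV[quat]_n.+1) (p1 p2 : V) (c1 c2 : quat) :
  (w *m p1) 0 0 = 1 -> (w *m p2) 0 0 = 1 -> p1 != p2 -> c1 != 0 -> c2 != 0 ->
  Cl G (rs p1 c1 *m w) -> Cl G (rs p2 c2 *m w) ->
  exists a b, free_pair mulmx 1%:M G a b.
Proof.
move=> W1 W2 p12 c10 c20 cl1 cl2.
have dp : 0 < mnorm (p1 - p2) by rewrite lt0r mnorm_ge0 andbT mnorm_eq0 subr_eq0.
(* A common point of the cones would put [p1] and [p2] within [2 eps], half their distance. *)
pose eps := mnorm (p1 - p2) / 4.
have eps0 : 0 < eps by rewrite /eps divr_gt0.
pose B := mnorm p1 + mnorm p2.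
have B1 : mnorm p1 <= B by rewrite lerDl mnorm_ge0.
have B2 : mnorm p2 <= B by rewrite lerDr mnorm_ge0.
have [a Ga ha] := cone_contraction eps0 B W1 c10 cl1.
have [b Gb hb] := cone_contraction eps0 B W2 c20 cl2.
have disj y : cone w eps p1 y -> cone w eps p2 y -> False.
  case=> Wy h1 [_ h2]; move: h1 h2; set q := (w *m y) 0 0 in Wy * => h1 h2.
  have qp : 0 < qabs q by rewrite qabs_gt0.
  have : mnorm (rs p1 q - rs p2 q) <= 2 * eps * qabs q.
    rewrite mnorm_distC in h1; have := mnorm_triangle (rs p1 q) y (rs p2 q).
    by move=> h; rewrite -mulrA mulr_natl mulr2n; apply: le_trans h (lerD h1 h2).
  have -> : rs p1 q - rs p2 q = rs (p1 - p2) q.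
    by apply/matrixP => i j; rewrite !mxE mulrBl.
  rewrite mnorm_rs ler_pM2r // /eps; lra.
exists a, b; split=> // w1 w2.
have y1 : cone w eps p1 p1.
  by split; rewrite W1 ?oner_eq0 // rs1 subrr mnorm0 qabs1 mulr1 ltW.
pose pt (c : bool) := if c then p1 else p2.
have step c x : (exists c', cone w eps (pt c') x) ->
    cone w eps (pt c) ((if c then a else b) *m x).
  by case=> c' hc'; case: c; [apply: (ha (pt c'))|apply: (hb (pt c'))] => //; case: (c') hc'.
have inC v : exists c, cone w eps (pt c) (weval a b v *m p1).
  elim: v => [|c v IH]; first by exists true; rewrite mul1mx.
  by exists c; rewrite /= -mulmxA; apply: step.
elim: w1 w2 => [|c1' w1 IH] [|c2' w2] //= [sw] e.
case: (eqVneq c1' c2') => [ec|nc].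
  rewrite -ec in e *; congr (_ :: _); apply: IH => //.
  have Gc : G (if c1' then a else b) by case: (c1').
  by have := congr1 (mulmx (shp (if c1' then a else b))) e; rewrite !mulmxA (G_mulVl GSp Gc) !mul1mx.
have s1 := step c1' _ (inC w1); have s2 := step c2' _ (inC w2).
rewrite !mulmxA e in s1 s2; exfalso.
by case: (c1') (c2') nc s1 s2 => -[] // _ s1 s2; [apply: (disj _ s1 s2)|apply: (disj _ s2 s1)].
Qed.

Lemma Cl_form0 (x y : V) A : (forall g, G g -> hform x (g *m y) = 0) ->
  Cl G A -> hform x (A *m y) = 0.
Proof.
move=> h clA; apply/eqP; rewrite -qabs_eq0; apply/eqP.
apply: (@eq0_small _ (mnorm x * mnorm y)) => [|e e0 _]; first exact: qabs_ge0.
have [t [g [Gg hg]]] := clA e e0.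
have -> : hform x (A *m y) = - hform x ((qreg t *: g - A) *m y).
  by rewrite mulmxBl formBr -scalemxAl form_regZr (h g Gg) mulr0 sub0r opprK.
rewrite qabsN; apply: le_trans (qabs_form _ _) _; rewrite -mulrA ler_wpM2l ?mnorm_ge0 //.
apply: le_trans (mnorm_mul _ _) _; rewrite mulrC ler_wpM2l ?mnorm_ge0 // ltW //.
Qed.

Definition rank_one_point (x v : V) : Prop :=
  [/\ sq x = 0, x != 0, sq v = 0, v != 0 & Cl G (x *m (adj v *m J))].

Lemma null_prop (x y z : V) : sq x = 0 -> x != 0 -> sq y = 0 -> y != 0 -> hform x y = 0 ->
  hform y z = 0 -> hform x z = 0.
Proof.
move=> sx x0 sy y0 xy yz; have yx : hform y x = 0 by rewrite -form_conj xy raddf0.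
by rewrite (null_orth sy sx yx y0) form_rsl yz mulr0.
Qed.

(* Composing [x_i v_i^* J], [h] and [x_1 v_1^* J] gives limits with image [x_i]
   and the common kernel [v_1], which meets at most one of the three points. *)
Lemma three_points_moving x1 v1 x2 v2 x3 v3 :
  rank_one_point x1 v1 -> rank_one_point x2 v2 -> rank_one_point x3 v3 ->
  hform x1 x2 != 0 -> hform x1 x3 != 0 -> hform x2 x3 != 0 ->
  (exists2 h, G h & hform x1 (h *m x1) != 0) ->
  exists a b, free_pair mulmx 1%:M G a b.
Proof.
move=> r1 r2 r3 x12 x13 x23 [h0 Gh0 hh0]; case: (r1) => sx1 x10 sv1 v10 cl1.
have move_to x v : rank_one_point x v -> exists2 d, d != 0 & Cl G (rs x d *m (adj v1 *m J)).
  case=> sx x0 sv v0 cl.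
  have [h Gh hv] : exists2 h, G h & hform v (h *m x1) != 0.
    apply: contrapT => hn.
    have vx h : G h -> hform v (h *m x1) = 0.
      by move=> Gh; apply/eqP; apply: contrapT => /negP ?; apply: hn; exists h.
    case/eqP: hh0; apply: (null_prop sx1 x10 sv v0); last exact: vx.
    by rewrite -form_conj -[x1]mul1mx vx ?raddf0 //; apply: (G_one Ggr).
  exists (hform v (h *m x1)); first exact: hv.
  have -> : rs x (hform v (h *m x1)) *m (adj v1 *m J) =
      x *m (adj v *m J) *m h *m (x1 *m (adj v1 *m J)).
    rewrite (mulmxA _ x1); set b := adj v1 *m J; set a := adj v *m J.
    by rewrite -2!(mulmxA x) mul_mx11 -(mulmxA a).
  exact: (Cl_mul Ggr (Cl_mul Ggr cl (Cl_G Gh)) cl1).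
have pair x v y v' : rank_one_point x v -> rank_one_point y v' -> hform x y != 0 ->
    hform v1 x != 0 -> hform v1 y != 0 -> exists a b, free_pair mulmx 1%:M G a b.
  move=> rx ry xy vx vy; have [d d0 cd] := move_to _ _ rx; have [d' d'0 cd'] := move_to _ _ ry.
  pose px := rs x (hform v1 x)^-1; pose py := rs y (hform v1 y)^-1.
  apply: (@ping_pong (adj v1 *m J) px py (hform v1 x * d) (hform v1 y * d')).
  - by rewrite /px rs_mul mxE mulrV.
  - by rewrite /py rs_mul mxE mulrV.
  - apply: contraNneq xy => pxy.
    have /eqP : hform px py = 0.
      by case: ry => sy _ _ _ _; rewrite pxy form_rsl form_rsr form_sq sy raddf0 mul0r mulr0.
    rewrite form_rsl form_rsr !quat_mulf_eq0 qconj_eq0 !quat_invr_eq0.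
    by rewrite (negbTE vx) (negbTE vy) /= orbF.
  - by rewrite quat_mulf_eq0 negb_or vx.
  - by rewrite quat_mulf_eq0 negb_or vy.
  - by rewrite rs_rs mulrA mulVr // mul1r.
  - by rewrite rs_rs mulrA mulVr // mul1r.
have sep x v y v' : rank_one_point x v -> rank_one_point y v' -> hform x y != 0 ->
    hform v1 x == 0 -> hform v1 y != 0.
  move=> [sx x0 _ _ _] _ xy /eqP vx; apply: contraNneq xy => vy.
  by apply/eqP; apply: (null_prop sx x0 sv1 v10) => //; rewrite -form_conj vx raddf0.
have [h1|h1] := boolP (hform v1 x1 == 0).
  exact: (pair _ _ _ _ r2 r3 x23 (sep _ _ _ _ r1 r2 x12 h1) (sep _ _ _ _ r1 r3 x13 h1)).
have [h2|h2] := boolP (hform v1 x2 == 0); last exact: (pair _ _ _ _ r1 r2 x12 h1 h2).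
exact: (pair _ _ _ _ r1 r3 x13 h1 (sep _ _ _ _ r2 r3 x23 h2)).
Qed.

(** If [G] moves none of the three lines, [Cl_form0] for the limit [x1 v1^* J] gives
    [<x_i, x1> <v1, x_i> = 0] for [i = 2, 3]. Then [x2] and [x3] are both orthogonal to the null
    vector [v1], hence proportional. *)
Lemma three_points x1 v1 x2 v2 x3 v3 :
  rank_one_point x1 v1 -> rank_one_point x2 v2 -> rank_one_point x3 v3 ->
  hform x1 x2 != 0 -> hform x1 x3 != 0 -> hform x2 x3 != 0 ->
  exists a b, free_pair mulmx 1%:M G a b.
Proof.
move=> r1 r2 r3 x12 x13 x23.
have sym x y : hform x y != 0 -> hform y x != 0.
  by rewrite -(form_conj y x) -qabs_eq0 qabs_conj qabs_eq0.
have [m1|f1] := pselect (exists2 h, G h & hform x1 (h *m x1) != 0).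
  exact: (three_points_moving r1 r2 r3).
have [m2|f2] := pselect (exists2 h, G h & hform x2 (h *m x2) != 0).
  by apply: (three_points_moving r2 r1 r3) => //; apply: sym.
have [m3|f3] := pselect (exists2 h, G h & hform x3 (h *m x3) != 0).
  by apply: (three_points_moving r3 r1 r2) => //; apply: sym.
have fix_ x : ~ (exists2 h, G h & hform x (h *m x) != 0) ->
    forall h, G h -> hform x (h *m x) = 0.
  by move=> f h Gh; apply/eqP; apply: contrapT => /negP ?; apply: f; exists h.
case: (r1) (r2) (r3) => [sx1 x10 sv1 v10 cl1] [sx2 x20 _ _ _] [sx3 x30 _ _ _].
have v1x x : hform x x1 != 0 -> ~ (exists2 h, G h & hform x (h *m x) != 0) ->
    hform v1 x = 0.
  move=> xx1 fx; have := Cl_form0 (fix_ _ fx) cl1.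
  by rewrite outer_mul form_rsr => /eqP; rewrite quat_mulf_eq0 (negbTE xx1) => /eqP.
case/eqP: x23; apply: (null_prop sx2 x20 sv1 v10).
  by rewrite -form_conj v1x ?raddf0 //; apply: sym.
by apply: v1x => //; apply: sym.
Qed.

Lemma sum_widen (F : 'I_n.+1 -> RR) :
  \sum_(i | i != ord_max) F i = \sum_(k < n) F (widen_ord (leqnSn n) k).
Proof.
apply: (addrI (F ord_max)); rewrite [RHS]addrC -big_ord_recr /=.
by rewrite [RHS](bigD1 ord_max).
Qed.

(* The boundary point [xi] of the ball model is the null line of [(xi, 1)]. *)
Definition vlift (xi : 'rV[quat]_n) : V :=
  \col_i (if insub (val i) is Some k then xi 0 k else 1).

Lemma vlift_widen xi k : vlift xi (widen_ord (leqnSn n) k) 0 = xi 0 k.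
Proof. by rewrite mxE /= valK. Qed.
Lemma vlift_max xi : vlift xi ord_max 0 = 1.
Proof. by rewrite mxE /= insubF // ltnn. Qed.
Lemma vlift_inj xi eta : (forall i, vlift xi i 0 = vlift eta i 0) -> xi = eta.
Proof. by move=> h; apply/rowP => k; rewrite -!vlift_widen h. Qed.
Lemma sq_vlift xi : qsphere xi -> sq (vlift xi) = 0.
Proof.
rewrite /qsphere /sq vlift_max sum_widen => h.
have -> : qnorm2 1 = 1 by rewrite -qabs_sqr qabs1 expr1n.
by apply/eqP; rewrite subr_eq0 -h; apply/eqP; apply: eq_bigr => k _; rewrite vlift_widen.
Qed.

Lemma ord_max_or_widen (i : 'I_n.+1) : i = ord_max \/ exists k, i = widen_ord (leqnSn n) k.
Proof.
case: (unliftP ord_max i) => [j ->|->]; [right|by left].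
by exists j; apply/val_inj; rewrite /= /bump leqNgt ltn_ord.
Qed.

(** The last column of [g] has [sq] equal to -1; divide it by the corner. Approach of the orbit to
    the sphere thereby becomes growth of [gmax]. *)
Lemma orb0_norm g : G g -> gmax g ^+ 2 * (1 - \sum_(k < n) qnorm2 (qorb0 g 0 k)) = 1.
Proof.
move=> Gg; have : hform (col ord_max g) (col ord_max g) = qreg (-1).
  rewrite -adj_mx_entry; move/in_SpE: (GSp Gg) => ->.
  by rewrite mxE eqxx; qring.
rewrite form_sq => /qreg_inj; rewrite /sq sum_widen !mxE -qabs_sqr => h.
have g0 : g ord_max ord_max != 0.
  apply/eqP => g0; move: h; rewrite g0 qabs0 expr0n /= subr0 => h.
  have : 0 <= \sum_(k < n) qnorm2 (col ord_max g (widen_ord (leqnSn n) k) 0).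
    by apply: sumr_ge0 => ? _; apply: qnorm2_ge0.
  by rewrite h; lra.
have e : \sum_(k < n) qnorm2 (col ord_max g (widen_ord (leqnSn n) k) 0) =
    gmax g ^+ 2 * \sum_(k < n) qnorm2 (qorb0 g 0 k).
  rewrite mulr_sumr; apply: eq_bigr => k _; rewrite !mxE -!qabs_sqr -exprMn -qabsM.
  have -> : qinv (g ord_max ord_max) = (g ord_max ord_max)^-1.
    by rewrite /GRing.inv /= /quat_inv (negbTE g0).
  rewrite !qabsM; congr (_ ^+ 2).
  by rewrite qabsV // mulrCA mulfV ?mulr1 // qabs_eq0.
by move: h; rewrite e mulrBr mulr1 => h; apply/eqP; rewrite -[1]opprK -h opprB.
Qed.
End FreePair.

(** * Limit sets *)

Section LimitSet.
Variable n : nat.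
Local Notation M := 'M[quat]_n.+1.
Local Notation V := 'cV[quat]_n.+1.
Local Notation J := (Jq n).
Local Notation gmax g := (qabs (g ord_max ord_max)).
Variable G : M -> Prop.
Hypothesis GSp : forall g, G g -> in_Sp g.
Hypothesis Ggr : is_subgroup mulmx 1%:M G.
Local Notation lim := (limit_set (@qorb0 n) (@qsphere n) (@qnearP n) G).

Lemma limit_approx xi (d : RR) : lim xi -> 0 < d ->
  exists2 g, G g & forall k, qabs (xi 0 k - qorb0 g 0 k) < d.
Proof.
move=> [_ h] d0; have [|g Gg hg] := h (d ^+ 2); first by rewrite exprn_gt0.
exists g => // k; rewrite -(@ltr_pXn2r _ 2) ?nnegrE ?qabs_ge0 ?(ltW d0) //.
by rewrite qabs_sqr; apply: hg.
Qed.

Lemma limit_seq xi (k : nat) : lim xi -> exists g,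
  [/\ G g, k%:R <= gmax g & forall i, qabs (xi 0 i - qorb0 g 0 i) <= k.+1%:R^-1].
Proof.
move=> hxi; pose K := k.+1%:R : RR; pose N := n%:R : RR.
have KE : k.+1%:R = K by [].
have NE : n%:R = N by [].
have kK : k%:R + 1 = K by rewrite natr1.
have K1 : 1 <= K by rewrite ler1n.
have N0 : 0 <= N by rewrite ler0n.
clearbody K N.
(* An orbit point within [d] of [xi] in each coordinate has squared norm at least [1 - 2 N d], so
   [gmax^2 * 2 N d >= 1]; the choice [d = 1 / c] then yields [gmax >= K]. *)
pose c := (2 * N + 1) * K ^+ 2.
have c0 : 0 < c by apply: mulr_gt0; [lra|apply: exprn_gt0; lra].
pose d := c^-1.
have d0 : 0 < d by rewrite invr_gt0.
have dc : d * c = 1 by rewrite mulVf // gt_eqF.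
have [g Gg hg] := limit_approx hxi d0.
exists g; split=> //; last first.
  move=> i; apply: le_trans (ltW (hg i)) _; have K0 : 0 < K by lra.
  rewrite KE /d lef_pV2 ?posrE // /c; nra.
case: hxi => sx _; have on := orb0_norm GSp Gg.
have le_i i : qnorm2 (xi 0 i) - 2 * d <= qnorm2 (qorb0 g 0 i).
  have x1 : qabs (xi 0 i) <= 1.
    rewrite -(@ler_pXn2r _ 2) ?nnegrE ?qabs_ge0 // expr1n qabs_sqr -sx (bigD1 i) //= lerDl.
    by apply: sumr_ge0 => ? _; apply: qnorm2_ge0.
  have := hg i; have := qabsD (qorb0 g 0 i) (xi 0 i - qorb0 g 0 i).
  rewrite addrC subrK -!qabs_sqr; have := qabs_ge0 (xi 0 i); have := qabs_ge0 (qorb0 g 0 i).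
  move: x1; move: (qabs (xi 0 i)) (qabs (qorb0 g 0 i)) (qabs (_ - _)) => a b e a1 b0 a0 ab ed.
  by have [ae|ae] := leP e a; nra.
have sum_le : 1 - 2 * N * d <= \sum_(i < n) qnorm2 (qorb0 g 0 i).
  apply: le_trans (ler_sum _ (fun i _ => le_i i)).
  rewrite sumrB sx sumr_const card_ord -[_ *+ n]mulr_natr NE lerD2l lerN2.
  by apply: eq_ler; ring.
move: on; set S := \sum_(i < n) _ in sum_le * => on.
have g0 := qabs_ge0 (g ord_max ord_max); set a := gmax g in g0 on *.
suff : K <= a by lra.
rewrite -(@ler_pXn2r _ 2) ?nnegrE //; last lra.
have a2 : 0 <= a ^+ 2 by rewrite sqr_ge0.
have h1 : 1 <= a ^+ 2 * (2 * N * d) by rewrite -{1}on ler_wpM2l //; lra.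
have h2 : 2 * N * d * K ^+ 2 <= 1.
  rewrite -[leRHS]dc /c; have : 0 <= d * K ^+ 2 by rewrite mulr_ge0 ?sqr_ge0 // ltW.
  nra.
have K2 : 0 <= K ^+ 2 by rewrite sqr_ge0.
have : K ^+ 2 * 1 <= K ^+ 2 * (a ^+ 2 * (2 * N * d)) by rewrite ler_wpM2l.
have : a ^+ 2 * (2 * N * d * K ^+ 2) <= a ^+ 2 * 1 by rewrite ler_wpM2l.
by rewrite !mulr1 => h3 h4; apply: le_trans h4 _; apply: le_trans h3; apply: eq_ler; ring.
Qed.

(** The rescaled last column of [g s] is the lift of the orbit point times a scalar of modulus 1.
    The orbit points tend to [xi], so the normalised column [u] of the limit is [vlift xi]. *)
Lemma limit_rank_one xi : lim xi -> exists v, rank_one_point G (vlift xi) v.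
Proof.
move=> hxi; have /choice [g hg] := fun k => limit_seq k hxi.
have [||u [v [su un sv v0 hL]]] := @rank_one_limit _ G GSp Ggr g.
- by move=> k; case: (hg k).
- by move=> k; case: (hg k).
have sx : sq (vlift xi) = 0 by apply: sq_vlift; case: hxi.
have vn := null_max_neq0 sv v0.
pose w := adj v *m J; pose L := u *m w.
have wn : w 0 ord_max != 0.
  rewrite mulJ mxE quat_mulf_eq0 qconj_eq0 (negbTE vn) qreg_eq0 /sgn eqxx.
  by rewrite oppr_eq0 oner_eq0.
have LE i : L i ord_max = u i 0 * w 0 ord_max by rewrite mxE big_ord1.
have Lnn : L ord_max ord_max = w 0 ord_max by rewrite LE un mul1r.
have uE : u = vlift xi.
  apply/matrixP => i j; rewrite [j]ord1 {j}.
  case: (ord_max_or_widen i) => [->|[k ->]]; first by rewrite un vlift_max.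
  rewrite vlift_widen; set i' := widen_ord _ k.
  have : (u i' 0 - xi 0 k) * w 0 ord_max = 0; last first.
    by move/eqP; rewrite quat_mulf_eq0 (negbTE wn) orbF subr_eq0 => /eqP.
  apply/eqP; rewrite -qabs_eq0; apply/eqP.
  apply: (@eq0_small _ (2 + qabs (xi 0 k))) => [|e e0 _]; first exact: qabs_ge0.
  have [s Ns hs] := hL e e0 (Num.bound e^-1).
  rewrite -/w -/L in hs; pose X := qreg (gmax (g s))^-1 *: g s.
  case: (hg s) => Gs gs os.
  have gp : 0 < gmax (g s).
    rewrite qabs_gt0; apply/eqP => h0; have := orb0_norm GSp Gs.
    by rewrite h0 qabs0 expr0n /= mul0r => /eqP; rewrite eq_sym oner_eq0.
  have g0 : g s ord_max ord_max != 0 by rewrite -qabs_gt0.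
  have Xnn : qabs (X ord_max ord_max) = 1.
    by rewrite mxE qabsM qabs_reg ger0_norm ?invr_ge0 ?qabs_ge0 // mulVf // gt_eqF.
  have Xi : X i' ord_max = qorb0 (g s) 0 k * X ord_max ord_max.
    have -> : qorb0 (g s) 0 k = g s i' ord_max * (g s ord_max ord_max)^-1.
      by rewrite mxE /GRing.inv /= /quat_inv (negbTE g0).
    by rewrite !mxE -mulrA [qreg _ * g s ord_max ord_max]qregC mulKr // qregC.
  have es : s.+1%:R^-1 <= e.
    rewrite -[e]invrK lef_pV2 ?posrE ?invr_gt0 ?ltr0n //.
    apply: le_trans (_ : (Num.bound e^-1)%:R <= _); last by rewrite ler_nat ltnW.
    by apply/ltW/archi_boundP; rewrite invr_ge0 ltW.
  have -> : (u i' 0 - xi 0 k) * w 0 ord_max =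
      (L i' ord_max - X i' ord_max) - (xi 0 k - qorb0 (g s) 0 k) * X ord_max ord_max
      + xi 0 k * (X ord_max ord_max - L ord_max ord_max).
    rewrite Xi LE Lnn mulrBr !mulrBl opprB.
    set a := u i' 0 * _; set b := qorb0 _ _ _ * _; set c := xi 0 k * X _ _; set d := xi 0 k * _.
    by rewrite [a - b + _]addrA subrK addrA subrK.
  have XL i1 : qabs (X i1 ord_max - L i1 ord_max) <= e.
    by apply: le_trans (ltW hs); apply: le_trans (mnorm_entry _ i1 ord_max); rewrite mxBE.
  apply: le_trans (qabsD _ _) _; rewrite qabsM.
  have h1 := qabsB (L i' ord_max - X i' ord_max) ((xi 0 k - qorb0 (g s) 0 k) * X ord_max ord_max).
  rewrite qabsM Xnn mulr1 [qabs (L i' _ - X i' _)]qabs_distC in h1.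
  have h2 := XL i'; have h3 : qabs (xi 0 k - qorb0 (g s) 0 k) <= e := le_trans (os k) es.
  have h4 : qabs (xi 0 k) * qabs (X ord_max ord_max - L ord_max ord_max) <= qabs (xi 0 k) * e.
    by rewrite ler_wpM2l ?qabs_ge0.
  lra.
exists v; split=> //.
  by apply/eqP => /matrixP/(_ ord_max 0); rewrite vlift_max mxE => /eqP; rewrite oner_eq0.
rewrite -uE => e e0; have [s _ hs] := hL e e0 0%N.
by exists (gmax (g s))^-1, (g s); split=> //; case: (hg s).
Qed.

Lemma nonelementary_free : q_nonelementary G -> exists a b, free_pair mulmx 1%:M G a b.
Proof.
case=> x1 [x2 [x3 [l1 l2 l3 [x12 x13 x23]]]].
have [v1 r1] := limit_rank_one l1; have [v2 r2] := limit_rank_one l2.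
have [v3 r3] := limit_rank_one l3.
have sep x y : lim x -> lim y -> x <> y -> hform (vlift x) (vlift y) != 0.
  move=> [sx _] [sy _] xy; apply/eqP => h; apply: xy; apply: vlift_inj => i.
  have x0 : vlift x != 0.
    by apply/eqP => /matrixP/(_ ord_max 0); rewrite vlift_max mxE => /eqP; rewrite oner_eq0.
  have := null_orth (sq_vlift sx) (sq_vlift sy) h x0.
  by rewrite !vlift_max invr1 mulr1 rs1 => ->.
by apply: (three_points GSp Ggr r1 r2 r3); apply: sep.
Qed.
End LimitSet.

(** * Real spans and orthonormal frames *)

Definition qbasis (j : 'I_4) : quat :=
  Quat (j == 0)%:R (j == 1)%:R (j == 2)%:R (j == inord 3)%:R.

Definition leftmx (p : quat) : 'M[RR]_4 := \matrix_(i, j) qcoord i (p * qbasis j).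

Lemma leftmx_is_zmod_morphism : zmod_morphism leftmx.
Proof. by move=> p q; apply/matrixP => i j; rewrite !mxE mulrBl qcoordB. Qed.
HB.instance Definition _ :=
  GRing.isZmodMorphism.Build quat 'M[RR]_4 leftmx leftmx_is_zmod_morphism.

Lemma qcoord_mul i (p q : quat) :
  qcoord i (p * q) = \sum_k qcoord i (p * qbasis k) * qcoord k q.
Proof.
rewrite !big_ord_recl big_ord0 /qcoord /= /qbasis -!(inj_eq val_inj) /= !inordK //=.
by do ![case: ifP => _]; rewrite ?qE /=; ring.
Qed.

Lemma leftmxM p q : leftmx (p * q) = leftmx p *m leftmx q.
Proof.
apply/matrixP => i j; rewrite !mxE -mulrA qcoord_mul.
by apply: eq_bigr => k _; rewrite !mxE.
Qed.

Lemma leftmx1 : leftmx 1 = 1%:M.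
Proof.
apply/matrixP => i j; rewrite !mxE mul1r /qcoord /qbasis /=.
case: i j => [[|[|[|[|]]]] //= ?] [[|[|[|[|]]]] //= ?];
  by rewrite -!(inj_eq val_inj) /= ?inordK.
Qed.

Lemma leftmx_inj : injective leftmx.
Proof.
have h p i : leftmx p i 0 = qcoord i p.
  rewrite mxE; congr qcoord; rewrite -[RHS]mulr1; congr (_ * _).
  by rewrite /qbasis -!(inj_eq val_inj) /= inordK.
move=> p q pq; apply: quat_eq.
- by rewrite -[LHS](h p 0) pq h.
- by rewrite -[LHS](h p 1) pq h.
- by rewrite -[LHS](h p 2) pq h.
- have hk s : qk s = qcoord (inord 3) s.
    by rewrite /qcoord -!(inj_eq val_inj) /= inordK.
  by rewrite !hk -!h pq.
Qed.

(* Determinants are not available over the quaternions, so the real matrices of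
   left multiplication are used. *)
Lemma quat_mulmx1C m (A B : 'M[quat]_m) : A *m B = 1%:M -> B *m A = 1%:M.
Proof.
pose L (A : 'M[quat]_m) := \mxblock_(i < m, j < m) leftmx (A i j).
have LM C D : L (C *m D) = L C *m L D.
  rewrite /L mul_mxblock; apply/eq_mxblock => i j.
  by rewrite mxE raddf_sum; apply: eq_bigr => k _; apply: leftmxM.
have L1 : L 1%:M = 1%:M.
  rewrite /L -mxdiagZ /mxdiag; apply/eq_mxblock => i j; rewrite mxE.
  case: eqVneq => [e|_]; last by rewrite mulr0n raddf0.
  by rewrite mulr1n conform_mx_id leftmx1.
have Linj C D : L C = L D -> C = D.
  move=> CD; apply/matrixP => i j; apply: leftmx_inj.
  by move: CD; rewrite /L => /eq_mxblockP/(_ i j).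
by move=> AB; apply: Linj; rewrite LM L1; apply: mulmx1C; rewrite -LM AB L1.
Qed.

Section RealSpan.
Variable n : nat.
Local Notation M := 'M[quat]_n.+1.
Local Notation V := 'cV[quat]_n.+1.
Local Notation J := (Jq n).
Variable G : M -> Prop.
Hypothesis GSp : forall g, G g -> in_Sp g.
Hypothesis Ggr : is_subgroup mulmx 1%:M G.
Variable u : V.

(** As an intersection of all real subspaces containing the orbit, it gives induction by
    instantiating [P]. *)
Definition real_span (x : V) : Prop := forall P : V -> Prop,
  (forall h, G h -> P (h *m u)) -> (forall y z, P y -> P z -> P (y + z)) ->
  (forall r y, P y -> P (qreg r *: y)) -> P x.

Lemma real_span_orbit h : G h -> real_span (h *m u).
Proof. by move=> Gh P hP _ _; apply: hP. Qed.
Lemma real_span_add x y : real_span x -> real_span y -> real_span (x + y).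
Proof. by move=> hx hy P h1 h2 h3; apply: (h2); [apply: hx|apply: hy]. Qed.
Lemma real_span_scale r x : real_span x -> real_span (qreg r *: x).
Proof. by move=> hx P h1 h2 h3; apply: (h3); apply: hx. Qed.
Lemma real_span_act g x : G g -> real_span x -> real_span (g *m x).
Proof.
move=> Gg hx; apply: (hx (fun y => real_span (g *m y))).
- by move=> h Gh; rewrite mulmxA; apply: real_span_orbit; apply: (G_mul Ggr).
- by move=> y z; rewrite mulmxDr; apply: real_span_add.
- by move=> r y; rewrite mul_regZ; apply: real_span_scale.
Qed.

Lemma real_span_form d x y :
  (forall h, G h -> qreal (hform u (h *m u) * d)) ->
  real_span x -> real_span y -> qreal (hform x y * d).
Proof.
move=> hd hx hy; apply: (hx (fun x => qreal (hform x y * d))).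
- move=> g Gg; apply: (hy (fun y => qreal (hform (g *m u) y * d))).
  + move=> h Gh; have -> : hform (g *m u) (h *m u) = hform u (shp g *m h *m u).
      by rewrite -mulmxA [RHS]form_shp shpK.
    by apply: hd; apply: (G_mul Ggr) => //; apply: (G_shp GSp Ggr).
  + by move=> x1 x2 h1 h2; rewrite formDr mulrDl; apply: qrealD.
  + by move=> r x1 h1; rewrite form_regZr -mulrA; apply: qreal_regM.
- by move=> x1 x2 h1 h2; rewrite formDl mulrDl; apply: qrealD.
- by move=> r x1 h1; rewrite form_regZl -mulrA; apply: qreal_regM.
Qed.

Lemma real_span_complex x : (forall h, G h -> mxcomplex h) -> mxcomplex u ->
  real_span x -> mxcomplex x.
Proof.
have sumc (I : finType) (F : I -> quat) :
    (forall i, qcomplex (F i)) -> qcomplex (\sum_i F i).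
  by move=> h; elim/big_ind: _ => // *; apply: qcomplexD.
move=> Gc uc hx; apply: (hx (@mxcomplex _ _)).
- move=> h Gh i j; rewrite mxE; apply: sumc => k.
  by apply: qcomplexM; [apply: Gc|apply: uc].
- by move=> y z hy hz i j; rewrite mxE; apply: qcomplexD.
- by move=> r y hy i j; rewrite mxE; apply: qcomplexM.
Qed.
End RealSpan.

Section Frame.
Variable n : nat.
Local Notation M := 'M[quat]_n.+1.
Local Notation V := 'cV[quat]_n.+1.
Local Notation J := (Jq n).
Variable U : V -> Prop.
Hypothesis U_add : forall x y, U x -> U y -> U (x + y).
Hypothesis U_scale : forall r x, U x -> U (qreg r *: x).
Hypothesis U_real : forall x y, U x -> U y -> qreal (hform x y).

Definition proj_mx (S : {set 'I_n.+1}) : M := \matrix_(i, j) ((i == j) && (i \in S))%:R.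

(* Frames are padded with zero columns, outside [S], to remain square matrices. *)
Definition frame (S : {set 'I_n.+1}) (E : M) : Prop :=
  [/\ ord_max \in S, forall j, U (col j E), adj E *m J *m E = J *m proj_mx S &
      E *m proj_mx S = E].

Lemma proj_mxE (k : nat) S (A : 'M[quat]_(k, n.+1)) i j :
  (A *m proj_mx S) i j = if j \in S then A i j else 0.
Proof.
rewrite mxE (bigD1 j) //= mxE eqxx big1 ?addr0 => [|s sj].
  by case: ifP => _; rewrite ?mulr1 ?mulr0.
by rewrite mxE (negbTE sj) mulr0.
Qed.

Lemma frameP (S : {set 'I_n.+1}) (E : M) : ord_max \in S -> (forall j, U (col j E)) ->
  (forall j, j \notin S -> col j E = 0) ->
  (forall i j, i \in S -> j \in S -> hform (col i E) (col j E) = J i j) -> frame S E.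
Proof.
move=> S1 UE E0 Egram; split=> //.
  apply/matrixP => i j; rewrite adj_mx_entry proj_mxE.
  case: ifPn => [jS|/E0 ->]; last by rewrite form0r.
  have [iS|iS] := boolP (i \in S); first exact: Egram.
  rewrite (E0 _ iS) form0l mxE; case: eqP => // ij.
  by rewrite ij jS in iS.
apply/matrixP => i j; rewrite proj_mxE; case: ifPn => // /E0 /matrixP /(_ i 0).
by rewrite !mxE => ->.
Qed.

Lemma frame_gram (S : {set 'I_n.+1}) (E : M) i j : frame S E -> i \in S -> j \in S ->
  hform (col i E) (col j E) = J i j.
Proof. by case=> _ _ h _ iS jS; rewrite -adj_mx_entry h proj_mxE jS. Qed.
Lemma frame_out (S : {set 'I_n.+1}) (E : M) j : frame S E -> j \notin S -> col j E = 0.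
Proof.
by case=> _ _ _ h jS; apply/matrixP => i k; rewrite mxE -h proj_mxE (negbTE jS) mxE.
Qed.

Lemma frame_exists t : U t -> sq t < 0 -> exists S E, frame S E.
Proof.
move=> Ut st; pose s := (Num.sqrt (- sq t))^-1.
have st0 : 0 < - sq t by rewrite oppr_gt0.
pose E : M := \matrix_(i, j) if j == ord_max then (qreg s *: t) i 0 else 0.
have U0 : U 0 by have := U_scale 0 Ut; rewrite rmorph0 scale0r.
have colE j : col j E = if j == ord_max then qreg s *: t else 0.
  by apply/matrixP => i k; rewrite [k]ord1 !mxE; case: ifP => _; rewrite !mxE.
exists [set ord_max], E; apply: frameP.
- by rewrite inE.
- by move=> j; rewrite colE; case: ifP => _ //; apply: U_scale.
- by move=> j; rewrite inE colE => /negbTE ->.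
- move=> i j; rewrite !inE => /eqP -> /eqP ->; rewrite colE eqxx form_regZl form_regZr form_sq.
  rewrite mxE eqxx -!rmorphM mulrA -expr2 /s exprVn sqr_sqrtr ?(ltW st0) //.
  by rewrite invrN mulNr mulVf ?lt_eqF // rmorphN rmorph1.
Qed.

(** Take [S] of maximal size. The remainder [x'] is orthogonal to the frame, so if nonzero it is
    positive and, normalised, could occupy a coordinate outside [S]. If there is none, [F E = 1], so
    [E F = 1] and the remainder is 0. *)
Lemma frame_max : (exists t, U t /\ sq t < 0) -> exists S E, frame S E /\
  forall x, U x -> E *m (J *m adj E *m J *m x) = x.
Proof.
case=> t [Ut st]; have [S0 fS0] := frame_exists Ut st.
pose P S := `[< exists E, frame S E >].
have PS0 : P S0 by apply/asboolP.
case: (arg_maxnP (fun S : {set 'I_n.+1} => #|S|) PS0) => S /asboolP [E fE] Smax.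
exists S, E; split=> // x Ux; case: (fE) => nS UE gram Epi.
pose F := J *m adj E *m J; pose x' := x - E *m (F *m x).
have Fx j : (F *m x) j 0 = qreg (sgn j) * hform (col j E) x.
  rewrite /F -!mulmxA Jmul; congr (_ * _); rewrite mulmxA.
  by have := adj_mx_entry E x j 0; rewrite col_id => <-.
have sumU (I : finType) (f : I -> V) : (forall i, U (f i)) -> U (\sum_i f i).
  move=> h; elim/big_ind: _ => //.
  by have := U_scale 0 Ut; rewrite rmorph0 scale0r.
have Ux' : U x'.
  apply: U_add => //; have -> : - (E *m (F *m x)) = qreg (-1) *: (E *m (F *m x)).
    by rewrite rmorphN rmorph1 scaleN1r.
  apply: U_scale.
  (* The coefficients are real because the form is real on [U], so the projection remains in [U]. *)
  have -> : E *m (F *m x) = \sum_j qreg (qr ((F *m x) j 0)) *: col j E.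
    apply/matrixP => i k; rewrite [k]ord1 mxE summxE; apply: eq_bigr => j _.
    rewrite [RHS]mxE [col _ _ _ _]mxE qregC; congr (_ * _); apply/qrealP; rewrite Fx.
    by apply: qreal_regM; apply: U_real.
  by apply: sumU => j; apply: U_scale.
have orth j : hform (col j E) x' = 0.
  have -> : hform (col j E) x' = (adj E *m J *m x') j 0.
    by have := adj_mx_entry E x' j 0; rewrite col_id => <-.
  rewrite /x' mulmxBr (mulmxA _ E) gram.
  have -> : J *m proj_mx S *m (F *m x) = adj E *m J *m x; last by rewrite subrr mxE.
  apply/matrixP => i k; rewrite -mulmxA Jmul mxE.
  rewrite (bigD1 i) //= big1 => [|s si]; last by rewrite mxE eq_sym (negbTE si) mul0r.
  rewrite [k]ord1 Fx addr0 mxE eqxx /=.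
  have -> : (adj E *m J *m x) i 0 = hform (col i E) x.
    by have := adj_mx_entry E x i 0; rewrite col_id => <-.
  have [iS|iS] := boolP (i \in S); last by rewrite (frame_out fE iS) form0l !mulr0.
  by rewrite mul1r mulrA -rmorphM sgn_sqr mul1r.
apply/esym/eqP; rewrite -subr_eq0 -/F -/x'; apply: contrapT => /negP x'0.
have st' : sq (col ord_max E) < 0.
  have := frame_gram fE nS nS; rewrite form_sq mxE eqxx => -[->]; lra.
have sx' : 0 < sq x' := timelike_orth st' (orth _) x'0.
have [/eqP|[j0 j0S]] : (S == setT) \/ exists j0, j0 \notin S.
- case: (eqVneq S setT) => [->|ST]; [by left|right].
  move: ST; rewrite -subTset => /subsetPn [j0 _ h]; by exists j0.
- move=> ST; have FE : F *m E = 1%:M.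
    rewrite /F -!mulmxA (mulmxA (adj E)) gram mulmxA JJ mul1mx.
    by apply/matrixP => i j; rewrite !mxE ST inE andbT.
  by case/eqP: x'0; rewrite /x' mulmxA (quat_mulmx1C FE) mul1mx subrr.
pose r := (Num.sqrt (sq x'))^-1.
pose E' : M := \matrix_(i, j) if j == j0 then (qreg r *: x') i 0 else E i j.
have colE' j : col j E' = if j == j0 then qreg r *: x' else col j E.
  by apply/matrixP => i k; rewrite [k]ord1 !mxE; case: ifP => _; rewrite !mxE.
have j0m : j0 != ord_max by apply: contraNneq j0S => ->.
have : P (j0 |: S).
  apply/asboolP; exists E'; apply: frameP.
  - by rewrite !inE nS orbT.
  - by move=> j; rewrite colE'; case: ifP => _ //; apply: U_scale.
  - by move=> j; rewrite !inE negb_or colE' => /andP[/negbTE -> jS]; apply: frame_out fE jS.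
  - move=> i j; rewrite !inE !colE' => /orP hi /orP hj.
    case: (eqVneq i j0) hi => [-> _|ij [//|iS]]; last first.
      case: (eqVneq j j0) hj => [-> _|jj [//|jS]].
        rewrite form_regZr orth mulr0 mxE; case: eqP => // e.
        by rewrite e eqxx in ij.
      exact: (frame_gram fE).
    case: (eqVneq j j0) hj => [-> _|jj [//|jS]].
      rewrite form_regZl form_regZr form_sq mxE eqxx (negbTE j0m) -!rmorphM mulrA -expr2.
      by rewrite /r exprVn sqr_sqrtr ?(ltW sx') // mulVf ?gt_eqF.
    rewrite form_regZl -form_conj orth raddf0 mulr0 mxE; case: eqP => // e.
    by rewrite e eqxx in jj.
by move=> /Smax; rewrite cardsU1 j0S add1n /geq /= ltnn.
Qed.
End Frame.

(** * Real models *)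

Definition Jr (n : nat) : 'M[RR]_n.+1 := \matrix_(i, j) (if i == j then sgn i else 0).
Definition qmx (m k : nat) (A : 'M[RR]_(m, k)) : 'M[quat]_(m, k) := map_mx qreg A.

Lemma qmx_inj m k : injective (@qmx m k).
Proof. by move=> A B /matrixP AB; apply/matrixP => i j; have := AB i j; rewrite !mxE => -[]. Qed.
Lemma qmxM m k l (A : 'M[RR]_(m, k)) (B : 'M[RR]_(k, l)) : qmx (A *m B) = qmx A *m qmx B.
Proof. exact: map_mxM. Qed.
Lemma qmx_tr m k (A : 'M[RR]_(m, k)) : adj (qmx A) = qmx A^T.
Proof. by apply/matrixP => i j; rewrite !mxE qconj_reg. Qed.
Lemma qmx_J n : qmx (Jr n) = Jq n.
Proof. by apply/matrixP => i j; rewrite !mxE; case: eqP => // _; apply: qreg_sgn. Qed.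
Lemma qmx_orth n (A : 'M[RR]_n.+1) : in_Sp (qmx A) <-> A^T *m Jr n *m A = Jr n.
Proof.
rewrite in_SpE qmx_tr -qmx_J -!qmxM; split=> [/qmx_inj //|-> //].
Qed.

Section RealModel.
Variable n : nat.
Local Notation M := 'M[quat]_n.+1.
Local Notation V := 'cV[quat]_n.+1.
Local Notation J := (Jq n).
Local Notation gmax g := (qabs (g ord_max ord_max)).
Variable G : M -> Prop.

(* The information needed to correct the determinant to 1 in the complex case:
   an unused coordinate, determinant 1, or a conjugation by a complex isometry. *)
Definition det_control (psi : M -> 'M[RR]_n.+1) : Prop :=
  [\/ exists j0, forall h, G h -> forall i,
        psi h i j0 = (i == j0)%:R /\ psi h j0 i = (i == j0)%:R,
      forall h, G h -> \det (psi h) = 1 |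
      exists E : M, [/\ adj E *m J *m E = J, forall h, G h -> h *m E = E *m qmx (psi h) &
        (forall h, G h -> mxcomplex h) -> mxcomplex E]].

Definition real_model (psi : M -> 'M[RR]_n.+1) : Prop :=
  [/\ forall h, G h -> in_Sp (qmx (psi h)),
      forall g h, G g -> G h -> psi (g *m h) = psi g *m psi h,
      forall R : RR, exists R' : RR, forall h, G h ->
        gmax (qmx (psi h)) <= R -> gmax h <= R' &
      det_control psi].

Hypothesis GSp : forall g, G g -> in_Sp g.
Hypothesis Ggr : is_subgroup mulmx 1%:M G.

Section FrameModel.
Variable U : V -> Prop.
Hypothesis U_add : forall x y, U x -> U y -> U (x + y).
Hypothesis U_scale : forall r x, U x -> U (qreg r *: x).
Hypothesis U_act : forall g x, G g -> U x -> U (g *m x).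
Hypothesis U_real : forall x y, U x -> U y -> qreal (hform x y).
Hypothesis U_complex : (forall h, G h -> mxcomplex h) -> forall x, U x -> mxcomplex x.

Lemma frame_model : (exists t, U t /\ sq t < 0) -> exists psi, real_model psi.
Proof.
move=> Ut; have [S [E [fE EF]]] := frame_max U_add U_scale U_real Ut.
case: (fE) => nS UE gram Epi.
pose Pi : M := proj_mx S; pose F := J *m adj E *m J.
have PiJ : Pi *m J = J *m Pi.
  apply/matrixP => i j; rewrite mulJ Jmul !mxE.
  by case: eqP => [->|_]; rewrite ?mul0r ?mulr0 // -qregC.
have adjPi : adj Pi = Pi.
  apply/matrixP => i j; rewrite !mxE eq_sym; case: eqP => [->|_] /=.
    by case: (_ \in _); rewrite ?qconj1 ?raddf0.
  by rewrite raddf0.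
have PiPi : Pi *m Pi = Pi.
  by apply/matrixP => i j; rewrite proj_mxE !mxE; case: eqP => [->|_] /=; case: (_ \in _).
have PiF : Pi *m F = F.
  rewrite /F !mulmxA PiJ -(mulmxA J); congr (_ *m _ *m _).
  by rewrite -{1}adjPi -adj_mul Epi.
have EFA (A : M) : (forall j, U (col j A)) -> E *m (F *m A) = A.
  move=> UA; apply/matrixP => i j.
  have /matrixP/(_ i 0) := EF _ (UA j).
  by rewrite -/F -!col_mul [LHS]mxE [RHS]mxE.
have FE : F = J *m adj E *m J by [].
clearbody F.
pose phi h := F *m h *m E.
have phiPi h : phi h *m Pi = phi h by rewrite /phi -mulmxA Epi.
have Piphi h : Pi *m phi h = phi h by rewrite /phi !mulmxA PiF.
have UhE h : G h -> forall j, U (col j (h *m E)).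
  by move=> Gh j; rewrite col_mul; apply: U_act.
have phiM g h : G g -> G h -> phi (g *m h) = phi g *m phi h.
  by move=> Gg Gh; rewrite /phi -!mulmxA EFA //; apply: UhE.
have phi_entry h i j : phi h i j = qreg (sgn i) * hform (col i E) (col j (h *m E)).
  by rewrite -adj_mx_entry /phi FE -Jmul !mulmxA.
pose psi h := map_mx qr (phi h + (1%:M - Pi)).
have psiE h : G h -> qmx (psi h) = phi h + (1%:M - Pi).
  move=> Gh; apply/matrixP => i j; rewrite [LHS]mxE [X in qreg X]mxE.
  apply/esym/qrealP; rewrite mxE; apply: qrealD.
    by rewrite phi_entry; apply: qreal_regM; apply: U_real => //; apply: UhE.
  rewrite !mxE; case: (i == j); case: (i \in S) => /=;
    by rewrite ?subrr ?subr0.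
have PiC : Pi *m (1%:M - Pi) = 0 by rewrite mulmxBr mulmx1 PiPi subrr.
have CPi : (1%:M - Pi) *m Pi = 0 by rewrite mulmxBl mul1mx PiPi subrr.
have phiC h : phi h *m (1%:M - Pi) = 0 by rewrite mulmxBr mulmx1 phiPi subrr.
have Cphi h : (1%:M - Pi) *m phi h = 0 by rewrite mulmxBl mul1mx Piphi subrr.
exists psi; split.
- move=> h Gh; apply/in_SpE; rewrite psiE //.
  have adjC : adj (1%:M - Pi) = 1%:M - Pi by rewrite raddfB /= adj1 adjPi.
  have CJ : (1%:M - Pi) *m J = J *m (1%:M - Pi) by rewrite mulmxBl mulmxBr mul1mx mulmx1 PiJ.
  have -> : adj (phi h + (1%:M - Pi)) = adj (phi h) + (1%:M - Pi).
    by rewrite -[in RHS]adjC; apply: raddfD.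
  move: PiC phiC Cphi adjC CJ; move CE : (1%:M - Pi) => C PiC phiC Cphi adjC CJ.
  rewrite !mulmxDl !mulmxDr.
  have -> : adj (phi h) *m J *m C = 0.
    rewrite -mulmxA -CJ mulmxA; have -> : adj (phi h) *m C = 0.
      by rewrite -{1}adjC -adj_mul Cphi raddf0.
    by rewrite mul0mx.
  have -> : C *m J *m phi h = 0 by rewrite CJ -mulmxA Cphi mulmx0.
  have -> : C *m J *m C = J *m C.
    by rewrite CJ -mulmxA -{1}CE mulmxBl mul1mx PiC subr0.
  have -> : adj (phi h) *m J *m phi h = J *m Pi.
    rewrite -gram /phi FE !adj_mul adjJ adjK.
    rewrite -!mulmxA (mulmxA J J) JJ mul1mx.
    have := EFA _ (UhE _ Gh); rewrite FE -!mulmxA => ->.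
    by move/in_SpE: (GSp Gh) => hh; rewrite (mulmxA J h) (mulmxA (adj h)) (mulmxA (adj h)) hh.
  by rewrite addr0 add0r -CE mulmxBr mulmx1 addrC subrK.
- move=> g h Gg Gh; apply: qmx_inj; rewrite qmxM !psiE //; last exact: (G_mul Ggr).
  have CC : (1%:M - Pi) *m (1%:M - Pi) = 1%:M - Pi by rewrite {1}mulmxBl mul1mx PiC subr0.
  move: phiC Cphi CC; move: (1%:M - Pi) => C phiC Cphi CC.
  by rewrite mulmxDr !mulmxDl phiC Cphi phiM // add0r addr0 CC.
(* The corner of [psi h] is [- <t, h t>] for the negative frame vector [t], so [timelike_proper]
   applies. *)
- move=> R; have st : sq (col ord_max E) < 0.
    have := frame_gram fE nS nS; rewrite form_sq mxE eqxx => -[->]; lra.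
  have [R' hR'] := timelike_proper GSp Ggr R st; exists R' => h Gh hR; apply: hR' => //.
  have -> : hform (col ord_max E) (h *m col ord_max E) = - phi h ord_max ord_max.
    by rewrite phi_entry col_mul /sgn eqxx rmorphN rmorph1 mulN1r opprK.
  rewrite qabsN; move: hR; rewrite psiE // mxDE mxBE [1%:M _ _]mxE [Pi _ _]mxE.
  by rewrite eqxx nS subrr addr0.
- have [ST|] := eqVneq S setT.
    have Pi1 : Pi = 1%:M by apply/matrixP => i j; rewrite !mxE ST inE andbT.
    apply: Or33; exists E; split; first by rewrite gram -/Pi Pi1 mulmx1.
    + move=> h Gh; rewrite psiE // Pi1 subrr addr0 /phi -mulmxA EFA //.
      exact: UhE.
    + move=> Gc i j; have := U_complex Gc (UE j) i 0; by rewrite mxE.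
  rewrite -subTset => /subsetPn [j0 _ j0S]; apply: Or31; exists j0 => h Gh i.
  have p1 : phi h i j0 = 0 by rewrite -phiPi proj_mxE (negbTE j0S).
  have p2 : phi h j0 i = 0 by rewrite phi_entry (frame_out fE j0S) form0l mulr0.
  have real k : qr (k%:R : quat) = k%:R by elim: k => // k IH; rewrite -!natr1 qrD IH.
  split; rewrite mxE mxDE ?p1 ?p2 add0r mxBE [1%:M _ _]mxE [Pi _ _]mxE raddfB /= !real.
    case: eqP => [->|_]; rewrite /= ?(negbTE j0S) ?subr0 //.
  by rewrite (negbTE j0S) andbF subr0 eq_sym.
Qed.
End FrameModel.
End RealModel.

(** * SL(2,R) and SO(2,1) *)

Section Embedding.
Variables (R : comNzRingType) (N k : nat) (P : 'M[R]_(N, k)).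
Hypothesis PP : P^T *m P = 1%:M.

Definition embed_mx (A : 'M[R]_k) : 'M[R]_N := P *m A *m P^T + (1%:M - P *m P^T).

Lemma embed_complr : (1%:M - P *m P^T) *m P = 0.
Proof. by rewrite mulmxBl mul1mx -mulmxA PP mulmx1 subrr. Qed.
Lemma embed_compll : P^T *m (1%:M - P *m P^T) = 0.
Proof. by rewrite mulmxBr mulmx1 mulmxA PP mul1mx subrr. Qed.
Lemma embed_compl2 : (1%:M - P *m P^T) *m (1%:M - P *m P^T) = 1%:M - P *m P^T.
Proof. by rewrite [LHS]mulmxBr mulmx1 mulmxA embed_complr mul0mx subr0. Qed.

Lemma embed_mxM A B : embed_mx (A *m B) = embed_mx A *m embed_mx B.
Proof.
rewrite /embed_mx; move: embed_complr embed_compll embed_compl2.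
move: (1%:M - P *m P^T) => C CP PC CC.
rewrite mulmxDl !mulmxDr CC; have -> : P *m A *m P^T *m C = 0 by rewrite -mulmxA PC mulmx0.
have -> : C *m (P *m B *m P^T) = 0 by rewrite !mulmxA CP !mul0mx.
rewrite addr0 add0r; congr (_ + _).
by rewrite !mulmxA -(mulmxA _ P^T P) PP mulmx1.
Qed.

Lemma embed_mx_orth J Jk A : J *m P = P *m Jk -> J^T = J -> Jk^T = Jk ->
  A^T *m Jk *m A = Jk -> (embed_mx A)^T *m J *m embed_mx A = J.
Proof.
move=> JP JT JkT AJ.
have PJ : P^T *m J = Jk *m P^T by rewrite -{1}JT -trmx_mul JP trmx_mul JkT.
have CT : (1%:M - P *m P^T)^T = 1%:M - P *m P^T.
  by rewrite raddfB /= trmx1 trmx_mul trmxK.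
have JC : J *m (1%:M - P *m P^T) = (1%:M - P *m P^T) *m J.
  by rewrite mulmxBr mulmxBl mulmx1 mul1mx mulmxA JP -!mulmxA PJ.
have JE : P *m Jk *m P^T + J *m (1%:M - P *m P^T) = J.
  by rewrite mulmxBr mulmx1 mulmxA JP addrC subrK.
move: embed_complr embed_compll embed_compl2 CT JC JE; rewrite /embed_mx.
move: (1%:M - P *m P^T) => C CP PC CC CT JC JE.
have -> : (P *m A *m P^T + C)^T = P *m A^T *m P^T + C.
  by rewrite -[in RHS]CT raddfD /= !trmx_mul trmxK mulmxA.
rewrite !mulmxDl !mulmxDr.
have -> : P *m A^T *m P^T *m J *m C = 0.
  by rewrite -!mulmxA JC (mulmxA P^T) PC mul0mx !mulmx0.
have -> : C *m J *m (P *m A *m P^T) = 0.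
  by rewrite !mulmxA -JC -(mulmxA J) CP mulmx0 !mul0mx.
have -> : C *m J *m C = J *m C by rewrite -JC -mulmxA CC.
have -> : P *m A^T *m P^T *m J *m (P *m A *m P^T) = P *m (A^T *m Jk *m A) *m P^T.
  rewrite -!mulmxA (mulmxA J) JP -!mulmxA (mulmxA P^T) PP mul1mx //.
by rewrite AJ addr0 add0r.
Qed.

(** Sylvester's identity: multiplying [B] by one unipotent matrix on the right or on the left gives
    two block triangular matrices. *)
Lemma det_one_add_mul m l (X : 'M[R]_(m, l)) (Y : 'M[R]_(l, m)) :
  \det (1%:M + X *m Y) = \det (1%:M + Y *m X).
Proof.
pose B := block_mx 1%:M (- X) Y 1%:M.
have e1 : B *m block_mx 1%:M X 0 1%:M = block_mx 1%:M 0 Y (1%:M + Y *m X).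
  by rewrite mulmx_block !mulmx1 !mul1mx !mulmx0 !addr0 subrr addrC.
have e2 : block_mx 1%:M X 0 1%:M *m B = block_mx (1%:M + X *m Y) 0 Y 1%:M.
  by rewrite mulmx_block !mulmx1 !mul1mx !mul0mx !add0r addNr.
have := congr1 determinant e1; have := congr1 determinant e2.
rewrite !det_mulmx !det_ublock !det_lblock !det1 !mulr1 !mul1r => <- <- //.
Qed.

Lemma det_embed_mx A : \det (embed_mx A) = \det A.
Proof.
have -> : embed_mx A = 1%:M + P *m ((A - 1%:M) *m P^T).
  by rewrite /embed_mx mulmxBl mul1mx mulmxBr mulmxA addrCA.
by rewrite det_one_add_mul -mulmxA PP mulmx1 addrC subrK.
Qed.
End Embedding.

Section SO21.
Variable R : realFieldType.

(* The action [X |-> A X A^T] of [A = [[a, b], [c, d]]] on the symmetric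
   matrices [X = [[z + x, y], [y, z - x]]], where [\det X = z^2 - x^2 - y^2]. *)
Definition so21_entry (a b c d : R) (i j : nat) : R :=
  match i, j with
  | 0, 0 => (a ^+ 2 - b ^+ 2 - c ^+ 2 + d ^+ 2) / 2
  | 0, 1 => a * b - c * d
  | 0, _ => (a ^+ 2 + b ^+ 2 - c ^+ 2 - d ^+ 2) / 2
  | 1, 0 => a * c - b * d
  | 1, 1 => a * d + b * c
  | 1, _ => a * c + b * d
  | _, 0 => (a ^+ 2 - b ^+ 2 + c ^+ 2 - d ^+ 2) / 2
  | _, 1 => a * b + c * d
  | _, _ => (a ^+ 2 + b ^+ 2 + c ^+ 2 + d ^+ 2) / 2
  end.

Definition so21 (a b c d : R) : 'M[R]_3 := \matrix_(i, j) so21_entry a b c d i j.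
Definition J21 : 'M[R]_3 :=
  \matrix_(i, j) (if i == j then (if val i == 2%N then -1 else 1) else 0).

Lemma so21M a b c d a' b' c' d' :
  so21 (a * a' + b * c') (a * b' + b * d') (c * a' + d * c') (c * b' + d * d') =
  so21 a b c d *m so21 a' b' c' d'.
Proof.
apply/matrixP => i j; rewrite !mxE !big_ord_recl big_ord0 !mxE /=.
case: i j => [[|[|[|]]] //= ?] [[|[|[|]]] //= ?]; by field.
Qed.

Lemma so21_orth a b c d :
  (so21 a b c d)^T *m J21 *m so21 a b c d = (a * d - b * c) ^+ 2 *: J21.
Proof.
apply/matrixP => i j; rewrite !mxE !big_ord_recl big_ord0 !mxE !big_ord_recl !big_ord0 !mxE /=.
case: i j => [[|[|[|]]] //= ?] [[|[|[|]]] //= ?]; by field.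
Qed.

Lemma det_so21 a b c d : \det (so21 a b c d) = (a * d - b * c) ^+ 3.
Proof.
rewrite (expand_det_row _ 0) !big_ord_recl big_ord0 /cofactor.
rewrite !(expand_det_row _ 0) !big_ord_recl !big_ord0 /cofactor !det_mx11 !mxE /=.
by field.
Qed.
End SO21.

(** * The symplectic plane of the imaginary case *)

Section Sl2Model.
Variable n : nat.
Local Notation M := 'M[quat]_n.+1.
Local Notation V := 'cV[quat]_n.+1.
Local Notation J := (Jq n).
Local Notation gmax g := (qabs (g ord_max ord_max)).
Hypothesis n2 : (2 <= n)%N.
Variable G : M -> Prop.
Hypothesis GSp : forall g, G g -> in_Sp g.
Hypothesis Ggr : is_subgroup mulmx 1%:M G.
Variable U : V -> Prop.
Hypothesis U_add : forall x y, U x -> U y -> U (x + y).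
Hypothesis U_scale : forall r x, U x -> U (qreg r *: x).
Hypothesis U_act : forall g x, G g -> U x -> U (g *m x).
Variables (x y : V) (c0 : quat).
Hypotheses (Ux : U x) (Uy : U y) (xy : hform x y = c0) (c00 : c0 != 0).
Hypothesis c0_conj : qconj c0 = - c0.
Hypothesis U_imag : forall z w, U z -> U w -> exists r, hform z w = qreg r * c0.

(** The coordinates along [x] and [y]: both are null and [<x, y> = c0 = - <y, x>], so pairing with
    [y] isolates the first and pairing with [x] the second. *)
Let alpha (z : V) : RR := qr (- c0^-1 * hform y z).
Let beta (z : V) : RR := qr (c0^-1 * hform x z).

(** [<z, z>] is real, and also a real multiple of the imaginary [c0]. *)
Lemma imag_null z : U z -> sq z = 0.
Proof.
move=> Uz; have [r hr] := U_imag Uz Uz; have := form_sq z; rewrite hr => e.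
have /(congr1 qr) : qconj (qreg r * c0) = qreg (sq z) by rewrite e qconj_reg.
have /(congr1 qr) := e.
rewrite qconjM qconj_reg c0_conj mulNr qrN qregC /= => -> ; lra.
Qed.
Lemma form_imag z : U z -> hform z z = 0.
Proof. by move=> Uz; rewrite form_sq imag_null. Qed.
Lemma imag_yx : hform y x = - c0.
Proof. by rewrite -form_conj xy. Qed.
Lemma alphaD z w : alpha (z + w) = alpha z + alpha w.
Proof. by rewrite /alpha formDr mulrDr qrD. Qed.
Lemma betaD z w : beta (z + w) = beta z + beta w.
Proof. by rewrite /beta formDr mulrDr qrD. Qed.
Lemma alphaZ r z : alpha (qreg r *: z) = r * alpha z.
Proof. by rewrite /alpha form_regZr mulrA -qregC -mulrA qr_regM. Qed.
Lemma betaZ r z : beta (qreg r *: z) = r * beta z.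
Proof. by rewrite /beta form_regZr mulrA -qregC -mulrA qr_regM. Qed.
Lemma alpha_x : alpha x = 1.
Proof. by rewrite /alpha imag_yx mulrNN mulVr. Qed.
Lemma alpha_y : alpha y = 0.
Proof. by rewrite /alpha form_sq imag_null // raddf0 mulr0. Qed.
Lemma beta_x : beta x = 0.
Proof. by rewrite /beta form_sq imag_null // raddf0 mulr0. Qed.
Lemma beta_y : beta y = 1.
Proof. by rewrite /beta xy mulVr. Qed.

(** Since [U] consists of null vectors, a negative one requires a quaternionic coefficient:
    [sq t = 2 c0^2 = - 2 |c0|^2]. *)
Let t : V := x + rs y c0.

Lemma sq_t : sq t < 0.
Proof.
have cc : c0 * c0 = qreg (- qnorm2 c0).
  have := qmul_conjr c0; rewrite c0_conj mulrN => e.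
  by apply: oppr_inj; rewrite e; qring.
have := form_sq t; rewrite {1 2}/t !formDl !formDr !form_rsl !form_rsr imag_yx xy.
rewrite (form_imag Ux) (form_imag Uy) c0_conj mul0r mulr0 addr0 add0r mulrNN cc -rmorphD.
move/qreg_inj => <-; have : 0 < qnorm2 c0 by rewrite lt0r qnorm2_ge0 qnorm2_eq0 c00.
lra.
Qed.

(** The remainder [w] is orthogonal to [x] and [y], hence to the negative [t], so it would be
    positive if nonzero; but it lies in [U] and is null. *)
Lemma decomp z : U z -> z = qreg (alpha z) *: x + qreg (beta z) *: y.
Proof.
move=> Uz; apply/eqP; rewrite -subr_eq0; set w := _ - _.
have Uw : U w.
  apply: U_add => //; rewrite -scaleN1r -[-1]/(- qreg 1) -rmorphN; apply: U_scale.
  by apply: U_add; apply: U_scale.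
have fx : hform x w = 0.
  have [r hr] := U_imag Ux Uw; have : beta w = 0.
    rewrite /w betaD -[- _]scaleN1r -[-1]/(- qreg 1) -rmorphN betaZ betaD !betaZ beta_x beta_y.
    by ring.
  by rewrite /beta hr qregC mulrA mulVr // mul1r /= => ->; rewrite raddf0 mulr0.
have fy : hform y w = 0.
  have [r hr] := U_imag Uy Uw; have : alpha w = 0.
    rewrite /w alphaD -[- _]scaleN1r -[-1]/(- qreg 1) -rmorphN alphaZ alphaD !alphaZ alpha_x alpha_y.
    by ring.
  rewrite /alpha hr qregC mulNr mulrA mulVr // mul1r qrN /= => /eqP.
  by rewrite oppr_eq0 => /eqP ->; rewrite raddf0 mulr0.
have ft : hform t w = 0 by rewrite formDl form_rsl fx fy mulr0 addr0.
apply: contrapT => /negP w0; have := timelike_orth sq_t ft w0.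
by rewrite imag_null // ltxx.
Qed.

Let a h := alpha (h *m x).
Let b h := alpha (h *m y).
Let c h := beta (h *m x).
Let d h := beta (h *m y).

Lemma act_x h : G h -> h *m x = qreg (a h) *: x + qreg (c h) *: y.
Proof. by move=> Gh; apply/decomp/U_act. Qed.
Lemma act_y h : G h -> h *m y = qreg (b h) *: x + qreg (d h) *: y.
Proof. by move=> Gh; apply/decomp/U_act. Qed.

Lemma sl2_det h : G h -> a h * d h - b h * c h = 1.
Proof.
move=> Gh; have := G_form GSp x y Gh; rewrite act_x // act_y // xy.
rewrite !formDl !formDr !form_regZl !form_regZr (form_imag Ux) (form_imag Uy) imag_yx xy.
rewrite !mulr0 add0r addr0 mulrN mulrN !mulrA -mulrBl => e.
have : (qreg (a h) * qreg (d h) - qreg (c h) * qreg (b h)) * c0 = 1 * c0 by rewrite mul1r.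
move/(mulIr (_ : c0 \is a GRing.unit)) => /(_ c00).
by rewrite -!rmorphM -rmorphB -[1]/(qreg 1) => /qreg_inj <-; ring.
Qed.

Lemma sl2_mul g h : G g -> G h ->
  [/\ a (g *m h) = a g * a h + b g * c h, b (g *m h) = a g * b h + b g * d h,
      c (g *m h) = c g * a h + d g * c h & d (g *m h) = c g * b h + d g * d h].
Proof.
move=> Gg Gh.
have ex : g *m h *m x = qreg (a h) *: (g *m x) + qreg (c h) *: (g *m y).
  by rewrite -mulmxA {1}act_x // mulmxDr !mul_regZ.
have ey : g *m h *m y = qreg (b h) *: (g *m x) + qreg (d h) *: (g *m y).
  by rewrite -mulmxA {1}act_y // mulmxDr !mul_regZ.
split.
- by rewrite {1}/a ex alphaD !alphaZ -/(a g) -/(b g); ring.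
- by rewrite {1}/b ey alphaD !alphaZ -/(a g) -/(b g); ring.
- by rewrite {1}/c ex betaD !betaZ -/(c g) -/(d g); ring.
- by rewrite {1}/d ey betaD !betaZ -/(c g) -/(d g); ring.
Qed.

Lemma sl2_proper (K : RR) : exists R', forall h, G h ->
  `|a h| <= K -> `|b h| <= K -> `|c h| <= K -> `|d h| <= K -> gmax h <= R'.
Proof.
pose B := mnorm t * ((K * mnorm x + K * mnorm y) + (K * mnorm x + K * mnorm y) * qabs c0).
have [R' hR'] := timelike_proper GSp Ggr B sq_t; exists R' => h Gh ha hb hc hd.
apply: hR' => //; apply: le_trans (qabs_form _ _) _; rewrite ler_wpM2l ?mnorm_ge0 //.
have bound p q : `|p| <= K -> `|q| <= K ->
    mnorm (qreg p *: x + qreg q *: y) <= K * mnorm x + K * mnorm y.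
  move=> hp hq; apply: le_trans (mnormD _ _) _.
  by rewrite !mnormZ !qabs_reg lerD // ler_wpM2r ?mnorm_ge0.
rewrite /t mulmxDr rs_mul; apply: le_trans (mnormD _ _) _; rewrite mnorm_rs.
by rewrite act_x // act_y // lerD ?ler_wpM2r ?qabs_ge0 // bound.
Qed.

(** The two positive directions go to coordinates 0 and 1, the negative one to [ord_max]; [2 <= n]
    keeps them distinct. *)
Let f (k : 'I_3) : 'I_n.+1 := if val k == 2%N then ord_max else inord (val k).
Let P : 'M[RR]_(n.+1, 3) := \matrix_(i, k) (i == f k)%:R.

Lemma so21_index_inj : injective f.
Proof.
move=> [[|[|[|]]] // p] [[|[|[|]]] // q]; rewrite /f /= => /(congr1 val) /= e;
  apply/val_inj => //=; move: e; rewrite ?inordK; lia.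
Qed.
Lemma so21_frame_orth : P^T *m P = 1%:M.
Proof.
apply/matrixP => i j; rewrite !mxE (bigD1 (f i)) //= big1 => [|k ki].
  by rewrite !mxE eqxx mul1r addr0 (inj_eq so21_index_inj).
by rewrite !mxE (negbTE ki) mul0r.
Qed.
Lemma so21_frame_J : Jr n *m P = P *m J21 RR.
Proof.
apply/matrixP => i j; rewrite !mxE (bigD1 i) //= big1 ?addr0 => [|k ki]; last first.
  by rewrite mxE eq_sym (negbTE ki) mul0r.
rewrite (bigD1 j) //= big1 ?addr0 => [|k ki]; last by rewrite [J21 _ _ _]mxE (negbTE ki) mulr0.
rewrite !mxE !eqxx; case: (eqVneq i (f j)) => [->|_]; last by rewrite mulr0 mul0r.
rewrite mulr1 mul1r /sgn; congr (if _ then _ else _).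
case: j => [[|[|[|]]] //= p]; rewrite /f /= ?eqxx //;
  by apply/negbTE/eqP => /(congr1 val) /=; rewrite inordK; lia.
Qed.

Lemma sl2_model : exists psi, real_model G psi.
Proof.
pose psi h := embed_mx P (so21 (a h) (b h) (c h) (d h)).
exists psi; split.
- move=> h Gh; apply/qmx_orth; apply: (embed_mx_orth so21_frame_orth so21_frame_J).
  + by apply/matrixP => i j; rewrite !mxE eq_sym; case: eqP => // ->.
  + by apply/matrixP => i j; rewrite !mxE eq_sym; case: eqP => // ->.
  + by rewrite so21_orth sl2_det // expr1n scale1r.
- move=> g h Gg Gh; rewrite /psi -(embed_mxM so21_frame_orth) -so21M.
  by have [-> -> -> ->] := sl2_mul Gg Gh.
(* The corner is half the sum of the four squares, so each square is at most [2 R <= K], and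
   [K >= 1] turns [p^2 <= K] into [|p| <= K]. *)
- move=> R; pose K := 2 * `|R| + 1; have [R' hR'] := sl2_proper K; exists R' => h Gh.
  have -> : gmax (qmx (psi h)) = (a h ^+ 2 + b h ^+ 2 + c h ^+ 2 + d h ^+ 2) / 2.
    rewrite mxE qabs_reg.
    have -> : psi h ord_max ord_max = (a h ^+ 2 + b h ^+ 2 + c h ^+ 2 + d h ^+ 2) / 2.
      have fk k : (ord_max == f k) = (val k == 2%N).
        case: k => [[|[|[|]]] //= p]; rewrite /f /= ?eqxx //;
          by apply/negbTE/eqP => /(congr1 val) /=; rewrite inordK; lia.
      rewrite /psi /embed_mx mxE [X in _ + X]mxE.
      rewrite !mxE !big_ord_recl !big_ord0 !mxE !big_ord_recl !big_ord0 !mxE !fk eqxx /=.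
      by field.
    by rewrite ger0_norm // divr_ge0 // !addr_ge0 // sqr_ge0.
  move=> hR; have R0 := ler_norm R.
  have := sqr_ge0 (a h); have := sqr_ge0 (b h); have := sqr_ge0 (c h); have := sqr_ge0 (d h).
  have K1 : 1 <= K by rewrite /K; have := normr_ge0 R; lra.
  have KR : 2 * R <= K by rewrite /K; lra.
  move=> d2 c2 b2 a2.
  have small p : p ^+ 2 <= K -> `|p| <= K.
    move=> h2; have : `|p| ^+ 2 <= K by rewrite real_normK ?num_real.
    have := normr_ge0 p; move: (`|p|) => q q0 qK.
    by have [q1|q1] := leP q 1; nra.
  by apply: hR' => //; apply: small; lra.
- by apply: Or32 => h Gh; rewrite (det_embed_mx so21_frame_orth) det_so21 sl2_det // expr1n.
Qed.
End Sl2Model.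

(** * Existence of real models *)

Section Existence.
Variable n : nat.
Local Notation M := 'M[quat]_n.+1.
Local Notation V := 'cV[quat]_n.+1.
Local Notation J := (Jq n).
Local Notation gmax g := (qabs (g ord_max ord_max)).
Hypothesis n2 : (2 <= n)%N.

Lemma real_model_exists (G : M -> Prop) a b :
  (forall g, G g -> in_Sp g) -> is_subgroup mulmx 1%:M G ->
  discrete (@qnear n) G -> torsion_free mulmx 1%:M G ->
  (forall g, G g -> qreal (\tr g)) -> free_pair mulmx 1%:M G a b ->
  exists psi, real_model G psi.
Proof.
move=> GSp Ggr Gdisc Gtf trG fp.
have Gunb := free_pair_unbounded GSp Ggr Gdisc fp.
have nofix := free_no_fixed_null GSp Ggr Gdisc Gtf fp.
have [u [d [[su u0] d0 dconj ud uc]]] := invariant_form GSp Ggr Gunb nofix trG.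
pose U := real_span G u.
have UD x y : U x -> U y -> U (x + y) by exact: real_span_add.
have UZ r x : U x -> U (qreg r *: x) by exact: real_span_scale.
have UA g x : G g -> U x -> U (g *m x).
  by move=> Gg; apply: (real_span_act Ggr Gg).
have Uf x y : U x -> U y -> qreal (hform x y * d).
  exact: (real_span_form GSp Ggr ud).
have Uu : U u.
  have : U (1%:M *m u) by apply: real_span_orbit; apply: (G_one Ggr).
  by rewrite mul1mx.
have [h Gh e0] := nofix u u0 su.
have Uhu : U (h *m u) by apply: real_span_orbit.
have dU : d \is a GRing.unit by rewrite quat_unitE.
case: dconj => dc.
  have /qreal_conjP/qrealP dE := dc; set r := qr d in dE.
  have r0 : r != 0 by apply: contraNneq d0 => r0; rewrite dE r0 raddf0.
  have Ureal x y : U x -> U y -> qreal (hform x y).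
    move=> Ux Uy; have := qreal_regM r^-1 (Uf _ _ Ux Uy).
    by rewrite {1}dE -qregC mulrA -rmorphM mulVf // rmorph1 mul1r.
  apply: (frame_model GSp Ggr UD UZ UA Ureal).
    by move=> Gc x; apply: real_span_complex => //; apply: uc.
  have /qrealP eE := Ureal _ _ Uu Uhu; set s := qr _ in eE.
  have s0 : s != 0 by apply: contraNneq e0 => s0; rewrite eE s0 raddf0.
  (* With [s = <u, h u>] real, the null vectors [u] and [h u] combine to a vector of square
     [- 2 s^2]. *)
  exists (u + qreg (- s) *: (h *m u)); split; first by apply: UD => //; apply: UZ.
  have es : sq (u + qreg (- s) *: (h *m u)) = - (2 * s ^+ 2).
    apply: qreg_inj; rewrite -form_sq formDl !formDr !form_regZl !form_regZr.
    rewrite !form_sq (G_sq GSp _ Gh) su -(form_conj u) eE qconj_reg.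
    by apply: quat_eq; rewrite ?qE /=; ring.
  by rewrite es oppr_lt0 mulr_gt0 // exprn_even_gt0.
(* Here [d] is imaginary, hence so is [c0 = s / d], and every value of the form on [U] is a real
   multiple of [c0]. *)
pose c0 := hform u (h *m u).
have /qrealP cd : qreal (c0 * d) by exact: Uf.
set s := qr _ in cd.
have s0 : s != 0.
  apply/eqP => s0; move/eqP: cd; rewrite s0 raddf0 quat_mulf_eq0 (negbTE d0) orbF.
  by rewrite (negbTE e0).
have cE : c0 = qreg s * d^-1 by rewrite -cd mulrK.
have cc : qconj c0 = - c0.
  have dcd : d * c0 = qreg s by rewrite cE mulrA -qregC mulrK.
  apply: (mulrI dU); rewrite mulrN dcd -[in RHS](qconj_reg s) -cd qconjM dc mulNr opprK //.
apply: (sl2_model n2 GSp Ggr UD UZ UA Uu Uhu (erefl c0) e0 cc).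
move=> z w Uz Uw; have /qrealP zw := Uf _ _ Uz Uw.
exists (qr (hform z w * d) / s); apply: (mulIr dU).
by rewrite zw -mulrA cd -rmorphM divfK // qr_reg.
Qed.

Lemma real_model_faithful (G : M -> Prop) psi :
  (forall g, G g -> in_Sp g) -> is_subgroup mulmx 1%:M G ->
  discrete (@qnear n) G -> torsion_free mulmx 1%:M G -> real_model G psi ->
  (forall g h, G g -> G h -> psi g = psi h -> g = h) /\
  discrete (@qnear n) (Defs.image G (fun g => qmx (psi g))).
Proof.
move=> GSp Ggr Gdisc Gtf [pSp pM pP _].
have [inj disc] := @proper_faithful n G GSp Ggr Gdisc Gtf (fun g => qmx (psi g))
  (fun g h Gg Gh => etrans (congr1 (@qmx _ _) (pM g h Gg Gh)) (qmxM _ _))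
  (fun g Gg => quat_mulmx1C (Sp_shp (pSp g Gg))) pP.
by split=> // g h Gg Gh e; apply: inj => //; rewrite e.
Qed.

Section Transfer.
Variables (T : Type) (mul : T -> T -> T) (e : T) (Gam : T -> Prop).
Hypothesis Ggr : is_subgroup mul e Gam.
Hypothesis mul_e : mul e e = e.

Definition img (f : T -> M) : M -> Prop := fun x => exists2 g, Gam g & f g = x.

Section Morphism.
Variable f : T -> M.
Hypothesis fM : forall g h, Gam g -> Gam h -> f (mul g h) = f g *m f h.
Hypothesis fSp : forall g, Gam g -> in_Sp (f g).

Lemma morph1 : f e = 1%:M.
Proof.
have G1 : Gam e by case: Ggr.
have := fM G1 G1; rewrite mul_e => fe; have := Sp_shp (fSp G1).
by rewrite {2}fe mulmxA (Sp_shp (fSp G1)) mul1mx.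
Qed.
Lemma img_Sp g : img f g -> in_Sp g.
Proof. by case=> h Gh <-; apply: fSp. Qed.
Lemma img_subgroup : is_subgroup mulmx 1%:M (img f).
Proof.
case: (Ggr) => G1 GM GV; split.
- by exists e => //; apply: morph1.
- by move=> _ _ [g Gg <-] [h Gh <-]; exists (mul g h); [apply: GM|apply: fM].
- move=> _ [g Gg <-]; have [h [Gh gh hg]] := GV g Gg.
  by exists (f h); split; [exists h|rewrite -fM // gh morph1|rewrite -fM // hg morph1].
Qed.
Lemma morph_word a b w : Gam a -> Gam b ->
  Gam (word_eval mul e a b w) /\
  f (word_eval mul e a b w) = word_eval mulmx 1%:M (f a) (f b) w.
Proof.
case: (Ggr) => G1 GM _ Ga Gb; elim: w => [|c w [IH1 IH2]] /=; first by split; [|apply: morph1].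
have Gc : Gam (if c then a else b) by case: c.
by split; [apply: GM|rewrite fM // IH2; case: c Gc].
Qed.
Lemma img_torsion_free : (forall g h, Gam g -> Gam h -> f g = f h -> g = h) ->
  torsion_free mul e Gam -> torsion_free mulmx 1%:M (img f).
Proof.
move=> inj tf _ [g Gg <-] k k0; case: (Ggr) => G1 GM _.
have powP : Gam (mpow mul e g k) /\ f (mpow mul e g k) = mpow mulmx 1%:M (f g) k.
  rewrite /mpow; elim: k {k0} => [|k [IH1 IH2]] /=; first by split; [|apply: morph1].
  by split; [apply: GM|rewrite fM // IH2].
case: powP => Gk <- fk; rewrite -morph1; congr f; apply: (tf _ Gg k k0).
by apply: inj => //; rewrite fk morph1.
Qed.
End Morphism.

(** [iota] brings the nonelementary group, [rho] the real traces. The free pair found in the image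
    of [iota] is pulled back to [Gam] and pushed forward by the injective [rho]. *)
Lemma real_representation (iota rho : T -> M) :
  (forall g h, Gam g -> Gam h -> iota (mul g h) = iota g *m iota h) ->
  (forall g, Gam g -> in_Sp (iota g)) ->
  q_nonelementary (img iota) ->
  torsion_free mul e Gam ->
  (forall g h, Gam g -> Gam h -> rho (mul g h) = rho g *m rho h) ->
  (forall g, Gam g -> in_Sp (rho g)) ->
  (forall g h, Gam g -> Gam h -> rho g = rho h -> g = h) ->
  discrete (@qnear n) (img rho) ->
  (forall g, Gam g -> qreal (\tr (rho g))) ->
  exists psi, real_model (img rho) psi.
Proof.
move=> iM iSp nonel tf rM rSp rinj rdisc rtr.
have [_ [_ [[a Ga <-] [b Gb <-] free]]] :=
  nonelementary_free (img_Sp iSp) (img_subgroup iM iSp) nonel.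
apply: (@real_model_exists _ (rho a) (rho b)).
- exact: img_Sp.
- exact: img_subgroup.
- exact: rdisc.
- exact: img_torsion_free.
- by move=> _ [g Gg <-]; apply: rtr.
- split; [by exists a|by exists b|move=> w1 w2 sw].
  have [G1 <-] := morph_word rM rSp w1 Ga Gb; have [G2 <-] := morph_word rM rSp w2 Ga Gb.
  move=> /(rinj _ _ G1 G2) e12; apply: free => //.
  have [_ <-] := morph_word iM iSp w1 Ga Gb; have [_ <-] := morph_word iM iSp w2 Ga Gb.
  by rewrite e12.
Qed.
End Transfer.
End Existence.

(** * Complex matrices *)

Definition cquat (z : CC) : quat := Quat (complex.Re z) (complex.Im z) 0 0.
Definition rcomplex (r : RR) : CC := Complex r 0.

Lemma cquat_is_zmod_morphism : zmod_morphism cquat.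
Proof. by move=> [a b] [c d]; qring. Qed.
Lemma cquat_is_monoid_morphism : monoid_morphism cquat.
Proof. by split=> // -[a b] [c d]; qring. Qed.
HB.instance Definition _ :=
  GRing.isZmodMorphism.Build CC quat cquat cquat_is_zmod_morphism.
HB.instance Definition _ :=
  GRing.isMonoidMorphism.Build CC quat cquat cquat_is_monoid_morphism.

Lemma rcomplex_is_zmod_morphism : zmod_morphism rcomplex.
Proof. by move=> a b; apply/eqP; rewrite eq_complex /= subr0 !eqxx. Qed.
Lemma rcomplex_is_monoid_morphism : monoid_morphism rcomplex.
Proof.
by split=> // a b; apply/eqP; rewrite eq_complex /= !mulr0 !mul0r subr0 addr0 !eqxx.
Qed.
HB.instance Definition _ :=
  GRing.isZmodMorphism.Build RR CC rcomplex rcomplex_is_zmod_morphism.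
HB.instance Definition _ :=
  GRing.isMonoidMorphism.Build RR CC rcomplex rcomplex_is_monoid_morphism.

Lemma cquat_inj : injective cquat.
Proof. by move=> [a b] [c d] [-> ->]. Qed.
Lemma qnorm2_cquat z : qnorm2 (cquat z) = cnorm2 z.
Proof. by rewrite /qnorm2 /cnorm2 /= expr0n /= !addr0. Qed.
Lemma qconj_cquat z : qconj (cquat z) = cquat (conjc z).
Proof. by case: z => a b; apply: quat_eq => //=; rewrite oppr0. Qed.
Lemma qinv_cquat z : qinv (cquat z) = cquat z^-1.
Proof. by case: z => a b; rewrite /qinv qnorm2_cquat; apply: quat_eq; rewrite /= ?mulNr ?mul0r ?oppr0. Qed.
Lemma qcomplexP q : qcomplex q -> q = cquat (Complex (qr q) (qi q)).
Proof. by case: q => a b c d [/= -> ->]. Qed.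

Section ComplexMatrices.
Variable n : nat.
Local Notation CM := 'M[CC]_n.+1.

Definition cqmx (A : CM) : 'M[quat]_n.+1 := map_mx cquat A.
Definition rcmx (A : 'M[RR]_n.+1) : CM := map_mx rcomplex A.

Lemma cqmx_inj : injective cqmx.
Proof. by move=> A B /matrixP AB; apply/matrixP => i j; have := AB i j; rewrite !mxE => /cquat_inj. Qed.
Lemma cqmxM A B : cqmx (A *m B) = cqmx A *m cqmx B.
Proof. exact: map_mxM. Qed.
Lemma cqmx_rcmx A : cqmx (rcmx A) = qmx A.
Proof. by apply/matrixP => i j; rewrite !mxE. Qed.
Lemma cqmx_J : cqmx (Jc n) = Jq n.
Proof. by apply/matrixP => i j; rewrite !mxE; do ![case: ifP => _]; rewrite ?rmorphN ?rmorph1 ?raddf0. Qed.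
Lemma cqmx_adj A : cqmx (cadj A) = adj (cqmx A).
Proof. by apply/matrixP => i j; rewrite !mxE qconj_cquat. Qed.
Lemma cqmx_Sp A : in_Sp (cqmx A) <-> cadj A *m Jc n *m A = Jc n.
Proof.
rewrite in_SpE -cqmx_adj -cqmx_J -!cqmxM; split=> [/cqmx_inj //|-> //].
Qed.
Lemma cqmx_tr A : \tr (cqmx A) = cquat (\tr A).
Proof. by rewrite /mxtrace rmorph_sum; apply: eq_bigr => i _; rewrite mxE. Qed.
Lemma cqmx_near eps A B : qnear eps (cqmx A) (cqmx B) <-> cnear eps A B.
Proof.
have e i j : qnorm2 (qadd (cqmx B i j) (qopp (cqmx A i j))) = cnorm2 (B i j - A i j).
  by rewrite -qnorm2_cquat rmorphB /= !mxE.
by split=> h i j; have := h i j; rewrite e.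
Qed.
Lemma cqmx_orb0 A k : qorb0 (cqmx A) 0 k = cquat (corb0 A 0 k).
Proof. by rewrite !mxE qinv_cquat rmorphM. Qed.

Lemma cqmx_nonelementary Gam : c_nonelementary Gam ->
  q_nonelementary (img Gam cqmx).
Proof.
pose up (xi : 'rV[CC]_n) : 'rV[quat]_n := map_mx cquat xi.
have up_inj xi eta : up xi = up eta -> xi = eta.
  by move/matrixP => h; apply/matrixP => i j; have := h i j; rewrite !mxE => /cquat_inj.
have lim xi : limit_set (@corb0 n) (@csphere n) (@cnearP n) Gam xi ->
    limit_set (@qorb0 n) (@qsphere n) (@qnearP n) (img Gam cqmx) (up xi).
  case=> sx hx; split.
    by rewrite /qsphere -[RHS]sx; apply: eq_bigr => k _; rewrite mxE qnorm2_cquat.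
  move=> eps eps0; have [g Gg hg] := hx eps eps0; exists (cqmx g); first by exists g.
  move=> k; have -> : qadd (up xi 0 k) (qopp (qorb0 (cqmx g) 0 k)) =
      cquat (xi 0 k - corb0 g 0 k) by rewrite cqmx_orb0 rmorphB /= mxE.
  by rewrite qnorm2_cquat; apply: hg.
case=> x1 [x2 [x3 [l1 l2 l3 [x12 x13 x23]]]].
exists (up x1), (up x2), (up x3); split; try exact: lim.
by split=> /up_inj.
Qed.

Lemma cqmx_complex A : mxcomplex (cqmx A).
Proof. by move=> i j; rewrite mxE. Qed.

Lemma det_Jr_neq0 : \det (Jr n) != 0.
Proof.
have JJ1 : Jr n *m Jr n = 1%:M.
  by apply: (@qmx_inj n.+1 n.+1); rewrite qmxM qmx_J JJ /qmx map_mx1.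
by apply/eqP => h; have := congr1 determinant JJ1; rewrite det_mulmx h mul0r det1 => /eqP;
  rewrite eq_sym oner_eq0.
Qed.

Lemma orth_det_sqr (A : 'M[RR]_n.+1) : A^T *m Jr n *m A = Jr n -> \det A * \det A = 1.
Proof.
move/(congr1 determinant); rewrite !det_mulmx det_tr mulrAC => h.
by apply: (mulIf det_Jr_neq0); rewrite mul1r.
Qed.

(** The determinant of [psi h] is 1 or -1. If [psi] fixes the coordinate [j0], placing this sign
    there commutes with [psi] and gives a homomorphism again. In the conjugate case [E] has complex
    entries, so determinants over the complex numbers give [det (psi g) = det h = 1]. *)
Lemma det_fix (Gam : CM -> Prop) (G := img Gam cqmx) psi :
  (forall g, Gam g -> \det g = 1) -> real_model G psi ->
  exists psi', real_model G psi' /\ forall g, G g -> \det (psi' g) = 1.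
Proof.
move=> det1G model; case: (model) => pSp pM pP [[j0 hj0]|hd|[E [EJ hE Ec]]].
- pose D (r : RR) : 'M[RR]_n.+1 := diag_mx (\row_j if j == j0 then r else 1).
  have DE r i j : D r i j = if i == j then (if j == j0 then r else 1) else 0.
    by rewrite !mxE; case: (eqVneq i j) => [->|_]; rewrite ?mulr1n ?mulr0n.
  have Dl r (A : 'M[RR]_n.+1) i j : (D r *m A) i j = (if i == j0 then r else 1) * A i j.
    by rewrite mul_diag_mx !mxE.
  have Dr r (A : 'M[RR]_n.+1) i j : (A *m D r) i j = A i j * (if j == j0 then r else 1).
    by rewrite mul_mx_diag !mxE.
  have DD r s : D r *m D s = D (r * s).
    apply/matrixP => i j; rewrite Dl !DE.
    by case: (eqVneq i j) => [->|_]; [case: eqP => // _; rewrite mul1r|rewrite mulr0].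
  have detD r : \det (D r) = r.
    rewrite det_diag (bigD1 j0) //= mxE eqxx big1 ?mulr1 // => i ij.
    by rewrite mxE (negbTE ij).
  have comm r h : G h -> D r *m psi h = psi h *m D r.
    move=> Gh; apply/matrixP => i j; rewrite Dl Dr.
    have [h1 _] := hj0 h Gh i; have [_ h2] := hj0 h Gh j.
    case: (eqVneq i j0) (eqVneq j j0) => [->|ij] [ej|ij'] //; rewrite ?ej ?mul1r ?mulr1 //.
    + by rewrite mulrC.
    + by rewrite h2 (negbTE ij') mulr0.
    + by rewrite h1 (negbTE ij) mul0r.
  have d2 g : G g -> \det (psi g) * \det (psi g) = 1.
    by move=> Gg; apply: orth_det_sqr; apply/qmx_orth; apply: pSp.
  pose psi' (h : 'M[quat]_n.+1) : 'M[RR]_n.+1 := psi h *m D (\det (psi h)).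
  exists psi'; rewrite /psi'.
  have det1 h : G h -> \det (psi h *m D (\det (psi h))) = 1.
    by move=> Gh; rewrite det_mulmx detD d2.
  split=> //; split.
  + move=> h Gh; apply/qmx_orth; rewrite trmx_mul tr_diag_mx -/(D _).
    have ph := (qmx_orth _).1 (pSp h Gh).
    rewrite -!mulmxA (mulmxA (Jr n)) (mulmxA (psi h)^T) (mulmxA _ (Jr n)) ph.
    apply/matrixP => i j; rewrite Dl Dr !mxE; case: (eqVneq i j) => [->|_].
      by case: (j == j0); rewrite ?mul1r ?mulr1 // mulrCA d2 // mulr1.
    by rewrite mul0r mulr0.
  + move=> g h Gg Gh; rewrite pM // det_mulmx -DD.
    by rewrite -!mulmxA; congr (_ *m _); rewrite !mulmxA comm.
  + move=> R; have [R' hR'] := pP R; exists R' => h Gh hR; apply: hR' => //.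
    apply: le_trans hR; rewrite mxE [X in _ <= qabs X]mxE Dr !qabs_reg normrM.
    have : `|\det (psi h)| = 1.
      apply/eqP; rewrite -(@eqrXn2 _ 2) // expr1n; apply/eqP.
      by rewrite real_normK ?num_real // expr2 d2.
    by case: ifP => _ e; rewrite ?e ?normr1 mulr1.
  + by apply: Or32.
- by exists psi.
- exists psi; split=> // g [h Gh hg].
  have Gg : G g by exists h.
  have {}Ec : mxcomplex E by apply: Ec => _ [k _ <-]; apply: cqmx_complex.
  pose E0 : CM := \matrix_(i, j) Complex (qr (E i j)) (qi (E i j)).
  have EE : E = cqmx E0 by apply/matrixP => i j; rewrite !mxE -qcomplexP.
  have dJ : \det (Jc n) != 0.
    have e : Jc n = rcmx (Jr n).
      apply: cqmx_inj; rewrite cqmx_rcmx cqmx_J qmx_J //.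
    by rewrite e /rcmx det_map_mx fmorph_eq0 det_Jr_neq0.
  have dE : \det E0 != 0.
    apply/eqP => h0; have /cqmx_Sp/(congr1 determinant) : in_Sp (cqmx E0) by apply/in_SpE; rewrite -EE.
    by rewrite !det_mulmx h0 mulr0 => /esym/eqP; rewrite (negbTE dJ).
  have : h *m E0 = E0 *m rcmx (psi g).
    by apply: cqmx_inj; rewrite !cqmxM cqmx_rcmx -EE -hE // hg.
  move/(congr1 determinant); rewrite !det_mulmx det1G // mul1r => /esym/eqP.
  rewrite -[X in _ == X]mulr1 (inj_eq (mulfI dE)) /rcmx det_map_mx => /eqP.
  by rewrite -[1]/(rcomplex 1) => -[].
Qed.
End ComplexMatrices.

Theorem theorem1p3 (n : nat) (hn : (2 <= n)%N) :
  (* complex hyperbolic case: Gamma < SU(n,1) *)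
  (forall Gamma : 'M[CC]_(n.+1) -> Prop,
     (forall g, Gamma g -> in_SU g) ->
     is_subgroup mulmx 1%:M Gamma ->
     discrete (@cnear n) Gamma ->
     torsion_free mulmx 1%:M Gamma ->
     c_nonelementary Gamma ->
     ((exists rho : 'M[CC]_(n.+1) -> 'M[CC]_(n.+1),
         discrete_faithful_rep mulmx (@cnear n) Gamma rho (@in_SU n) /\
         (forall g, Gamma g -> complex.Im (\tr (rho g)) = 0))
      <->
      (exists rho : 'M[CC]_(n.+1) -> 'M[CC]_(n.+1),
         discrete_faithful_rep mulmx (@cnear n) Gamma rho (@in_SO n))))
  /\
  (* quaternionic hyperbolic case: Gamma < Sp(n,1) *)
  (forall Gamma : 'M[quat]_(n.+1) -> Prop,
     (forall g, Gamma g -> in_Sp g) ->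
     is_subgroup (@qmx_mul n) (qmx1 n) Gamma ->
     discrete (@qnear n) Gamma ->
     torsion_free (@qmx_mul n) (qmx1 n) Gamma ->
     q_nonelementary Gamma ->
     ((exists rho : 'M[quat]_(n.+1) -> 'M[quat]_(n.+1),
         discrete_faithful_rep (@qmx_mul n) (@qnear n) Gamma rho (@in_Sp n) /\
         (forall g, Gamma g -> qreal (qtr (rho g))))
      <->
      (exists rho : 'M[quat]_(n.+1) -> 'M[quat]_(n.+1),
         discrete_faithful_rep (@qmx_mul n) (@qnear n) Gamma rho (@in_O n)))).
Proof.
split=> Gamma GSU Ggr Gdisc Gtf Gnon.
- split; last first.
    move=> [rho [rSO rM rinj rdisc]]; exists rho; split.
      by split=> // g /rSO [].
    by move=> g /rSO [_ rr]; rewrite /mxtrace raddf_sum big1 // => i _; apply: rr.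
  move=> [rho [[rSU rM rinj rdisc] rtr]].
  pose f g := cqmx (rho g).
  have fM g h : Gamma g -> Gamma h -> f (g *m h) = f g *m f h.
    by move=> Gg Gh; rewrite /f rM // cqmxM.
  have fSp g : Gamma g -> in_Sp (f g) by move=> /rSU [h _]; apply/cqmx_Sp.
  have finj g h : Gamma g -> Gamma h -> f g = f h -> g = h.
    by move=> Gg Gh /cqmx_inj; apply: rinj.
  have fdisc : discrete (@qnear n) (img Gamma f).
    move=> _ [g Gg <-]; have [|eps eps0 h] := rdisc (rho g); first by exists g.
    exists eps => // _ [k Gk <-] /cqmx_near near; congr cqmx.
    by apply: h => //; exists k.
  have e11 : 1%:M *m 1%:M = 1%:M :> 'M[CC]_n.+1 by rewrite mulmx1.
  have iM (g h : 'M[CC]_n.+1) : Gamma g -> Gamma h -> cqmx (g *m h) = cqmx g *m cqmx h.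
    by move=> _ _; apply: cqmxM.
  have iSp g : Gamma g -> in_Sp (cqmx g) by move=> /GSU [h _]; apply/cqmx_Sp.
  have ftr g : Gamma g -> qreal (\tr (f g)).
    by move=> Gg; rewrite cqmx_tr; split=> //=; apply: rtr.
  have [psi0 model0] := real_representation hn Ggr e11 iM iSp (cqmx_nonelementary Gnon)
    Gtf fM fSp finj fdisc ftr.
  (* [det_fix] expects the [cqmx] image of a set of complex matrices, so [img Gamma f] is rewritten
     as the image of [rho(Gamma)]. *)
  pose rGam x := exists2 g, Gamma g & rho g = x.
  have imgE : img rGam (@cqmx n) = img Gamma f.
    apply: funext => x; apply: propext; split.
      by case=> _ [g Gg <-] <-; exists g.
    by case=> g Gg <-; exists (rho g) => //; exists g.
  have [psi [model det1]] : exists psi, real_model (img Gamma f) psi /\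
      forall g, img Gamma f g -> \det (psi g) = 1.
    rewrite -imgE; apply: (@det_fix _ rGam psi0); last by rewrite imgE.
    by move=> _ [g Gg <-]; case: (rSU g Gg).
  have [pinj pdisc] := real_model_faithful (img_Sp fSp) (img_subgroup Ggr e11 fM fSp) fdisc
    (img_torsion_free Ggr e11 fM fSp finj Gtf) model.
  case: model => pSp pM _ _.
  have imf g : Gamma g -> img Gamma f (f g) by move=> Gg; exists g.
  exists (fun g => rcmx (psi (f g))); split.
  + move=> g Gg; split; last by move=> i j; rewrite mxE.
    split; first by apply/cqmx_Sp; rewrite cqmx_rcmx; apply/pSp/imf.
    by rewrite /rcmx det_map_mx det1 ?rmorph1 //; apply: imf.
  + by move=> g h Gg Gh; rewrite fM // pM; [apply: map_mxM|apply: imf|apply: imf].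
  + move=> g h Gg Gh e; apply: finj => //; apply: pinj; [exact: imf|exact: imf|].
    by apply: (@qmx_inj n.+1 n.+1); rewrite -!cqmx_rcmx e.
  + move=> _ [g Gg <-]; have [|eps eps0 h] := pdisc (qmx (psi (f g))).
      by exists (f g) => //; apply: imf.
    exists eps => // _ [k Gk <-] near; apply: cqmx_inj; rewrite !cqmx_rcmx; apply: h.
      by exists (f k) => //; apply: imf.
    by rewrite -!cqmx_rcmx; apply/cqmx_near.
- have mE : @qmx_mul n = mulmx by apply: funext => A; apply: funext => B; apply: qmx_mulE.
  move: Ggr Gtf; rewrite mE qmx1E => Ggr Gtf.
  split; last first.
    move=> [rho [rO rM rinj rdisc]]; exists rho; split.
      by split=> // g /rO [].
    move=> g /rO [_ rr]; rewrite /qtr; elim/big_ind: _ => //.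
    exact: qrealD.
  move=> [rho [[rSp rM rinj rdisc] rtr]].
  have e11 : 1%:M *m 1%:M = 1%:M :> 'M[quat]_n.+1 by rewrite mulmx1.
  have imgE : img Gamma id = Gamma.
    apply: funext => x; apply: propext; split; first by case=> g Gg <-.
    by move=> Gx; exists x.
  have rdisc' : discrete (@qnear n) (img Gamma rho) by exact: rdisc.
  have Gnon' : q_nonelementary (img Gamma id) by rewrite imgE.
  have [psi model] := real_representation hn Ggr e11 (fun _ _ _ _ => erefl) GSU Gnon'
    Gtf rM rSp rinj rdisc' rtr.
  have [pinj pdisc] := real_model_faithful (img_Sp rSp) (img_subgroup Ggr e11 rM rSp) rdisc'
    (img_torsion_free Ggr e11 rM rSp rinj Gtf) model.
  case: model => pSp pM _ _.
  have imr g : Gamma g -> img Gamma rho (rho g) by move=> Gg; exists g.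
  exists (fun g => qmx (psi (rho g))); split.
  + move=> g Gg; split; first by apply/pSp/imr.
    by move=> i j; rewrite mxE.
  + by move=> g h Gg Gh; rewrite rM // pM; [apply: qmxM|apply: imr|apply: imr].
  + move=> g h Gg Gh /qmx_inj e; apply: rinj => //.
    by apply: pinj => //; apply: imr.
  + move=> _ [g Gg <-]; have [|eps eps0 h] := pdisc (qmx (psi (rho g))).
      by exists (rho g) => //; apply: imr.
    exists eps => // _ [k Gk <-] near; apply: h => //.
    by exists (rho k) => //; apply: imr.
Qed.
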